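(* Let $$\mathscr F^\ast:=\inf_{\Omega^N}\mathscr F,\qquad \mathcal M:=\{X\in\Omega^N:\ \mathscr F(X)=\mathscr F^\ast\},$$ and assume that $\mathcal M$ is nonempty and compact. Fix $r>0$ and set $\mathcal U_r:=\{X\in\Omega^N:\ \operatorname{dist}(X,\mathcal M)<r\}$, where $r$ is small enough that every $X\in\overline{\mathcal U_r}$ has pairwise distinct generators, and that $\overline{\mathcal U_r}\subset\Omega^N$ when $\Omega$ is a bounded domain. Assume that there is $C_1>0$ such that $$\mathscr D(X)\le C_1h\qquad\text{for every }X\in\mathcal U_r .$$ Let $v\in L^1((0,T);C^{0,1}(\Omega;\mathbb R^2))$, with $v\cdot n=0$ on $\partial\Omega$ when $\Omega$ is a bounded domain, and set $$\delta_r:=\inf\{\mathscr F(X)-\mathscr F^\ast:\ X\in\overline{\mathcal U_r},\ \operatorname{dist}(X,\mathcal M)=r\},$$ which is positive. If $X^0\in\mathcal U_r$ satisfies $\mathscr F(X^0)-\mathscr F^\ast<\delta_r$, then there is a nonnegative $\alpha\in L^1(0,T)$ such that the system $$\dot x_i(t)=v(t,x_i(t))+\alpha(t)\left(c_i(X(t))-x_i(t)\right),\qquad 1\le i\le N,$$ with $X(0)=X^0$ has a unique absolutely continuous solution $X=(x_1,\dots,x_N)$ on $[0,T]$, and $X(t)\in\mathcal U_r$ for every $t\in[0,T]$. In particular $\mathscr D(X(t))\le C_1h$ for every $t\in[0,T]$.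
   Context: Domain. $T>0$ is finite, $N\ge1$ is fixed. $\Omega$ is either a bounded convex Lipschitz domain of $\mathbb R^2$ or a flat torus $\Omega=\mathbb R^2/\mathcal L$, where $\mathcal L=\mathbb Z\ell_1+\mathbb Z\ell_2$ with $\ell_1,\ell_2\in\mathbb R^2$ linearly independent. On the torus, $|x-y|=\min_{k\in\mathcal L}|\tilde x-\tilde y-k|$ denotes the torus distance ($\tilde x,\tilde y\in\mathbb R^2$ representatives); balls and diameters are understood accordingly, and functions on $\Omega$ are identified with $\mathcal L$-periodic functions on $\mathbb R^2$. The mesh size is $h:=\sqrt{|\Omega|/N}$. Voronoi tessellation. For $X=(x_1,\dots,x_N)\in\Omega^N$ with pairwise distinct entries (generators), $\Omega_i(X):=\{x\in\Omega: |x-x_i|<|x-x_j|\ \text{for all } j\ne i\}$, $V_i(X):=|\Omega_i(X)|$, and $c_i(X):=V_i(X)^{-1}\int_{\Omega_i(X)}x\,dx$ is the centroid. On the torus, the displacement $c_i(X)-x_i\in\mathbb R^2$ is defined by $c_i-x_i=\frac1{V_i}\int_{P_i}(y-x_i)\,dy$, where, for representatives $x_j\in\mathbb R^2$, $P_i:=\{y\in\mathbb R^2:\ |y-x_i|\le|y-x_j-k|\ \text{for all } 1\le j\le N,\ k\in\mathcal L\}$ (Euclidean norms); it does not depend on the chosen representatives. $\mathscr D(X):=\max_{1\le i\le N}\operatorname{diam}(\Omega_i(X))$. Energy. $\mathscr F(X):=\sum_{i=1}^N\int_{\Omega_i(X)}|x-x_i|^2\,dx=\int_\Omega\min_{1\le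 i\le N}|x-x_i|^2\,dx$; the last expression is used to define $\mathscr F$ on all of $\overline\Omega^N$ (also when generators coincide), where it is continuous. Here $\operatorname{dist}$ is the distance on $\Omega^N$ induced by $|X-Y|=(\sum_i|x_i-y_i|^2)^{1/2}$, closures are taken in $\overline\Omega^N$, and $\inf\emptyset=+\infty$. *)

(* Defs.v *)
From HB Require Import structures.
From mathcomp Require Import all_boot all_order all_algebra.
From mathcomp Require Import all_classical all_reals all_analysis.
From mathcomp Require Import ring lra.

Set Implicit Arguments.
Unset Strict Implicit.
Unset Printing Implicit Defensive.

Import Order.TTheory GRing.Theory Num.Theory.
Import numFieldNormedType.Exports.

Local Open Scope classical_set_scope.
Local Open Scope ring_scope.

Section Plane.
Variable R : realType.
Implicit Types p q x y e n : R * R.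

Definition dot p q : R := p.1 * q.1 + p.2 * q.2.

(* The library norm on [R * R] is the sup norm; [enorm] is the Euclidean one.
   Both induce the same topology, so [open], [closure] etc. are used as is. *)
Definition enorm p : R := Num.sqrt (dot p p).

Definition perp p : R * R := (- p.2, p.1).

Definition lebesgue2 := (@lebesgue_measure R \x @lebesgue_measure R)%E.

Definition boundary (A : set (R * R)) : set (R * R) := closure A `\` A°.

(* Near [p], [A] is the strict epigraph of [g] in the orthonormal frame
   centred at [p] with axes [perp e] (abscissa) and [e] (ordinate). *)
Definition lipschitz_chart (A : set (R * R)) p e (g : R -> R) : Prop :=
  [/\ enorm e = 1,
      (exists k : R, k.-lipschitz g) &
      exists2 rho : R, 0 < rho &
        forall q, enorm (q - p) < rho ->
          (A q <-> g (dot (q - p) (perp e)) < dot (q - p) e)].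

Definition lipschitz_boundary (A : set (R * R)) : Prop :=
  forall p, boundary A p -> exists e g, lipschitz_chart A p e g.

(* [n] is the outward unit normal at a boundary point [p] where the boundary
   is differentiable. *)
Definition outward_normal (A : set (R * R)) p n : Prop :=
  exists e g, [/\ lipschitz_chart A p e g, derivable g 0 1 &
    n = (Num.sqrt (1 + derive1 g 0 ^+ 2))^-1 *: (derive1 g 0 *: perp e - e)].

Definition bounded_convex_lipschitz_domain (A : set (R * R)) : Prop :=
  [/\ A !=set0, open A, bounded_set A, convex_set A & lipschitz_boundary A].

Definition lattice (l1 l2 : R * R) : set (R * R) :=
  [set k | exists a b : int, k = l1 *~ a + l2 *~ b].

End Plane.

(* A point of the torus [R^2 / (Z l1 + Z l2)] is given by any representative in
   the plane; the functions and sets below are lattice-periodic. *)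
Inductive domain (R : realType) : Type :=
| Planar of set (R * R)
| Torus of R * R & R * R.
Arguments Torus {R} l1 l2.

Section Domain.
Variable R : realType.
Implicit Types (Om : domain R) (x y : R * R).

Definition admissible Om : Prop :=
  match Om with
  | Planar A => bounded_convex_lipschitz_domain A
  | Torus l1 l2 =>
      forall a b : R, a *: l1 + b *: l2 = 0 -> a = 0 /\ b = 0
  end.

Definition points Om : set (R * R) :=
  match Om with Planar A => A | Torus _ _ => setT end.

Definition same_point Om x y : Prop :=
  match Om with
  | Planar _ => x = y
  | Torus l1 l2 => lattice l1 l2 (x - y)
  end.

(* For linearly independent [l1], [l2] the infimum is a minimum. *)
Definition pdist Om x y : R :=
  match Om with
  | Planar _ => enorm (x - y)
  | Torus l1 l2 => inf [set enorm (x - y - k) | k in lattice l1 l2]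
  end.

(* A set containing exactly one representative of each point. *)
Definition fundamental Om : set (R * R) :=
  match Om with
  | Planar A => A
  | Torus l1 l2 => [set z | exists s t : R,
      [/\ 0 <= s < 1, 0 <= t < 1 & z = s *: l1 + t *: l2]]
  end.

Definition area Om (A : set (R * R)) : R :=
  fine (lebesgue2 (A `&` fundamental Om)).

Definition diam Om (A : set (R * R)) : R :=
  sup [set pdist Om z.1 z.2 | z in A `*` A].

End Domain.

Definition config (R : realType) (Om : domain R) (N : nat) : Type :=
  'I_N -> R * R.

Section ConfigDistance.
Variable R : realType.
Implicit Types Om : domain R.

Definition cdist Om N (X Y : config Om N) : R :=
  Num.sqrt (\sum_(i < N) pdist Om (X i) (Y i) ^+ 2).

Lemma cauchy_schwarz_sum N (a b : 'I_N -> R) :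
  (\sum_i a i * b i) ^+ 2 <= (\sum_i a i ^+ 2) * (\sum_i b i ^+ 2).
Proof.
have H : 0 <= \sum_i \sum_j (a i * b j - a j * b i) ^+ 2.
  by apply: sumr_ge0 => i _; apply: sumr_ge0 => j _; exact: sqr_ge0.
suff E : \sum_i \sum_j (a i * b j - a j * b i) ^+ 2 =
    2 * ((\sum_i a i ^+ 2) * (\sum_i b i ^+ 2) - (\sum_i a i * b i) ^+ 2).
  by move: H; rewrite E pmulr_rge0// subr_ge0.
pose P := \sum_i \sum_j a i ^+ 2 * b j ^+ 2.
pose Q := \sum_i \sum_j (a i * b i) * (a j * b j).
have -> : (\sum_i a i ^+ 2) * (\sum_i b i ^+ 2) = P.
  by rewrite mulr_suml; apply: eq_bigr => i _; rewrite mulr_sumr.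
have -> : (\sum_i a i * b i) ^+ 2 = Q.
  by rewrite expr2 mulr_suml; apply: eq_bigr => i _; rewrite mulr_sumr.
transitivity (P + P - (Q + Q)); last by ring.
have {2}-> : P = \sum_i \sum_j a j ^+ 2 * b i ^+ 2 by exact: exchange_big.
rewrite -!big_split -sumrB /=; apply: eq_bigr => i _.
rewrite -!big_split -sumrB /=; apply: eq_bigr => j _.
by ring.
Qed.

Lemma minkowski_sum N (a b : 'I_N -> R) :
  Num.sqrt (\sum_i (a i + b i) ^+ 2) <=
  Num.sqrt (\sum_i a i ^+ 2) + Num.sqrt (\sum_i b i ^+ 2).
Proof.
have A0 : 0 <= \sum_i a i ^+ 2 by apply: sumr_ge0 => i _; exact: sqr_ge0.
have B0 : 0 <= \sum_i b i ^+ 2 by apply: sumr_ge0 => i _; exact: sqr_ge0.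
set A := \sum_i a i ^+ 2 in A0 *; set B := \sum_i b i ^+ 2 in B0 *.
have S0 : 0 <= Num.sqrt A + Num.sqrt B by rewrite addr_ge0// sqrtr_ge0.
rewrite -[leRHS]ger0_norm// -sqrtr_sqr ler_wsqrtr//.
have -> : \sum_i (a i + b i) ^+ 2 = A + B + 2 * \sum_i a i * b i.
  rewrite mulr_sumr -!big_split; apply: eq_bigr => i _ /=; ring.
have -> : (Num.sqrt A + Num.sqrt B) ^+ 2 =
    A + B + 2 * (Num.sqrt A * Num.sqrt B).
  rewrite sqrrD !sqr_sqrtr//; ring.
rewrite lerD2l ler_wpM2l// -sqrtrM// (le_trans (ler_norm _))//.
by rewrite -sqrtr_sqr ler_wsqrtr// cauchy_schwarz_sum.
Qed.

Lemma enorm_ge0 (p : R * R) : 0 <= enorm p.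
Proof. exact: sqrtr_ge0. Qed.

Lemma enorm0 : enorm (0 : R * R) = 0.
Proof. by rewrite /enorm /dot /= mulr0 addr0 sqrtr0. Qed.

Lemma enormN (p : R * R) : enorm (- p) = enorm p.
Proof. by rewrite /enorm /dot /= !mulrNN. Qed.

Lemma enormD (p q : R * R) : enorm (p + q) <= enorm p + enorm q.
Proof.
have := @minkowski_sum 2 (fun i => if i == ord0 then p.1 else p.2)
  (fun i => if i == ord0 then q.1 else q.2).
by rewrite !big_ord_recl !big_ord0 /= !addr0.
Qed.

Let lattice_dists (l1 l2 x y : R * R) :=
  [set enorm (x - y - k) | k in lattice l1 l2].

Let lattice0 (l1 l2 : R * R) : lattice l1 l2 0.
Proof. by exists 0, 0; rewrite !mulr0z addr0. Qed.

Let latticeN (l1 l2 k : R * R) : lattice l1 l2 k -> lattice l1 l2 (- k).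
Proof. by move=> [a [b ->]]; exists (- a), (- b); rewrite !mulrNz opprD. Qed.

Let latticeD (l1 l2 k k' : R * R) :
  lattice l1 l2 k -> lattice l1 l2 k' -> lattice l1 l2 (k + k').
Proof.
move=> [a [b ->]] [c [d ->]]; exists (a + c), (b + d).
by rewrite !mulrzDr addrACA.
Qed.

Let lattice_dists_has_inf (l1 l2 x y : R * R) :
  has_inf (lattice_dists l1 l2 x y).
Proof.
split; first by exists (enorm (x - y - 0)); exists 0.
by exists 0 => _ [k _ <-]; exact: enorm_ge0.
Qed.

Lemma pdist_ge0 Om (x y : R * R) : 0 <= pdist Om x y.
Proof.
case: Om => [A|l1 l2] /=; first exact: enorm_ge0.
apply: lb_le_inf; first by case: (lattice_dists_has_inf l1 l2 x y).
by move=> _ [k _ <-]; exact: enorm_ge0.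
Qed.

Lemma pdistxx Om (x : R * R) : pdist Om x x = 0.
Proof.
apply/eqP; rewrite eq_le pdist_ge0 andbT.
case: Om => [A|l1 l2] /=; rewrite subrr ?enorm0//.
apply: ge_inf; first by exists 0 => _ [k _ <-]; exact: enorm_ge0.
by exists 0 => //; rewrite subrr enorm0.
Qed.

Lemma pdistC Om (x y : R * R) : pdist Om x y = pdist Om y x.
Proof.
case: Om => [A|l1 l2] /=; first by rewrite -enormN opprB.
congr inf; apply/seteqP; split=> _ [k lk <-];
  (exists (- k); [exact: latticeN|]);
  by rewrite -[LHS]enormN opprB opprB addrC.
Qed.

Lemma pdist_triangle Om (x y z : R * R) :
  pdist Om x z <= pdist Om x y + pdist Om y z.
Proof.
case: Om => [A|l1 l2] /=.
  by rewrite (le_trans _ (enormD _ _))// addrA subrK.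
apply/ler_addgt0Pr => e e0; have e20 : 0 < e / 2 by rewrite divr_gt0.
have [_ [k lk <-] hk] := inf_adherent e20 (lattice_dists_has_inf l1 l2 x y).
have [_ [k' lk' <-] hk'] := inf_adherent e20 (lattice_dists_has_inf l1 l2 y z).
apply: (@le_trans _ _ (enorm (x - z - (k + k')))).
  apply: ge_inf; first by exists 0 => _ [? _ <-]; exact: enorm_ge0.
  by exists (k + k') => //; exact: latticeD.
have -> : x - z - (k + k') = (x - y - k) + (y - z - k').
  by rewrite (addrACA (x - y)) (addrA (x - y)) subrK opprD.
rewrite (le_trans (enormD _ _))//.
rewrite /lattice_dists in hk hk'; lra.
Qed.

Variables (Om : domain R) (N : nat).
Implicit Types X Y Z : config Om N.

Lemma cdistxx X : cdist X X = 0.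
Proof.
by rewrite /cdist big1 ?sqrtr0// => i _; rewrite pdistxx expr0n.
Qed.

Lemma cdistC X Y : cdist X Y = cdist Y X.
Proof. by congr Num.sqrt; apply: eq_bigr => i _; rewrite pdistC. Qed.

Lemma cdist_triangle X Y Z : cdist X Z <= cdist X Y + cdist Y Z.
Proof.
apply: le_trans (minkowski_sum _ _); apply: ler_wsqrtr; apply: ler_sum => i _.
by rewrite lerXn2r ?nnegrE ?addr_ge0 ?pdist_ge0// pdist_triangle.
Qed.

Definition config_ball X (e : R) : set (config Om N) := [set Y | cdist X Y < e].

Lemma config_ball_center X (e : R) : 0 < e -> config_ball X e X.
Proof. by move=> e0; rewrite /config_ball /= cdistxx. Qed.

Lemma config_ball_sym X Y (e : R) : config_ball X e Y -> config_ball Y e X.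
Proof. by rewrite /config_ball /= cdistC. Qed.

Lemma config_ball_triangle X Y Z (e1 e2 : R) :
  config_ball X e1 Y -> config_ball Y e2 Z -> config_ball X (e1 + e2) Z.
Proof.
rewrite /config_ball /= => ? ?.
by rewrite (le_lt_trans (cdist_triangle _ Y _))// ltrD.
Qed.

(* Only a pseudometric on the torus, where points are given by representatives;
   it provides [closure] and [compact] for sets of configurations. *)
HB.instance Definition _ := Choice.on (config Om N).

HB.instance Definition _ :=
  hasNbhs.Build (config Om N) (nbhs_ (entourage_ config_ball)).

HB.instance Definition _ := @Nbhs_isPseudoMetric.Build R (config Om N)
  (entourage_ config_ball) erefl config_ball config_ball_center config_ball_sym
  config_ball_triangle erefl.

End ConfigDistance.

Section Voronoi.
Variables (R : realType) (Om : domain R) (N : nat).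
Implicit Types (X Y : config Om N) (A : set (config Om N)).

Definition configs : set (config Om N) := [set X | forall i, points Om (X i)].

Definition pairwise_distinct X : Prop :=
  forall i j, i != j -> ~ same_point Om (X i) (X j).

Definition mesh_size : R := Num.sqrt (area Om setT / N%:R).

Definition cell X (i : 'I_N) : set (R * R) :=
  [set x | points Om x /\
           forall j, j != i -> pdist Om x (X i) < pdist Om x (X j)].

Definition cell_area X i : R := area Om (cell X i).

Definition vintegral (A : set (R * R)) (f : R * R -> R * R) : R * R :=
  ((\int[@lebesgue2 R]_(x in A) (f x).1)%R,
   (\int[@lebesgue2 R]_(x in A) (f x).2)%R).

Definition lattice_cell (l1 l2 : R * R) X i : set (R * R) :=
  [set y | forall j k, lattice l1 l2 k ->
           enorm (y - X i) <= enorm (y - X j - k)].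

Definition centroid X i : R * R :=
  (cell_area X i)^-1 *: vintegral (cell X i) id.

(* The difference c_i(X) - x_i. *)
Definition displacement X i : R * R :=
  match Om with
  | Planar _ => centroid X i - X i
  | Torus l1 l2 =>
      (cell_area X i)^-1 *:
        vintegral (lattice_cell l1 l2 X i) (fun y => y - X i)
  end.

Definition max_diam X : R := \big[Num.max/0]_(i < N) diam Om (cell X i).

Definition energy X : R :=
  (\int[@lebesgue2 R]_(x in fundamental Om)
     inf [set pdist Om x (X i) ^+ 2 | i in [set: 'I_N]])%R.

Definition min_energy : R := inf [set energy X | X in configs].

Definition minimizers : set (config Om N) :=
  [set X | configs X /\ energy X = min_energy].

Definition dist_to X A : R := inf [set cdist X Y | Y in A].

Definition tube (r : R) : set (config Om N) :=
  [set X | configs X /\ dist_to X minimizers < r].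

Definition energy_gap (r : R) : \bar R :=
  ereal_inf [set (energy X - min_energy)%:E | X in
    [set X | closure (tube r) X /\ dist_to X minimizers = r]].

End Voronoi.
Arguments configs {R} Om N.
Arguments mesh_size {R} Om N.
Arguments min_energy {R} Om N.
Arguments minimizers {R} Om N.
Arguments tube {R} Om N r.
Arguments energy_gap {R} Om N r.

Section Velocity.
Variables (R : realType) (Om : domain R).
Implicit Types (f : R * R -> R * R) (v : R -> R * R -> R * R).

(* In the Lipschitz seminorm the pairs with [pdist Om x y = 0] contribute [0],
   by the convention [0^-1 = 0]. *)
Definition C01_norm f : \bar R :=
  (ereal_sup [set (enorm (f x))%:E | x in points Om] +
   ereal_sup [set (enorm (f z.1 - f z.2) / pdist Om z.1 z.2)%:E
             | z in points Om `*` points Om])%E.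

Definition C01 f : Prop :=
  (forall x y, same_point Om x y -> f x = f y) /\ (C01_norm f < +oo)%E.

Definition simple_C01 v : Prop :=
  exists (m : nat) (E : 'I_m -> set R) (f : 'I_m -> R * R -> R * R),
    [/\ forall k, measurable (E k), forall k, C01 (f k) &
        forall t x, v t x = \sum_(k < m) (\1_(E k) t : R) *: f k x].

(* The Bochner space L^1((0,T); C^{0,1}). *)
Definition L1_C01 (T : R) v : Prop :=
  [/\ {ae lebesgue_measure, forall t : R, 0 < t < T -> C01 (v t)},
      (exists2 s : nat -> R -> R * R -> R * R,
         forall n, simple_C01 (s n) &
         {ae lebesgue_measure, forall t : R, 0 < t < T ->
           C01_norm (fun x => s n t x - v t x) @[n --> \oo] --> 0%E}) &
      (\int[lebesgue_measure]_(t in `]0%R, T[) C01_norm (v t) < +oo)%E].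

(* For a Lipschitz field [f] on an open set, the limit is [f(p) . n] for the
   continuous extension of [f] to the closure. *)
Definition tangential f : Prop :=
  match Om with
  | Planar A => forall p n, boundary A p -> outward_normal A p n ->
      dot (f x) n @[x --> within A (nbhs p)] --> (0 : R)
  | Torus _ _ => True
  end.

End Velocity.

Section Flow.
Variables (R : realType) (Om : domain R) (N : nat).

Definition absolutely_continuous (T : R) (g : R -> R * R) : Prop :=
  forall e : R, 0 < e -> exists2 d : R, 0 < d &
    forall (m : nat) (a b : 'I_m -> R),
      (forall k, 0 <= a k <= b k /\ b k <= T) ->
      trivIset setT (fun k => [set` `]a k, b k[]) ->
      \sum_(k < m) (b k - a k) < d ->
      \sum_(k < m) enorm (g (b k) - g (a k)) < e.

(* On the torus, [X] is the lift to the plane of a curve of configurations,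
   starting at the given representatives [X0]. *)
Definition solution (T : R) (v : R -> R * R -> R * R) (alpha : R -> R)
    (X0 : config Om N) (X : R -> config Om N) : Prop :=
  [/\ forall i, absolutely_continuous T (fun t => X t i),
      X 0 = X0,
      forall t, 0 <= t <= T -> configs Om N (X t) /\ pairwise_distinct (X t) &
      {ae lebesgue_measure, forall t : R, 0 < t < T -> forall i,
         is_derive t (1 : R) (fun s => X s i : R * R)
           (v t (X t i) + alpha t *: displacement (X t) i)}].

End Flow.

(* Main.v *)
(** The energy [F] is, up to an error quadratic in the displacement of the
    generators, affine along moves of the generators, with gradient
    [- 2 V_i (c_i - x_i)], and [V_i] and [c_i - x_i] are Lipschitz functions of
    [X] as long as the generators stay uniformly separated, which they do on
    the compact closure of the tube.  Both follow by lifting the generators to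
    finitely many points of the plane and bounding the area of the strips around
    their bisectors.

    Choose [alpha t = K m t], where [m] is an integrable majorant of the norm of
    [v].  Since [m |d| - K m |d|^2 <= m / (4 K)], the energy of a solution in the
    tube grows by at most [N C / (2 K)] times the integral of [m], which stays
    below the energy gap for [K] large; as the energy of exit configurations is
    at least the gap, the solution cannot leave the tube.  Existence and
    uniqueness come from Picard iteration in a weighted norm, after multiplying
    the field by a Lipschitz cutoff [chi] of the energy, which makes it globally
    Lipschitz and equals [1] along all solutions. *)

Require Import Defs.
From HB Require Import structures.
From mathcomp Require Import all_boot all_order all_algebra.
From mathcomp Require Import all_classical all_reals all_analysis.
From mathcomp Require Import measurable_realfun.
From mathcomp Require Import zify ring lra.

Import Order.TTheory GRing.Theory Num.Theory.
Import numFieldNormedType.Exports.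

Local Open Scope classical_set_scope.
Local Open Scope ring_scope.

Set Implicit Arguments.
Unset Strict Implicit.
Unset Printing Implicit Defensive.

(** * Absolutely continuous functions *)

(** The energy is never differentiated. One inequality is enough: freezing the cells of [X] while
    the generators move to [Y] bounds [energy Y] from above by an explicit expression in the areas
    and displacements of [X]. A monotonicity criterion for absolutely continuous functions turns
    this one-sided bound into a descent estimate and so replaces the chain rule along curves that
    are differentiable only almost everywhere. The cutoff depends on the energy because a curve can
    leave the tube only through configurations of energy at least [e1]; a level [e0 < e1] above the
    initial energy leaves room for a Lipschitz transition. Uniqueness concerns every solution, also
    one not known to stay in the tube, so the descent is run up to the first exit, for the cut-off
    field and for the original one alike. With [alpha] proportional to [m], the bound and the
    Lipschitz constant of the field are both a constant times [m t]. Planar domains and tori are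
    handled together by giving the former the lattice [{0}]. *)

Section AbsoluteContinuity.
Variable R : realType.
Implicit Types (T : R) (w : R -> R -> R) (s : seq (R * R)).

(** The increment [w] stays abstract so that coordinates, Euclidean norms, the energy and sums of
    these share one set of closure lemmas. *)
Definition ac_increments T w : Prop :=
  forall e : R, 0 < e -> exists2 d : R, 0 < d &
    forall (m : nat) (a b : 'I_m -> R),
      (forall k, 0 <= a k <= b k /\ b k <= T) ->
      trivIset setT (fun k => [set` `]a k, b k[]) ->
      \sum_(k < m) (b k - a k) < d ->
      \sum_(k < m) w (a k) (b k) < e.

Lemma ac_increments_le T w w' C : 0 <= C ->
  (forall a b, 0 <= a <= b -> b <= T -> w' a b <= C * w a b) ->
  ac_increments T w -> ac_increments T w'.
Proof.
move=> C0 H ac e e0.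
have C1 : 0 < C + 1 by rewrite ltr_wpDl.
have [d d0 Hd] := ac _ (divr_gt0 e0 C1).
exists d => // m a b ab tr sd.
have E0 : 0 < e / (C + 1) by rewrite divr_gt0.
apply: (@le_lt_trans _ _ (C * (\sum_(k < m) w (a k) (b k)))).
  by rewrite mulr_sumr; apply: ler_sum => k _; apply: H; case: (ab k).
apply: (@le_lt_trans _ _ (C * (e / (C + 1)))).
  by rewrite ler_wpM2l// ltW// Hd.
by rewrite mulrCA -[ltRHS]mulr1 ltr_pM2l// ltr_pdivrMr// mul1r ltrDl.
Qed.

Lemma ac_incrementsD T w1 w2 :
  ac_increments T w1 -> ac_increments T w2 ->
  ac_increments T (fun a b => w1 a b + w2 a b).
Proof.
move=> h1 h2 e e0.
have e20 : 0 < e / 2 by rewrite divr_gt0.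
have [d1 d10 H1] := h1 _ e20; have [d2 d20 H2] := h2 _ e20.
exists (Num.min d1 d2); first by rewrite lt_min d10.
move=> m a b ab tr; rewrite lt_min => /andP[s1 s2].
by rewrite big_split/= (splitr e) ltrD// ?H1 ?H2.
Qed.

Lemma ac_increments_S T T' w : T' <= T ->
  ac_increments T w -> ac_increments T' w.
Proof.
move=> TT h e e0; have [d d0 H] := h _ e0; exists d => // m a b ab.
by apply: H => k; have [? ?] := ab k; split=> //; exact: le_trans TT.
Qed.

Lemma ac_increments_sum T (I : finType) (w : I -> R -> R -> R) :
  (forall i, ac_increments T (w i)) ->
  ac_increments T (fun a b => \sum_i w i a b).
Proof.
move=> h.
suff H (s : seq I) : ac_increments T (fun a b => \sum_(i <- s) w i a b) by exact: H.
elim: s => [|i s IH].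
  move=> e e0; exists 1 => // m a b _ _ _.
  by rewrite big1// => k _; rewrite big_nil.
have := ac_incrementsD (h i) IH; congr ac_increments.
by apply/funext => a; apply/funext => b; rewrite big_cons.
Qed.

Lemma ac_increments_continuous T (f : R -> R) x : 0 <= x <= T ->
  ac_increments T (fun a b => `|f b - f a|) ->
  forall e : R, 0 < e -> exists2 d : R, 0 < d &
    forall y, 0 <= y <= T -> `|y - x| < d -> `|f y - f x| < e.
Proof.
move=> /andP[x0 xT] ac e e0; have [d d0 H] := ac _ e0; exists d => // y.
move=> /andP[y0 yT] yx.
have [xy|yx'] := leP x y.
  have := H 1%N (fun=> x) (fun=> y); rewrite !big_ord1; apply => //.
  - by move=> _; rewrite x0 xy.
  - by move=> i j; rewrite !ord1.
  - by rewrite -(ger0_norm (_ : 0 <= y - x)) ?subr_ge0.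
have := H 1%N (fun=> y) (fun=> x); rewrite !big_ord1 distrC; apply => //.
- by move=> _; rewrite y0 (ltW yx').
- by move=> i j; rewrite !ord1.
- by rewrite -(ger0_norm (_ : 0 <= x - y)) ?subr_ge0 1?distrC// ltW.
Qed.

(** Lists are used because the supremum argument below concatenates families; [chained_sum] converts
    back to the indexed families of [ac_increments]. *)
Let chained (a b : R) (U : set R) s :=
  all (fun p => [&& a <= p.1, p.1 <= p.2 & p.2 <= b]) s /\
  (forall p, p \in s -> `]p.1, p.2[ `<=` U) /\
  pairwise (fun p q : R * R => p.2 <= q.1) s.

Let chained_cat a b c U s s' : a <= b -> b <= c ->
  chained a b U s -> chained b c U s' -> chained a c U (s ++ s').
Proof.
move=> ab bc [A [B C]] [A' [B' C']]; split; [|split].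
- rewrite all_cat; apply/andP; split.
    apply: sub_all A => p /and3P[-> -> /= h]; exact: le_trans bc.
  apply: sub_all A' => p /and3P[h -> ->] /=; rewrite andbT; exact: le_trans h.
- by move=> p; rewrite mem_cat => /orP[/B|/B'].
- rewrite pairwise_cat C C' !andbT; apply/allrelP => p q ps qs.
  have /and3P[_ _ h1] := allP A _ ps; have /and3P[h2 _ _] := allP A' _ qs.
  exact: le_trans h2.
Qed.

(** The intervals are disjoint and contained in [U], so their total length is at most the measure of
    [U], which lies below the budget [d]. *)
Let chained_sum T U (w : R -> R -> R) e d :
  measurable U -> (lebesgue_measure U < d%:E)%E ->
  (forall (m : nat) (a b : 'I_m -> R),
      (forall k, 0 <= a k <= b k /\ b k <= T) ->
      trivIset setT (fun k => [set` `]a k, b k[]) ->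
      \sum_(k < m) (b k - a k) < d ->
      \sum_(k < m) w (a k) (b k) < e) ->
  forall s, chained 0 T U s -> \sum_(p <- s) w p.1 p.2 < e.
Proof.
move=> mU Ud H s [A [B C]].
pose t := in_tuple s.
pose a (k : 'I_(size s)) := (tnth t k).1.
pose b (k : 'I_(size s)) := (tnth t k).2.
have ab k : 0 <= a k <= b k /\ b k <= T.
  have := allP A (tnth t k); rewrite mem_tnth => /(_ isT) /and3P[h1 h2 h3].
  by rewrite /a /b h1 h2.
have tr : trivIset setT (fun k => [set` `]a k, b k[]).
  have lt_disj (i j : 'I_(size s)) x : (i < j)%N ->
      a i < x < b i -> a j < x < b j -> False.
    move=> ij /andP[_ xi] /andP[xj _].
    have /(pairwiseP (0,0)) := C => /(_ i j); rewrite !inE.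
    move=> /(_ (ltn_ord i) (ltn_ord j) ij).
    rewrite -!(tnth_nth _ t) => h.
    by have := lt_trans (lt_le_trans xi h) xj; rewrite ltxx.
  move=> i j _ _ [x [/=]]; rewrite !in_itv/= => xi xj.
  by apply/val_inj; case: (ltngtP i j) => // h;
    [have := lt_disj _ _ _ h xi xj|have := lt_disj _ _ _ h xj xi].
have -> : \sum_(p <- s) w p.1 p.2 = \sum_(k < size s) w (a k) (b k).
  by rewrite -[in LHS](in_tupleE s) big_tuple.
apply: H => //; rewrite -lte_fin -sumEFin.
apply: le_lt_trans Ud.
rewrite (eq_bigr (fun k => lebesgue_measure [set` `]a k, b k[])); last first.
  move=> k _; rewrite lebesgue_measure_itv/= lte_fin.
  have [/andP[_ abk] _] := ab k; case: ltP => // h.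
  by rewrite (_ : b k = a k) ?subrr//; apply/eqP; rewrite eq_le h.
rewrite -measure_bigsetU_ord//.
apply: le_measure; rewrite ?inE//.
  by apply: bigsetU_measurable => k _; exact: measurable_itv.
move=> x; rewrite -bigcup_seq => -[k _]; apply: B.
exact: mem_tnth.
Qed.

(* A point of a small open cover of the exceptional null set is crossed by an
   interval of the absolute continuity budget, any other one by the derivative
   bound; a supremum argument chains such intervals from [0] to [T]. *)
Lemma ac_nonincreasing T (f : R -> R) : 0 <= T ->
  ac_increments T (fun a b => `|f b - f a|) ->
  {ae lebesgue_measure, forall t : R, 0 < t < T ->
     forall e : R, 0 < e -> exists2 g : R, 0 < g &
       forall a b, 0 <= a <= t -> t <= b <= T -> t - a < g -> b - t < g ->
         f b - f a <= e * (b - a)} ->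
  f T <= f 0.
Proof.
move=> T0 ac [B [mB B0 HB]]; apply/ler_addgt0Pr => e0 e00.
(* The total error will be [e * T] from the derivative bounds plus [e] from the intervals inside
   [U], hence the denominator [T + 1]. *)
pose e := e0 / (T + 1).
have T10 : 0 < T + 1 by rewrite ltr_wpDl.
have ee : 0 < e by rewrite divr_gt0.
have [d d0 Hd] := ac _ ee.
(* The hypothesis says nothing at the endpoints, so they join the exceptional set. *)
pose B' := B `|` [set 0; T].
have m2 : measurable [set 0; T] by apply: measurableU; exact: measurable_set1.
have mB' : measurable B' by exact: measurableU.
have B'0 : lebesgue_measure B' = 0%E.
  apply/eqP; rewrite eq_le measure_ge0 andbT.
  apply: (le_trans (measureU2 _ _ _)) => //.
  rewrite [X in (X + _)%E](_ : _ = 0%E) // add0e.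
  apply: (le_trans (measureU2 _ _ _)) => //.
  by rewrite -[leRHS]adde0; apply: leeD; rewrite le_eqVlt; apply/orP; left; apply/eqP; exact: lebesgue_measure_set1.
have [] := @lebesgue_regularity_outer R B' d _ _ d0.
  - exact: mB'.
  - by apply: (@le_lt_trans _ _ 0%E); [rewrite le_eqVlt; apply/orP; left; apply/eqP; exact: B'0|].
move=> U [oU BU Ud].
have mU : measurable U by exact: measurable_realfun.open_measurable.
have {}Ud : (lebesgue_measure U < d%:E)%E.
  apply: le_lt_trans Ud.
  rewrite -[in leLHS](setDUK BU).
  apply: (le_trans (measureU2 _ _ _)) => //; first exact: measurableD.
  by rewrite [X in (X + _)%E](_ : _ = 0%E) ?add0e.
have CS := @chained_sum T U (fun a b => `|f b - f a|) e d mU Ud Hd.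
(* The increment over [[a, b]] is paid for partly by slope [e] and partly by a chain inside [U];
   both costs add up under concatenation. *)
pose good a b := exists2 s, chained a b U s &
  f b - f a <= e * (b - a) + \sum_(p <- s) `|f p.2 - f p.1|.
have good_cat a b c : a <= b -> b <= c -> good a b -> good b c -> good a c.
  move=> ab bc [s h1 h2] [s' h1' h2']; exists (s ++ s').
    exact: (@chained_cat a b c).
  rewrite big_cat/=.
  have -> : f c - f a = (f b - f a) + (f c - f b) by ring.
  apply: le_trans (lerD h2 h2') _; rewrite addrACA -mulrDr.
  by have -> : b - a + (c - b) = c - a by ring.
have loc t : 0 <= t <= T -> exists2 g : R, 0 < g &
    forall a b, 0 <= a <= t -> t <= b <= T -> t - a < g -> b - t < g -> good a b.
  move=> /andP[t0 tT]; have [Ut|nUt] := pselect (U t).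
    have /nbhs_ballP[g /= g0 Hg] : nbhs t U by exact: open_nbhs_nbhs.
    exists g => // a b /andP[a0 at_] /andP[tb bT] ag bg.
    exists [:: (a, b)].
      split; first by rewrite /= lexx (le_trans at_ tb) lexx.
      split=> // p; rewrite inE => /eqP -> x /=; rewrite in_itv/= => /andP[ax xb].
      apply: Hg; rewrite /ball/= ltr_distlC; apply/andP; split.
        by rewrite (le_lt_trans _ ax)// lerBlDr -lerBlDl ltW.
      by rewrite (lt_le_trans xb)// -lerBlDl ltW.
    rewrite big_seq1/= (le_trans (ler_norm _))// lerDr mulr_ge0 ?(ltW ee)//.
    by rewrite subr_ge0 (le_trans at_).
  have nB' : ~ B' t by move/BU.
  have tT' : 0 < t < T.
    rewrite !lt_neqAle t0 tT !andbT; apply/andP.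
    by split; (apply/eqP => E; apply: nB'; right); [left|right].
  have P : forall e : R, 0 < e -> exists2 g : R, 0 < g &
       forall a b, 0 <= a <= t -> t <= b <= T -> t - a < g -> b - t < g ->
         f b - f a <= e * (b - a).
    apply: contrapT => nP; apply: nB'; left; apply: HB => /= h; apply: nP.
    exact: h.
  have [g g0 Hg] := P _ ee; exists g => // a b ha hb ag bg.
  exists [::]; first by split.
  by rewrite big_nil addr0; exact: Hg.
pose S := [set x | 0 <= x <= T /\ good 0 x].
have S0 : S 0.
  split; first by rewrite lexx.
  by exists [::]; rewrite ?big_nil ?subrr ?mulr0 ?addr0//; split.
have hS : has_sup S.
  by split; [exists 0|exists T => x [/andP[]]].
set z := sup S.
have z0T : 0 <= z <= T.
  apply/andP; split; first by apply: ub_le_sup => //; case: hS.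
  by apply: ge_sup => //; [exists 0|move=> x [/andP[]]].
have [g g0 Hg] := loc z z0T.
(* The supremum is attained: the local property at [z] bridges the gap from a nearby element of [S]
   up to [z]. *)
have Sz : good 0 z.
  have [x [x0T gx] zx] := sup_adherent g0 hS.
  have xz : x <= z by apply: ub_le_sup; [case: hS|].
  have /andP[x0 xT] := x0T; have /andP[z0 zT] := z0T.
  apply: (good_cat 0 x z) => //; apply: Hg; rewrite ?x0 ?xz ?lexx ?zT//.
    by rewrite ltrBlDr -ltrBlDl.
  by rewrite subrr.
have zT : z = T.
  apply/eqP; rewrite eq_le; case/andP: z0T => z0 -> /=; rewrite leNgt; apply/negP => zT.
  (* If [z < T], the same local property reaches beyond [z], against its choice as a supremum. *)
  pose y := Num.min T (z + g / 2).
  have zy : z < y by rewrite lt_min zT ltrDl divr_gt0.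
  have yT : y <= T by rewrite ge_min lexx.
  have : S y.
    split; first by rewrite yT andbT (le_trans z0)// ltW.
    apply: (good_cat 0 z y) => //; first exact: ltW.
    apply: Hg; rewrite ?z0 ?lexx ?yT ?(ltW zy) ?subrr//.
    rewrite ltrBlDl (@le_lt_trans _ _ (z + g / 2))//; first by rewrite ge_min lexx orbT.
    by rewrite ltrD2l ltr_pdivrMr// ltr_pMr// ltr1n.
  move=> /(ub_le_sup (proj2 hS)); rewrite -/z => h.
  by have := lt_le_trans zy h; rewrite ltxx.
rewrite zT in Sz; case: Sz => s hs.
rewrite subr0 lerBlDl => h; apply: (le_trans h); rewrite lerD2l.
have -> : e0 = e * T + e by rewrite -[X in _ + X]mulr1 -mulrDr mulfVK ?gt_eqF.
by rewrite lerD2l ltW// CS.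
Qed.

End AbsoluteContinuity.

(** * Indefinite integrals of integrable functions on the line *)

Section IndefiniteIntegral.
Variable R : realType.
Implicit Types (f h : R -> R) (T t : R).
Notation mu := (@lebesgue_measure R).
Notation intble h := (mu.-integrable setT (EFin \o h)).

Lemma is_derive_linear_bound f (t l : R) : is_derive t (1 : R) f l ->
  forall e : R, 0 < e -> exists2 g : R, 0 < g &
    forall y, `|y - t| < g -> `|f y - f t - l * (y - t)| <= e * `|y - t|.
Proof.
move=> [df dl] e e0.
have /cvgrPdist_le /(_ _ e0) : (fun u : R => u^-1 *: (f (u *: 1 + t) - f t)) u @[u --> 0^'] --> l.
  by rewrite -dl.
move=> /nbhs_ballP[g /= g0 Hg]; exists g => // y yt.
have [->|nyt] := eqVneq y t; first by rewrite !subrr mulr0 subr0 normr0 mulr0.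
have nz : y - t != 0 by rewrite subr_eq0.
have := Hg (y - t); rewrite /ball/= sub0r normrN => /(_ yt nz).
rewrite scaler1 subrK => H.
have -> : f y - f t - l * (y - t) = - ((l - (y - t)^-1 * (f y - f t)) * (y - t)).
  by field.
by rewrite normrN normrM ler_wpM2r.
Qed.

(** Starting at [-oo] avoids oriented integrals; the integrands of the differential equation vanish
    at nonpositive times, so their [Iint] at [0] is [0]. *)
Definition Iint h t : R := \int[mu]_(s in `]-oo, t]) h s.

Lemma IintB h a b : intble h -> a <= b ->
  Iint h b - Iint h a = \int[mu]_(s in `]a, b]) h s.
Proof.
move=> ih ab; apply: Rintegral_itvB => //; first by apply: integrableS ih.
Qed.

Lemma intble_norm h : intble h -> intble (fun s => `|h s|).
Proof. by move=> /integrable_norm. Qed.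

Lemma intbleZ (c : R) h : intble h -> intble (fun s => c * h s).
Proof.
move=> ih; have -> : EFin \o (fun s => c * h s) = (fun s => c%:E * (EFin \o h) s)%E by [].
exact: integrableZl.
Qed.

Lemma Iint_incr_le h (k : R -> R) a b : intble h -> intble k ->
  (forall s, `|h s| <= k s) -> a <= b ->
  `|Iint h b - Iint h a| <= Iint k b - Iint k a.
Proof.
move=> ih ik hk ab; rewrite !IintB//.
have ih' : mu.-integrable `]a, b] (EFin \o h) by exact: integrableS ih.
apply: (le_trans (le_normr_Rintegral _ _)) => //.
apply: le_Rintegral => //; last by exact: integrableS ik.
by have /integrable_norm := ih'.
Qed.

Lemma Iint_small h (e : R) : intble h -> 0 < e ->
  exists2 d : R, 0 < d & forall A, measurable A -> (mu A < d%:E)%E ->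
    \int[mu]_(s in A) `|h s| < e.
Proof.
by move=> ih e0; have [d [d0 Hd]] := integral_normr_continuous ih e0; exists d.
Qed.

Lemma Iint_ge0 h t : (forall s, 0 <= h s) -> 0 <= Iint h t.
Proof. by move=> h0; exact: Rintegral_ge0. Qed.

Lemma IintZ (c : R) h t : intble h -> Iint (fun s => c * h s) t = c * Iint h t.
Proof. by move=> ih; rewrite /Iint RintegralZl//; exact: integrableS ih. Qed.

Lemma Iint_sub h k t : intble h -> intble k ->
  Iint (fun s => h s - k s) t = Iint h t - Iint k t.
Proof.
by move=> ih ik; rewrite /Iint RintegralB//; [exact: integrableS ih|exact: integrableS ik].
Qed.

Lemma Iint_eq0 h t : (forall s, s <= t -> h s = 0) -> Iint h t = 0.
Proof.
move=> h0; rewrite /Iint (@eq_Rintegral _ _ _ _ _ (fun=> 0)).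
  by rewrite Rintegral_cst// mul0r.
by move=> s; rewrite inE/= in_itv/= => /h0.
Qed.

Lemma le_normr_Iint h k t : intble h -> intble k -> (forall s, `|h s| <= k s) ->
  `|Iint h t| <= Iint k t.
Proof.
move=> ih ik hk; have ih' : mu.-integrable `]-oo, t] (EFin \o h) by exact: integrableS ih.
apply: (le_trans (le_normr_Rintegral _ _)) => //.
apply: le_Rintegral => //; last by exact: integrableS ik.
by have /integrable_norm := ih'.
Qed.

Lemma Iint_continuous h : intble h -> continuous (Iint h).
Proof.
move=> ih x; apply/cvgrPdist_lt => e e0.
have [d d0 Hd] := Iint_small ih e0.
have small a b : a <= b -> b - a < d -> `|Iint h b - Iint h a| < e.
  move=> ab abd; apply: (le_lt_trans _ (Hd `]a, b]%classic _ _)) => //; last first.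
    rewrite lebesgue_measure_itv/= lte_fin; case: ifP => _ //; rewrite -?EFinB ?lte_fin//.
  rewrite IintB//; apply: le_normr_Rintegral => //; exact: integrableS ih.
apply/nbhs_ballP; exists d => // y; rewrite /ball/= => xy.
have [le_xy|lt_yx] := leP x y.
  by rewrite distrC; apply: small => //; rewrite -(ger0_norm (_ : 0 <= y - x)) 1?distrC ?subr_ge0.
by apply: small; [exact: ltW|rewrite -(ger0_norm (_ : 0 <= x - y)) ?subr_ge0// ltW].
Qed.

Lemma Iint_ac h T : intble h ->
  ac_increments T (fun a b => `|Iint h b - Iint h a|).
Proof.
move=> ih e e0; have [d d0 Hd] := Iint_small ih e0; exists d => // m a b ab tr sd.
pose F (i : 'I_m) : set (measurableTypeR R) := `]a i, b i[%classic.
have mF i : measurable (F i) by exact: measurable_itv.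
have mU : measurable (\big[setU/set0]_(i < m) F i) by exact: bigsetU_measurable.
apply: (le_lt_trans _ (Hd (\big[setU/set0]_(i < m) F i) _ _)) => //; last first.
  rewrite [X in (X < _)%E](_ : _ = (\sum_(i < m) mu (F i))%E); last first.
    exact: (measure_bigsetU_ord mu xpredT mF tr).
  rewrite (eq_bigr (fun i => (b i - a i)%:E)); first by rewrite sumEFin lte_fin.
  move=> i _; rewrite lebesgue_measure_itv/= lte_fin.
  have [/andP[_ abk] _] := ab i; case: ltP => // hh.
  by rewrite (_ : b i = a i) ?subrr//; apply/eqP; rewrite eq_le hh.
have ihn : intble (fun s => `|h s|) by exact: intble_norm.
have ihS A : measurable A -> mu.-integrable A (EFin \o (fun s => `|h s|)).
  by move=> mA; exact: integrableS ihn.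
rewrite [leRHS](_ : _ = \sum_(i < m) \int[mu]_(s in F i) `|h s|); last first.
  apply: EFin_inj; rewrite /Rintegral fineK; last exact: integrable_fin_num (ihS _ mU).
  rewrite -sumEFin (@integral_bigsetU_EFin _ _ _ mu _ _ (fun s => `|h s|)) //=.
  - by apply: eq_bigr => i _; rewrite fineK//; exact: integrable_fin_num (ihS _ (mF i)).
  - exact: index_enum_uniq.
  - by apply: sub_trivIset tr.
  - exact: measurable_int (ihS _ mU).
apply: ler_sum => k _; have [/andP[_ abk] _] := ab k.
rewrite IintB// -Rintegral_itv_bndo_bndc; last by exact: integrableS ih.
by apply: le_normr_Rintegral => //; exact: integrableS ih.
Qed.

Lemma Iint_derive h : intble h ->
  {ae mu, forall t : R, is_derive t (1 : R) (Iint h) (h t)}.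
Proof.
move=> ih.
have loc : locally_integrable setT h by apply: open_integrable_locally => //; exact: openT.
have := @FTC1Ny R h _ loc => H.
have {}H := H (fun y => integrableS (E := [set: measurableTypeR R]) measurableT (measurable_itv `]-oo, y]) (@subsetT _ _) ih).
move: H; apply: filterS; first exact: (ae_filter_ringOfSetsType mu).
move=> t [d E].
by split=> //; rewrite -derive1E.
Qed.

(** The difference [f - Iint h] is absolutely continuous with derivative [0] almost everywhere.
    Multiplied by [1] and by [-1] it is nonincreasing by [ac_nonincreasing], hence constant. *)
Lemma ac_FTC T f h : intble h ->
  ac_increments T (fun a b => `|f b - f a|) ->
  {ae mu, forall t : R, 0 < t < T -> is_derive t (1 : R) f (h t)} ->
  forall t, 0 <= t <= T -> f t - f 0 = Iint h t - Iint h 0.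
Proof.
move=> ih acf df t /andP[t0 tT].
have key (c : R) : `|c| <= 1 ->
    c * (f t - Iint h t) <= c * (f 0 - Iint h 0).
  move=> c1; apply: (@ac_nonincreasing R t (fun s => c * (f s - Iint h s))) => //.
    apply: (@ac_increments_le _ _ (fun a b => `|f b - f a| + `|Iint h b - Iint h a|) _ 1) => //.
      move=> a b _ _; rewrite -mulrBr normrM mul1r.
      apply: (@le_trans _ _ (1 * `|f b - Iint h b - (f a - Iint h a)|)).
        by rewrite ler_wpM2r.
      rewrite mul1r (_ : f b - Iint h b - (f a - Iint h a) = (f b - f a) - (Iint h b - Iint h a)); last by ring.
      exact: ler_normB.
    apply: ac_incrementsD; last exact: Iint_ac.
    exact: (@ac_increments_S _ T).
  apply: (@filterS2 _ _ (ae_filter_ringOfSetsType mu) _ _ _ _ df (Iint_derive ih)).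
  move=> s dfs dIs /andP[s0 st] e e0.
  have e20 : 0 < e / 2 by rewrite divr_gt0.
  have [g1 g10 H1] := is_derive_linear_bound (dfs ltac:(by rewrite s0 (lt_le_trans st))) e20.
  have [g2 g20 H2] := is_derive_linear_bound dIs e20.
  exists (Num.min g1 g2); first by rewrite lt_min g10.
  have loc y : `|y - s| < Num.min g1 g2 ->
      `|c * (f y - Iint h y) - c * (f s - Iint h s)| <= e * `|y - s|.
    rewrite lt_min => /andP[/H1 h1 /H2 h2].
    rewrite -mulrBr normrM.
    apply: (@le_trans _ _ (1 * `|f y - Iint h y - (f s - Iint h s)|)).
      by rewrite ler_wpM2r.
    rewrite mul1r (_ : f y - _ - _ = (f y - f s - h s * (y - s)) -
      (Iint h y - Iint h s - h s * (y - s))); last by ring.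
    by rewrite (le_trans (ler_normB _ _))// (splitr e) mulrDl lerD.
  move=> a b /andP[a0 as_] /andP[sb _] ag bg.
  have ha : `|a - s| = s - a by rewrite distrC ger0_norm// subr_ge0.
  have hb : `|b - s| = b - s by rewrite ger0_norm// subr_ge0.
  have := loc a; rewrite ha => /(_ ag) /ler_normlP[la _].
  have := loc b; rewrite hb => /(_ bg) /ler_normlP[_ lb].
  by lra.
have := key 1 _; rewrite normr1 lexx => /(_ isT).
have := key (-1) _; rewrite normrN1 lexx => /(_ isT).
lra.
Qed.

End IndefiniteIntegral.

(** * Caratheodory equations *)

Lemma geometric_le0 (R : realType) (c z : R) :
  (forall n, z <= c / 2 ^+ n) -> z <= 0.
Proof.
move=> H; have h : (fun n => c * (2^-1) ^+ n) @ \oo --> c * 0.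
  by apply: cvgM; [exact: cvg_cst|apply: cvg_expr; rewrite ger0_norm// invf_lt1// ltr1n].
rewrite mulr0 in h; rewrite -(cvg_lim (@Rhausdorff R) h).
apply: limr_ge; first by apply/cvg_ex; exists 0.
by near=> n; rewrite exprVn.
Unshelve. all: by end_near. Qed.

Lemma ler_dist_through (R : realType) (p q x y : R) :
  `|x - y| <= `|p - q| + `|p - x| + `|q - y|.
Proof.
rewrite (_ : x - y = p - q - (p - x) + (q - y)); last by ring.
by rewrite (le_trans (ler_normD _ _))// lerD2r ler_normB.
Qed.

(** Nested intervals: the radius [r n = 2 * c / 2 ^+ n] satisfies [r n - r n.+1 = c / 2 ^+ n], so
    [u n - r n] increases and [u n + r n] decreases. The supremum of the lower ends lies in every
    interval. *)
Lemma geometric_limit (R : realType) (u : nat -> R) (c : R) :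
  (forall n, `|u n.+1 - u n| <= c / 2 ^+ n) ->
  exists l, forall n, `|u n - l| <= 2 * c / 2 ^+ n.
Proof.
move=> H; pose r n := 2 * c / 2 ^+ n.
have c0 : 0 <= c by have := le_trans (normr_ge0 _) (H 0%N); rewrite divr1.
have r0 n : 0 <= r n by rewrite divr_ge0 ?mulr_ge0 ?exprn_ge0.
have rS n : c / 2 ^+ n = r n - r n.+1.
  by rewrite /r exprSr invfM; lra.
have inc n k : u n - r n <= u (n + k)%N - r (n + k)%N.
  elim: k => [|k IH]; first by rewrite addn0.
  apply: (le_trans IH); rewrite addnS.
  have := H (n + k)%N; rewrite rS => /ler_normlP[+ _]; lra.
have dec n k : u (n + k)%N + r (n + k)%N <= u n + r n.
  elim: k => [|k IH]; first by rewrite addn0.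
  apply: le_trans IH; rewrite addnS.
  have := H (n + k)%N; rewrite rS => /ler_normlP[_]; lra.
have ub m n : u m - r m <= u n + r n.
  have := inc m n; have := dec n m; rewrite addnC.
  have := r0 (m + n)%N; lra.
exists (sup (range (fun n => u n - r n))) => n; rewrite -/(r n) ler_distlC.
apply/andP; split; last first.
  by apply: ge_sup => [|_ [m _ <-]//]; exists (u 0%N - r 0%N); exists 0%N.
by apply: ub_le_sup; [exists (u n + r n) => _ [m _ <-]//|exists n].
Qed.

Section Caratheodory.
Variables (R : realType) (I : Type) (lam : R -> R).
Notation mu := (@lebesgue_measure R).
Notation intble h := (mu.-integrable setT (EFin \o h)).
Hypothesis ilam : intble lam.
Hypothesis lam_ge0 : forall t, 0 <= lam t.
Hypothesis lam0 : forall t, t <= 0 -> lam t = 0.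

Let Lam := Iint lam.
(** Bielecki weight: its derivative is [2 * lam * W] almost everywhere, and the factor [2] is what
    makes the Picard map a contraction with ratio [1/2] on the whole line, without subdividing
    time. *)
Let W t := expR (2 * Lam t).

Let Lam_le a b : a <= b -> Lam a <= Lam b.
Proof.
by move=> ab; rewrite -subr_ge0 IintB//; exact: Rintegral_ge0.
Qed.

Let Lam_ge0 t : 0 <= Lam t. Proof. exact: Iint_ge0. Qed.

Let Lam_ub : exists M, forall t, Lam t <= M.
Proof.
exists (\int[mu]_s lam s) => t; rewrite /Lam /Iint Rintegral_mkcond.
apply: le_Rintegral => //.
  rewrite -restrict_EFin.
  by apply/integrable_restrict => //; rewrite setTI; exact: integrableS ilam.
move=> s _; rewrite patchE; case: ifP => // _.
Qed.

Let W_ge1 t : 1 <= W t.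
Proof. by rewrite -expR0 ler_expR mulr_ge0. Qed.

Let W_gt0 t : 0 < W t. Proof. exact: expR_gt0. Qed.

Let W_le a b : a <= b -> W a <= W b.
Proof. by move=> ab; rewrite ler_expR ler_wpM2l// Lam_le. Qed.

Let W_ub : exists M, forall t, W t <= M.
Proof.
have [M HM] := Lam_ub; exists (expR (2 * M)) => t.
by rewrite ler_expR ler_wpM2l.
Qed.

Let W_cont : continuous W.
Proof.
move=> t; apply: continuous_comp; last exact: continuous_expR.
apply: cvgM; first exact: cvg_cst.
exact: Iint_continuous.
Qed.

Let ilamW : intble (fun s => lam s * W s).
Proof.
have [M HM] := W_ub.
have M0 : 0 <= M by rewrite (le_trans _ (HM 0))// ltW.
apply: (@le_integrable _ _ _ mu _ _ _ (EFin \o (fun s => M * lam s))) => //.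
- apply/measurable_EFinP; apply: measurable_funM.
    by apply/measurable_EFinP; exact: measurable_int ilam.
  exact: continuous_measurable_fun.
- move=> s _ /=; rewrite lee_fin normrM (ger0_norm (lam_ge0 s)).
  rewrite (ger0_norm (ltW (W_gt0 s))) (ger0_norm (mulr_ge0 M0 (lam_ge0 s))).
  by rewrite mulrC ler_wpM2r.
- exact: intbleZ.
Qed.

(** The fundamental theorem applied to [W] gives [W t - W 0] for twice the left side when [t] is
    positive; for nonpositive [t] the integral vanishes with [lam]. *)
Let W_half t : Iint (fun s => lam s * W s) t <= W t / 2.
Proof.
have [t0|t0] := leP t 0.
  rewrite Iint_eq0 ?divr_ge0 ?ltW// => s st.
  by rewrite lam0 ?mul0r// (le_trans st).
have i2 : intble (fun s => 2 * (lam s * W s)).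
  exact: intbleZ.
(* From [1 + x <= expR x] at [x = a - b]; it transfers absolute continuity from [Lam] to [W]. *)
have exp_lip (a b : R) : a <= b -> expR b - expR a <= expR b * (b - a).
  move=> ab; have := expR_ge1Dx (a - b).
  rewrite expRB ler_pdivlMr ?expR_gt0// => h; rewrite mulrC; lra.
have acW : ac_increments t (fun a b => `|W b - W a|).
  apply: (@ac_increments_le _ _ (fun a b => `|Lam b - Lam a|) _ (2 * W t)).
  - by rewrite mulr_ge0// ltW.
  - move=> a b /andP[a0 ab] bt.
    rewrite !ger0_norm ?subr_ge0 ?W_le ?Lam_le//.
    apply: (le_trans (exp_lip _ _ _)); first by rewrite ler_wpM2l// Lam_le.
    have h1 := W_le bt; have h2 := Lam_le ab; move: h1 h2; rewrite -/(W b).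
    move: (W b) (W t) (Lam a) (Lam b) => y z p q h1 h2.
    by rewrite -mulrBr mulrCA mulrA ler_wpM2r ?subr_ge0// ler_wpM2l.
  - exact: Iint_ac.
have := ac_FTC i2 acW _ (t := t); rewrite lexx (ltW t0) => /(_ _ isT) H.
have {}H : W t - W 0 = Iint (fun s => 2 * (lam s * W s)) t - Iint (fun s => 2 * (lam s * W s)) 0.
  apply: H; have := Iint_derive ilam; apply: filterS; first exact: (ae_filter_ringOfSetsType mu).
  move=> s ds _.
  have -> : W = expR \o (fun t => 2 * Lam t) by [].
  have d2 : is_derive s (1 : R) (fun t => 2 * Lam t) (2 * lam s).
    exact: (is_deriveZ (2 : R) ds).
  rewrite mulrA [_ * W s]mulrC; exact: (is_derive1_comp (is_derive_expR _) d2).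
rewrite [Iint _ 0]Iint_eq0 in H; last by move=> s s0; rewrite lam0// mul0r mulr0.
rewrite IintZ// in H.
rewrite ler_pdivlMr// mulrC; move: H; rewrite subr0 => <-.
by rewrite gerBl ltW.
Qed.

Variable (g : R -> (I -> R) -> I -> R) (x0 : I -> R).
Hypothesis g_lip : forall t x y d, (forall i, `|x i - y i| <= d) ->
  forall i, `|g t x i - g t y i| <= lam t * d.
Hypothesis g_bd : forall t x i, `|g t x i| <= lam t.
Hypothesis g_meas : forall x : R -> I -> R, (forall i, continuous (x^~ i)) ->
  forall i, measurable_fun setT (fun t => g t (x t) i).

Let ig x i : (forall i, continuous (x^~ i)) -> intble (fun t => g t (x t) i).
Proof.
move=> cx; apply: (@le_integrable _ _ _ mu _ _ _ (EFin \o lam)) => //.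
  by apply/measurable_EFinP; exact: g_meas.
by move=> s _ /=; rewrite lee_fin (ger0_norm (lam_ge0 s)).
Qed.

Let step (x : R -> I -> R) : R -> I -> R :=
  fun t i => x0 i + Iint (fun s => g s (x s) i) t.

Let step_cont x : (forall i, continuous (x^~ i)) -> forall i, continuous ((step x)^~ i).
Proof.
move=> cx i t; apply: cvgD; first exact: cvg_cst.
by apply: Iint_continuous; exact: ig.
Qed.

Let step_contract x y c : (forall i, continuous (x^~ i)) ->
  (forall i, continuous (y^~ i)) ->
  (forall t i, `|x t i - y t i| <= c * W t) ->
  forall t i, `|step x t i - step y t i| <= c / 2 * W t.
Proof.
move=> cx cy xy t i; rewrite /step opprD addrACA subrr add0r -Iint_sub; [|exact: ig|exact: ig].
have ic : intble (fun s => c * (lam s * W s)).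
  exact: intbleZ.
have c0 : 0 <= c.
  have := le_trans (normr_ge0 _) (xy 0 i); rewrite pmulr_lge0//.
apply: (@le_trans _ _ (Iint (fun s => c * (lam s * W s)) t)); last first.
  by rewrite IintZ// -mulrA ler_wpM2l// mulrC W_half.
apply: le_normr_Iint => //.
  have := integrableB measurableT (ig i cx) (ig i cy); congr (mu.-integrable setT).
move=> s; rewrite mulrCA; apply: g_lip => j; exact: xy.
Qed.

Lemma caratheodory_unique x y : (forall i, continuous (x^~ i)) ->
  (forall i, continuous (y^~ i)) ->
  (forall t i, x t i = x0 i + Iint (fun s => g s (x s) i) t) ->
  (forall t i, y t i = x0 i + Iint (fun s => g s (y s) i) t) ->
  forall t i, x t i = y t i.
Proof.
move=> cx cy ex ey.
have [M HM] := Lam_ub.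
(* A crude bound from the total mass of [lam] starts the iteration; each use of [step_contract] then
   halves it. *)
have base t i : `|x t i - y t i| <= 2 * M * W t.
  have bd z : (forall i, continuous (z^~ i)) -> `|Iint (fun s => g s (z s) i) t| <= M.
    move=> cz; apply: le_trans (HM t); apply: le_normr_Iint => //; exact: ig.
  rewrite ex ey opprD addrACA subrr add0r (le_trans (ler_normB _ _))//.
  have M0 : 0 <= M by exact: le_trans (HM 0).
  apply: (@le_trans _ _ (2 * M)); last by rewrite ler_peMr ?mulr_ge0.
  by rewrite mulr_natl mulr2n lerD// bd.
have iter n t i : `|x t i - y t i| <= 2 * M / 2 ^+ n * W t.
  elim: n t i => [|n IH] t i; first by rewrite expr0 divr1.
  rewrite ex ey exprSr invfM mulrA; exact: step_contract cx cy IH t i.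
move=> t i; apply/eqP; rewrite -subr_eq0 -normr_le0.
apply: (@geometric_le0 _ (2 * M * W t)) => n.
by rewrite mulrAC; exact: iter.
Qed.

Let picard n := iter n step (fun=> x0).

Let picard_cont n i : continuous ((picard n)^~ i).
Proof.
elim: n i => [|n IH] i; first by move=> t; exact: cvg_cst.
exact: step_cont.
Qed.

(** A modulus of continuity independent of [n], which the limit of the iterates inherits. *)
Let picard_lip n i a b : a <= b -> `|picard n b i - picard n a i| <= Lam b - Lam a.
Proof.
case: n => [|n] ab /=; first by rewrite subrr normr0 subr_ge0 Lam_le.
rewrite /step opprD addrACA subrr add0r.
by apply: Iint_incr_le => //; exact: ig.
Qed.

Lemma caratheodory_exists : exists x : R -> I -> R,
  (forall i, continuous (x^~ i)) /\
  (forall t i, x t i = x0 i + Iint (fun s => g s (x s) i) t).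
Proof.
have [M HM] := Lam_ub.
have M0 : 0 <= M by exact: le_trans (HM 0).
have consec n t i : `|picard n.+1 t i - picard n t i| <= M / 2 ^+ n * W t.
  elim: n t i => [|n IH] t i.
    rewrite expr0 divr1 /= /step (addrC (x0 i)) addrK.
    apply: (@le_trans _ _ M); last by rewrite ler_peMr.
    apply: le_trans (HM t); apply: le_normr_Iint => //.
    by apply: (@ig (fun=> x0)) => j s; exact: cvg_cst.
  rewrite exprSr invfM mulrA.
   exact: (step_contract (@picard_cont n.+1) (@picard_cont n) IH).
have cW n t : M / 2 ^+ n * W t = M * W t / 2 ^+ n by rewrite mulrAC.
have H t i : exists l, forall n, `|picard n t i - l| <= 2 * (M * W t) / 2 ^+ n.
  apply: (@geometric_limit _ (fun n => picard n t i) (M * W t)) => n.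
  by rewrite -cW; exact: consec.
pose x t i := sval (cid (H t i)).
have xP n t i : `|picard n t i - x t i| <= 2 * M / 2 ^+ n * W t.
  by rewrite [leRHS]mulrAC -(mulrA 2); exact: (svalP (cid (H t i)) n).
have xlip a b i : a <= b -> `|x b i - x a i| <= Lam b - Lam a.
  move=> ab; rewrite -subr_le0.
  apply: (@geometric_le0 _ (2 * M * W b + 2 * M * W a)) => n.
  have h1 := xP n b i; have h2 := xP n a i; have h3 := picard_lip n i ab.
  have h : `|x b i - x a i| <= `|picard n b i - picard n a i| +
      `|picard n b i - x b i| + `|picard n a i - x a i|.
    exact: ler_dist_through.
  have eqn (m w1 w2 q l : R) : l + m / q * w1 + m / q * w2 = (m * w1 + m * w2) / q + l.
    by ring.
  rewrite lerBlDr; apply: (le_trans h).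
  by rewrite -eqn; exact: (lerD (lerD h3 h1) h2).
(* Continuity of the limit has to come first: [g_meas], and with it [step_contract], speaks of
   continuous curves only. *)
have cx i : continuous (x^~ i).
  move=> t; apply/cvgrPdist_lt => e e0.
  have /cvgrPdist_lt/(_ _ e0) := Iint_continuous ilam (x := t).
  apply: filterS => s; rewrite -/Lam => h; apply: le_lt_trans h.
  have [ts|ts] := leP t s.
    by rewrite distrC (le_trans (xlip _ _ _ ts))// distrC ler_norm.
  by rewrite (le_trans (xlip _ _ _ (ltW ts)))// ler_norm.
exists x; split=> // t i; apply/eqP; rewrite -subr_eq0 -normr_le0.
apply: (@geometric_le0 _ (2 * M * W t)) => n.
have h1 := xP n.+1 t i.
have h2 := step_contract (@picard_cont n) cx (xP n) t i.
rewrite -/(step x t i).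
apply: (le_trans (ler_distD (picard n.+1 t i) _ _)); rewrite [X in X + _]distrC.
apply: (le_trans (lerD h1 h2)).
have eqn (m w q : R) : m / (q * 2) * w + m / q / 2 * w = m * w / q.
  by rewrite invfM; move: q^-1 => r; field.
by rewrite exprSr eqn.
Qed.

End Caratheodory.

(** * Lebesgue measure of planar strips *)

Notation pushforward_measure :=
  measure_function_pushforward__canonical__measure_function_Measure.

Section PlaneMeasure.
Variable R : realType.
Notation mu := (@lebesgue_measure R).
Notation mu2 := (@lebesgue2 R).
Notation P2 := (measurableTypeR R * measurableTypeR R)%type.

(** The product measure is defined by slicing in one order; the other order is needed for strips of
    which only the first coefficient is bounded below. *)
Lemma lebesgue2_yE (S : set P2) : measurable S ->
  mu2 S = (\int[mu]_y mu (ysection S y))%E.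
Proof.
move=> mS; rewrite /lebesgue2.
rewrite (_ : (\int[mu]_y _)%E = (mu \x^ mu)%E S)//.
by apply: product_measure_unique => //= A B mA mB; rewrite product_measure2E.
Qed.

Let itv_len (a b : R) : a <= b -> mu `[a, b] = (b - a)%:E.
Proof.
move=> ab; rewrite lebesgue_measure_itv/= lte_fin; case: ltP => [_|h].
  by rewrite EFinB.
by rewrite (_ : a = b) ?subrr//; apply/eqP; rewrite eq_le ab.
Qed.

Let section_le (phi : R -> set R) (B c : R) : 0 <= B -> 0 <= c ->
  measurable_fun setT (fun x => mu (phi x)) ->
  (forall x, B < `|x| -> phi x = set0) ->
  (forall x, (mu (phi x) <= c%:E)%E) ->
  (\int[mu]_x mu (phi x) <= (2 * B * c)%:E)%E.
Proof.
move=> B0 c0 mphi phi0 phic.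
have -> : (2 * B * c)%:E = (\int[mu]_(x in `[(- B)%R, B]) cst c%:E x)%E.
  rewrite integral_cst; last exact: measurable_itv.
  rewrite [X in (_ * X)%E](_ : _ = (2 * B)%:E); first by rewrite -EFinM mulrC.
  by rewrite (_ : 2 * B = B - - B); [apply: itv_len; rewrite (le_trans _ B0)// oppr_le0|ring].
rewrite [leRHS]integral_mkcond; apply: ge0_le_integral => //.
  apply/(measurable_restrictT _ _).1 => //; exact: measurable_itv.
move=> x _; rewrite patchE; case: ifPn => // nx.
rewrite phi0 ?measure0//; move: nx; apply: contraNT; rewrite -leNgt => h.
by rewrite inE/= in_itv/= -ler_norml.
Qed.

Let slab_le (a b w s : R) : 0 < s -> 0 <= w -> s <= `|a| ->
  (mu [set y : R | (`|a * y + b| <= w)%R] <= (2 * w / s)%:E)%E.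
Proof.
move=> s0 w0 sa; have a0 : a != 0.
  by apply: contraTneq sa => ->; rewrite normr0 -ltNge.
have na0 : 0 < `|a| by rewrite normr_gt0.
have E y : (`|a * y + b| <= w) = (`|y - (- b / a)| <= w / `|a|).
  by rewrite ler_pdivlMr// -normrM; congr (`|_| <= _); field.
have -> : [set y : R | `|a * y + b| <= w] = `[- b / a - w / `|a|, - b / a + w / `|a|]%classic.
  by apply/seteqP; split=> y /=; rewrite in_itv/= E ler_distl.
rewrite lebesgue_measure_itv/= lte_fin; case: ifP => _; last first.
  by rewrite lee_fin divr_ge0 ?mulr_ge0// ltW.
rewrite -EFinB lee_fin (_ : _ - _ = 2 * w / `|a|); last by field; rewrite a0 gt_eqF.
by rewrite ler_wpM2l ?mulr_ge0// lef_pV2 ?posrE.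
Qed.

Let measurable_affine (a1 a2 c : R) : measurable_fun setT (fun x : P2 => a1 * x.1 + a2 * x.2 + c).
Proof.
by apply: measurable_funD => //; apply: measurable_funD; apply: measurable_funM.
Qed.

Lemma measurable_strip (B a1 a2 c w : R) : measurable ([set x |
  [/\ `|x.1| <= B, `|x.2| <= B & `|a1 * x.1 + a2 * x.2 + c| <= w]] : set P2).
Proof.
have m1 (f : P2 -> R) d : measurable_fun setT f -> measurable [set x | `|f x| <= d].
  move=> mf; rewrite -[X in measurable X]setTI.
  have -> : [set x | `|f x| <= d] = f @^-1` `[- d, d]%classic.
    by apply/seteqP; split=> x /=; rewrite in_itv/= ler_norml.
  by apply: mf => //; exact: measurable_itv.
rewrite (_ : mkset _ = [set x | `|x.1| <= B] `&` [set x | `|x.2| <= B] `&`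
   [set x | `|a1 * x.1 + a2 * x.2 + c| <= w]).
  apply: measurableI; last by apply: (m1 (fun x => a1 * x.1 + a2 * x.2 + c)); exact: measurable_affine.
  apply: measurableI; [apply: (m1 fst)|apply: (m1 snd)].
    exact: measurable_fst.
  exact: measurable_snd.
by apply/seteqP; split=> x /=; [case|case; case].
Qed.

(** Slice along the coordinate whose coefficient is at least [s] in modulus: each slice lies in an
    interval of length [2 * w / s], and the slices that meet the square range over an interval of
    length [2 * B]. *)
Lemma strip_le (B a1 a2 c w s : R) : 0 <= B -> 0 < s -> 0 <= w ->
  s <= `|a1| \/ s <= `|a2| ->
  (mu2 [set x : P2 | [/\ `|x.1| <= B, `|x.2| <= B & `|a1 * x.1 + a2 * x.2 + c| <= w]%R]
    <= (2 * B * (2 * w / s))%:E)%E.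
Proof.
move=> B0 s0 w0 sa; set S := mkset _.
have mS : measurable S by exact: measurable_strip.
have ws0 : 0 <= 2 * w / s by rewrite divr_ge0 ?mulr_ge0// ltW.
have le_slab (A : set R) a b : measurable (A : set (measurableTypeR R)) -> s <= `|a| ->
    (forall y, A y -> `|a * y + b| <= w) -> (mu A <= (2 * w / s)%:E)%E.
  move=> mA sa' HA; apply: le_trans (slab_le b s0 w0 sa').
  apply: le_measure; rewrite ?inE//.
  have -> : [set y : R | `|a * y + b| <= w] = (fun y => a * y + b) @^-1` `[- w, w]%classic.
    by apply/seteqP; split=> x /=; rewrite in_itv/= ler_norml.
  rewrite -[X in measurable X]setTI.
  have mf : measurable_fun [set: measurableTypeR R] (fun y : R => a * y + b).
    by apply: measurable_funD => //; apply: measurable_funM.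
  by apply: mf => //; exact: measurable_itv.
case: sa => sa.
  rewrite lebesgue2_yE//; apply: section_le => //.
  - exact: measurable_fun_ysection.
  - move=> y By; apply/seteqP; split=> x //=.
    by rewrite /ysection/= inE => -[_ /= h _]; have := lt_le_trans By h; rewrite ltxx.
  - move=> y; apply: (le_slab _ a1 (a2 * y + c)) => //; first exact: measurable_ysection.
    by move=> x; rewrite /ysection/= inE => -[_ _ /=]; rewrite addrA.
rewrite /lebesgue2 /product_measure1; apply: section_le => //.
- exact: measurable_fun_xsection.
- move=> y By; apply/seteqP; split=> x //=.
  by rewrite /xsection/= inE => -[/= h _ _]; have := lt_le_trans By h; rewrite ltxx.
- move=> y; apply: (le_slab _ a2 (a1 * y + c)) => //; first exact: measurable_xsection.
  by move=> x; rewrite /xsection/= inE => -[_ _ /=]; rewrite addrCA addrA.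
Qed.

Lemma measurable_translation (k : P2) : measurable_fun setT (fun x : P2 => (x.1 + k.1, x.2 + k.2) : P2).
Proof.
apply/measurable_fun_pairP; split.
  by apply: measurable_funD => //; exact: measurable_fst.
by apply: measurable_funD => //; exact: measurable_snd.
Qed.

Lemma lebesgue_translation (c : R) (A : set (measurableTypeR R)) : measurable A ->
  mu ((fun x => x + c) @^-1` A) = mu A.
Proof.
have mc : measurable_fun [set: measurableTypeR R] (fun x : measurableTypeR R => x + c : measurableTypeR R).
  by apply: measurable_funD.
move=> mA; symmetry.
apply: (lebesgue_measure_unique (mu := pushforward_measure mu mc)) => //.
move=> X [[a b] _ <-] /=; rewrite /pushforward.
have -> : (fun x => x + c) @^-1` `]a, b]%classic = `]a - c, b - c]%classic.
  by apply/seteqP; split=> x /=; rewrite !in_itv/= ltrBlDr lerBrDr.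
rewrite !lebesgue_measure_itv/= !lte_fin ltrD2r; case: ifP => // _.
by rewrite -!EFinB; congr EFin; ring.
Qed.

Lemma lebesgue2_translation (k : P2) (A : set P2) : measurable A ->
  mu2 ((fun x : P2 => (x.1 + k.1, x.2 + k.2)) @^-1` A) = mu2 A.
Proof.
move=> mA; symmetry.
apply: (@product_measure_unique _ _ _ _ R mu mu
  (pushforward_measure (mu \x mu)%E (measurable_translation k))) => //.
move=> X Y mX mY; rewrite /= /pushforward.
have -> : (fun x : P2 => (x.1 + k.1, x.2 + k.2)) @^-1` (X `*` Y) =
  ((fun x => x + k.1) @^-1` X) `*` ((fun x => x + k.2) @^-1` Y) by [].
have mt (Z : set (measurableTypeR R)) c : measurable Z -> measurable ((fun x : measurableTypeR R => x + c : measurableTypeR R) @^-1` Z).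
  move=> mZ; rewrite -[X in measurable X]setTI.
  have mc : measurable_fun [set: measurableTypeR R] (fun x : measurableTypeR R => x + c : measurableTypeR R).
    by apply: measurable_funD.
  exact: mc.
rewrite product_measure1E; [|exact: mt|exact: mt].
by congr (_ * _)%E; exact: lebesgue_translation.
Qed.

End PlaneMeasure.

(** * Real integrals over a set of finite measure *)

Section RintegralFinite.
Context d (T : measurableType d) (R : realType) (mu : {measure set T -> \bar R}).
Variable D : set T.
Hypothesis mD : measurable D.
Notation intble f := (mu.-integrable D (EFin \o f)).

Lemma intbleD (f g : T -> R) : intble f -> intble g -> intble (fun x => f x + g x).
Proof. by move=> hf hg; have := integrableD mD hf hg. Qed.

Lemma intbleMl (c : R) (f : T -> R) : intble f -> intble (fun x => c * f x).
Proof.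
move=> hf; have -> : EFin \o (fun x => c * f x) = (fun x => c%:E * (EFin \o f) x)%E by [].
exact: integrableZl.
Qed.

Lemma intble_sum (I : Type) (s : seq I) (f : I -> T -> R) :
  (forall i, intble (f i)) -> intble (fun x => \sum_(i <- s) f i x).
Proof.
move=> hf; have := integrable_sum mD s (P := xpredT) (fun i _ => hf i).
by congr (mu.-integrable D); apply/funext => x /=; rewrite sumEFin.
Qed.

Lemma Rintegral_sum (I : Type) (s : seq I) (f : I -> T -> R) :
  (forall i, intble (f i)) ->
  \int[mu]_(x in D) (\sum_(i <- s) f i x) = \sum_(i <- s) \int[mu]_(x in D) f i x.
Proof.
move=> hf; elim: s => [|i s IH].
  rewrite big_nil (@eq_Rintegral _ _ _ _ _ (fun=> 0)).
    by rewrite Rintegral_cst// mul0r.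
  by move=> x _; rewrite big_nil.
rewrite big_cons -IH -RintegralD//; last exact: intble_sum.
by apply: eq_Rintegral => x _; rewrite big_cons.
Qed.

Hypothesis finD : (mu D < +oo)%E.

Lemma intble_bounded (f : T -> R) (M : R) : measurable_fun D f ->
  (forall x, D x -> `|f x| <= M) -> intble f.
Proof.
move=> mf fM; apply: measurable_bounded_integrable => //.
exists M; split; first exact: num_real.
by move=> N MN x Dx; exact: le_trans (fM _ Dx) (ltW MN).
Qed.

Lemma intble_indic (A : set T) : measurable A -> intble (\1_A : T -> R).
Proof.
move=> mA; apply: (@intble_bounded _ 1).
  by apply: measurable_funTS; exact: measurable_indic.
by move=> x _; rewrite indicE; case: (x \in A); rewrite ?normr0 ?normr1.
Qed.

Lemma Rintegral_indic (A : set T) : measurable A ->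
  \int[mu]_(x in D) (\1_A x : R) = fine (mu (A `&` D)).
Proof.
by move=> mA; rewrite /Rintegral integral_indic.
Qed.

Lemma intble_cst (c : R) : intble (fun=> c).
Proof. by apply: (@intble_bounded _ `|c|) => //; exact: measurable_cst. Qed.

(** Integrates a pointwise comparison that may fail by [M] on each exceptional set. It serves twice:
    with [s = 0] to discard ties, and with [s] proportional to [e] to obtain Lipschitz dependence on
    the generators. *)
Lemma Rintegral_le_except (K : finType) (S : K -> set T) (f g : T -> R) (e M s : R) :
  0 <= M -> (forall k, measurable (S k)) -> (forall k, (mu (S k `&` D) <= s%:E)%E) ->
  intble f -> intble g ->
  (forall x, D x -> f x <= g x + (e + M * \sum_k \1_(S k) x)) ->
  \int[mu]_(x in D) f x <=
    \int[mu]_(x in D) g x + (e * fine (mu D) + M * (#|K|%:R * s)).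
Proof.
move=> M0 mS Ss hf hg H.
have iS : intble (fun x => \sum_k \1_(S k) x).
  by apply: intble_sum => k; exact: intble_indic.
have i2 : intble (fun x => e + M * \sum_k \1_(S k) x).
  by apply: intbleD; [exact: intble_cst|exact: intbleMl].
apply: (@le_trans _ _ (\int[mu]_(x in D) (g x + (e + M * \sum_k \1_(S k) x)))).
  by apply: le_Rintegral => //; exact: intbleD.
rewrite RintegralD// lerD2l RintegralD//; [|exact: intble_cst|exact: intbleMl].
rewrite Rintegral_cst// lerD2l RintegralZl// ler_wpM2l//.
rewrite Rintegral_sum; last by move=> k; exact: intble_indic.
rewrite -sum1_card natr_sum mulr_suml; apply: ler_sum => k _; rewrite mul1r.
rewrite Rintegral_indic// -lee_fin fineK//.
by rewrite ge0_fin_numE// (le_lt_trans (Ss k))// ltry.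
Qed.

End RintegralFinite.

Lemma inf_finType (R : realType) (J : finType) (j0 : J) (F : J -> R) :
  inf [set F j | j in [set: J]] = \big[Num.min/F j0]_j F j.
Proof.
have lbF : lbound [set F j | j in [set: J]] (\big[Num.min/F j0]_j F j).
  by move=> _ [j _ <-]; exact: bigmin_le_cond.
have [j E] : exists j, \big[Num.min/F j0]_j F j = F j.
  apply: (big_ind (fun x => exists j, x = F j)); [by exists j0| |by move=> i _; exists i].
  move=> _ _ [a ->] [b ->]; rewrite /Num.min; case: ifP => _; [by exists a|by exists b].
apply/eqP; rewrite eq_le; apply/andP; split.
  rewrite E; apply: ge_inf; first by exists (\big[Num.min/F j0]_j F j).
  by exists j.
by apply: lb_le_inf => //; exists (F j0); exists j0.
Qed.

Lemma inf_finType_le (R : realType) (J : finType) (F : J -> R) (j : J) :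
  inf [set F j | j in [set: J]] <= F j.
Proof. by rewrite (inf_finType j); exact: bigmin_le_cond. Qed.

Lemma inf_finType_attained (R : realType) (J : finType) (j0 : J) (F : J -> R) :
  exists j, inf [set F j | j in [set: J]] = F j.
Proof.
rewrite (inf_finType j0).
apply: (big_ind (fun x => exists j, x = F j)); [by exists j0| |by move=> i _; exists i].
move=> _ _ [a ->] [b ->]; rewrite /Num.min; case: ifP => _; [by exists a|by exists b].
Qed.

Lemma measurable_inf_finType d (T : measurableType d) (R : realType) (J : finType)
    (j0 : J) (D : set T) (F : J -> T -> R) : (forall j, measurable_fun D (F j)) ->
  measurable_fun D (fun x => inf [set F j x | j in [set: J]]).
Proof.
move=> mF.
have -> : (fun x => inf [set F j x | j in [set: J]]) =
  (fun x => \big[Num.min/F j0 x]_j F j x) by apply/funext => x; exact: inf_finType.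
suff H (s : seq J) : measurable_fun D (fun x => \big[Num.min/F j0 x]_(j <- s) F j x) by exact: H.
elim: s => [|j s IH].
  by rewrite (_ : (fun x => _) = F j0)//; apply/funext => x; rewrite big_nil.
rewrite (_ : (fun x => _) = (fun x => Num.min (F j x) (\big[Num.min/F j0 x]_(j <- s) F j x))).
  exact: measurable_minr.
by apply/funext => x; rewrite big_cons.
Qed.

(** * Voronoi cells of finitely many planar points *)

Definition sqd (R : realType) (x z : R * R) : R :=
  (x.1 - z.1) ^+ 2 + (x.2 - z.2) ^+ 2.

Section Tessellation.
Variables (R : realType) (J : finType).
Notation mu2 := (@lebesgue2 R).
Notation P2 := (measurableTypeR R * measurableTypeR R)%type.
Variables (D : set P2) (B : R).
Hypothesis mD : measurable D.
Hypothesis DB : forall x, D x -> `|x.1| <= B /\ `|x.2| <= B.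
Hypothesis B0 : 0 <= B.
Implicit Types Z Y : J -> R * R.

Lemma lebesgue2_bounded_lty : (mu2 D < +oo)%E.
Proof.
apply: (@le_lt_trans _ _ (2 * B * (2 * B / 1))%:E); last exact: ltry.
apply: le_trans (@strip_le R B 1 0 0 B 1 B0 ltr01 B0 _); last first.
  by left; rewrite normr1.
apply: le_measure; rewrite ?inE//; first exact: measurable_strip.
by move=> x Dx /=; have [h1 h2] := DB Dx; split=> //; rewrite mul1r mul0r !addr0.
Qed.

Lemma sqd_measurable z : measurable_fun setT (fun x : P2 => sqd x z).
Proof.
by apply: measurable_funD; apply: measurable_funX; apply: measurable_funB.
Qed.

(** In the application [J] consists of pairs of a generator and a lattice vector, so that a cell of
    the torus becomes, up to ties, a finite union of these planar cells. *)
Definition tcell Z j : set P2 :=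
  [set x | D x /\ forall i, i != j -> sqd x (Z j) < sqd x (Z i)].

Definition tenergy Z : R :=
  \int[mu2]_(x in D) inf [set sqd x (Z j) | j in [set: J]].

Lemma measurable_tcell Z j : measurable (tcell Z j).
Proof.
rewrite (_ : tcell Z j = D `&` \bigcap_(i in [set i | i != j]) [set x | sqd x (Z j) < sqd x (Z i)]).
  apply: measurableI => //; apply: fin_bigcap_measurable; first exact: finite_finset.
  move=> i _; rewrite -[X in measurable X]setTI.
  rewrite (_ : [set x | _] = (fun x => sqd x (Z i) - sqd x (Z j)) @^-1` `]0, +oo[%classic).
    have : measurable_fun [set: P2] (fun x => sqd x (Z i) - sqd x (Z j)).
      by apply: measurable_funB; exact: sqd_measurable.
    by apply => //; exact: measurable_itv.
  by apply/seteqP; split=> x /=; rewrite in_itv/= andbT subr_gt0.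
by apply/seteqP; split=> x /= [Dx H]; split=> // i /= ij; exact: H.
Qed.

Lemma tcell_restr Z j (f : P2 -> R) :
  \int[mu2]_(x in tcell Z j) f x = \int[mu2]_(x in D) (\1_(tcell Z j) x * f x).
Proof.
rewrite -[in LHS](setIidr (_ : tcell Z j `<=` D)); last by move=> x [].
rewrite Rintegral_mkcondr; apply: eq_Rintegral => x _.
by rewrite patchE indicE; case: (x \in _); rewrite ?mul1r ?mul0r.
Qed.

Definition strip (w c a1 a2 : R) : set P2 :=
  [set x | [/\ `|x.1| <= B, `|x.2| <= B & `|a1 * x.1 + a2 * x.2 + c| <= w]].

(* [sqd x z' - sqd x z] is affine in [x], so its sublevel sets are strips. *)
Definition bisector (w : R) (z z' : R * R) : set P2 :=
  strip w (sqd 0 z' - sqd 0 z) (2 * (z.1 - z'.1)) (2 * (z.2 - z'.2)).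

Lemma bisectorP w z z' x : D x -> `|sqd x z' - sqd x z| <= w -> bisector w z z' x.
Proof.
move=> Dx H; have [h1 h2] := DB Dx; split=> //.
by move: H; congr (`|_| <= _); rewrite /sqd /=; ring.
Qed.

Lemma measurable_bisector w z z' : measurable (bisector w z z').
Proof. exact: measurable_strip. Qed.

Lemma bisector_le w z z' s : 0 < s -> 0 <= w ->
  s <= `|z.1 - z'.1| \/ s <= `|z.2 - z'.2| ->
  (mu2 (bisector w z z' `&` D) <= (2 * B * (2 * w / s))%:E)%E.
Proof.
move=> s0 w0 h.
apply: (@le_trans _ _ (mu2 (bisector w z z'))).
  by apply: measureIl => //; exact: measurable_strip.
apply: strip_le => //.
by rewrite !normrM ger0_norm//; case: h => h; [left|right]; apply: (le_trans h); rewrite ler_peMl// ler1n.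
Qed.

Definition separated (s : R) Z := forall i j, i != j ->
  s <= `|(Z i).1 - (Z j).1| \/ s <= `|(Z i).2 - (Z j).2|.

Let bd_sqd Z : exists M, forall x j, D x -> sqd x (Z j) <= M.
Proof.
exists (\sum_j ((B + `|(Z j).1|) ^+ 2 + (B + `|(Z j).2|) ^+ 2)) => x j Dx.
have [h1 h2] := DB Dx.
rewrite (bigD1 j)//= ler_wpDr//.
  by apply: sumr_ge0 => i _; rewrite addr_ge0// sqr_ge0.
apply: lerD; rewrite -real_normK ?num_real// lerXn2r ?nnegrE ?addr_ge0//;
by rewrite (le_trans (ler_normB _ _))// lerD2r.
Qed.

Lemma sqd_ge0 (x z : R * R) : 0 <= sqd x z.
Proof. by rewrite addr_ge0// sqr_ge0. Qed.

Lemma intble_tenergy Z (j0 : J) :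
  mu2.-integrable D (EFin \o (fun x => inf [set sqd x (Z j) | j in [set: J]])).
Proof.
have [M HM] := bd_sqd Z.
apply: (@intble_bounded _ _ _ _ _ mD lebesgue2_bounded_lty _ M).
  apply: (measurable_inf_finType j0) => j.
  by apply: measurable_funTS; exact: sqd_measurable.
move=> x Dx; have [j ->] := inf_finType_attained j0 (fun j => sqd x (Z j)).
by rewrite ger0_norm ?sqd_ge0//; exact: HM.
Qed.

Lemma intble_tcell Z j (f : P2 -> R) (M : R) : measurable_fun setT f ->
  (forall x, D x -> `|f x| <= M) ->
  mu2.-integrable D (EFin \o (fun x => \1_(tcell Z j) x * f x)).
Proof.
move=> mf fM; apply: (@intble_bounded _ _ _ _ _ mD lebesgue2_bounded_lty _ M).
  apply: measurable_funTS; apply: measurable_funM => //.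
  by apply: measurable_indic; exact: measurable_tcell.
move=> x Dx; rewrite indicE; case: (x \in _); rewrite ?mul1r ?mul0r; first exact: fM.
by rewrite normr0 (le_trans _ (fM _ Dx)).
Qed.

(* On the cell of [Z j] the generator [Y j] is a competitor for the minimum
   defining the energy of [Y]. *)
Lemma tenergy_le s Z Y : 0 < s -> separated s Z ->
  tenergy Y <= tenergy Z +
    \sum_j \int[mu2]_(x in tcell Z j) (sqd x (Y j) - sqd x (Z j)).
Proof.
move=> s0 sZ; have [[j0 _]|nJ] := pselect (exists j : J, True); last first.
  rewrite big1; last by move=> j _; case: nJ; exists j.
  rewrite addr0 /tenergy; rewrite le_eqVlt; apply/orP; left; apply/eqP; apply: eq_Rintegral => x _; congr inf.
  by apply/seteqP; split=> y [j]; case: nJ; exists j.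
have [MY HY] := bd_sqd Y; have [MZ HZ] := bd_sqd Z.
have MY0 x : D x -> 0 <= MY by move=> /(HY _ j0); apply: le_trans; exact: sqd_ge0.
have MZ0 x : D x -> 0 <= MZ by move=> /(HZ _ j0); apply: le_trans; exact: sqd_ge0.
pose G x := inf [set sqd x (Z j) | j in [set: J]] +
  \sum_j \1_(tcell Z j) x * (sqd x (Y j) - sqd x (Z j)).
have ij j : mu2.-integrable D (EFin \o (fun x => \1_(tcell Z j) x * (sqd x (Y j) - sqd x (Z j)))).
  apply: (@intble_tcell _ _ _ (`|MY| + `|MZ|)).
    by apply: measurable_funB; exact: sqd_measurable.
  move=> x Dx; rewrite (le_trans (ler_normB _ _))// lerD//.
    by rewrite !ger0_norm ?sqd_ge0 ?HY// (MY0 x).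
  by rewrite !ger0_norm ?sqd_ge0 ?HZ// (MZ0 x).
have iS : mu2.-integrable D (EFin \o (fun x => \sum_j \1_(tcell Z j) x * (sqd x (Y j) - sqd x (Z j)))).
  exact: intble_sum.
have iG : mu2.-integrable D (EFin \o G).
  by apply: intbleD => //; exact: intble_tenergy.
(* The diagonal is excluded because the bisector of a point with itself is the whole square. With
   width [0] all the others are null sets. *)
pose tie (p : J * J) := if p.1 == p.2 then set0 else bisector 0 (Z p.1) (Z p.2).
(* On a tie the left side is at most [MY] and the correction sum in [G] is at least minus the second
   summand. *)
pose M := `|MY| + (\sum_(j : J) (`|MY| + `|MZ|)).
have M0 : 0 <= M by rewrite addr_ge0// sumr_ge0// => j _; rewrite addr_ge0.
have := @Rintegral_le_except _ _ R mu2 D mD lebesgue2_bounded_lty (J * J)%type tie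
  (fun x => inf [set sqd x (Y j) | j in [set: J]]) G 0 M 0 M0.
rewrite !mul0r mulr0 mulr0 !addr0 => H.
apply: (le_trans (H _ _ _ _ _)).
- move=> p; rewrite /tie; case: ifP => _; first exact: measurable0.
  exact: measurable_strip.
- move=> p; rewrite /tie; case: ifPn => np; first by rewrite set0I measure0.
  by apply: (le_trans (bisector_le s0 _ (sZ _ _ np))) => //; rewrite mulr0 mul0r mulr0.
- exact: intble_tenergy.
- exact: iG.
- move=> x Dx; rewrite add0r.
  have [i Ei] := inf_finType_attained j0 (fun j => sqd x (Z j)).
  have leZ j : sqd x (Z i) <= sqd x (Z j) by rewrite -Ei; exact: (inf_finType_le (fun j => sqd x (Z j))).
  have leY j := inf_finType_le (fun j => sqd x (Y j)) j.
  have [ci|nci] := pselect (tcell Z i x).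
    have Eo j : j != i -> \1_(tcell Z j) x = 0 :> R.
      move=> ji; rewrite indicE memNset// => -[_ /(_ i)]; rewrite eq_sym => /(_ ji).
      by rewrite ltNge leZ.
    rewrite /G (bigD1 i)//= [X in _ * _ + X]big1 => [|j ji]; last by rewrite Eo// mul0r.
    rewrite indicE mem_set// mul1r addr0 Ei.
    apply: (le_trans (leY i)); rewrite (addrC (sqd x (Z i))) subrK lerDl mulr_ge0// sumr_ge0//.
  have [j [ji Ej]] : exists j, j != i /\ sqd x (Z j) = sqd x (Z i).
    apply: contrapT => nH; apply: nci; split=> // j ji.
    rewrite lt_neqAle leZ andbT; apply/eqP => E; apply: nH; exists j; split=> //.
  have tx : tie (i, j) x.
    rewrite /tie /= eq_sym (negbTE ji); apply: bisectorP => //.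
    by rewrite Ej subrr normr0.
  have h1 : 1 <= \sum_p \1_(tie p) x :> R.
    rewrite (bigD1 (i, j))//= indicE mem_set// lerDl sumr_ge0//.
  apply: (le_trans (leY i)); apply: (@le_trans _ _ (G x + M * 1)); last first.
    by rewrite lerD2l ler_wpM2l.
  rewrite mulr1 /G /M Ei.
  have hs : - (\sum_(j : J) (`|MY| + `|MZ|)) <= \sum_j \1_(tcell Z j) x * (sqd x (Y j) - sqd x (Z j)).
    rewrite -sumrN; apply: ler_sum => k _; rewrite indicE; case: (x \in _).
      rewrite mul1r opprD lerD//; first by rewrite (le_trans _ (sqd_ge0 _ _))// oppr_le0.
      by rewrite lerN2 (le_trans (HZ _ _ Dx))// ler_norm.
    by rewrite mul0r oppr_le0 addr_ge0.
  have hY : sqd x (Y i) <= `|MY| by rewrite (le_trans (HY _ _ Dx))// ler_norm.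
  have hZ := sqd_ge0 x (Z i).
  move: hs hY hZ; move: (\sum_j \1_(tcell Z j) x * _) (\sum_(j : J) _) => a b; lra.
- rewrite RintegralD//; last exact: intble_tenergy.
  rewrite lerD2l Rintegral_sum//; apply: ler_sum => j _.
  by rewrite tcell_restr.
Qed.

Lemma intble_on_tcell Z j (f : P2 -> R) (M : R) : measurable_fun setT f ->
  (forall x, D x -> `|f x| <= M) -> mu2.-integrable (tcell Z j) (EFin \o f).
Proof.
move=> mf fM; have mt := measurable_tcell Z j.
apply: (@intble_bounded _ _ R mu2 _ mt _ _ M); last by move=> x [/fM].
  apply: le_lt_trans lebesgue2_bounded_lty; apply: le_measure; rewrite ?inE//.
  by move=> x [].
exact: measurable_funTS.
Qed.

Lemma le_normr_tcell Z j (f : P2 -> R) (M : R) : measurable_fun setT f ->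
  (forall x, D x -> `|f x| <= M) -> 0 <= M ->
  `|\int[mu2]_(x in tcell Z j) f x| <= M * fine (mu2 D).
Proof.
move=> mf fM M0; rewrite tcell_restr.
have ii := intble_tcell Z j mf fM.
apply: (le_trans (le_normr_Rintegral mD ii)); rewrite -Rintegral_cst//.
apply: le_Rintegral => //.
- by have := integrable_norm ii.
- exact: (intble_cst mD lebesgue2_bounded_lty).
- move=> x Dx; rewrite normrM indicE; case: (x \in _); rewrite ?normr1 ?normr0 ?mul1r ?mul0r//.
  exact: fM.
Qed.

Lemma coord_bounded (z x : R * R) : D x ->
  `|x.1 - z.1| <= B + (`|z.1| + `|z.2|) /\ `|x.2 - z.2| <= B + (`|z.1| + `|z.2|).
Proof.
move=> /DB[x1 x2]; split; rewrite (le_trans (ler_normB _ _))// lerD//.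
  by rewrite lerDl.
by rewrite lerDr.
Qed.

(** The expansion of [|x - y|^2 - |x - z|^2] around [z] is [|y - z|^2 - 2 (y - z) . (x - z)]. Area
    and first moments of the cell are thus all that enters, and the moments supply the gradient
    [- 2 V (c - z)]. *)
Lemma tcell_sqdB Z j (y : R * R) :
  \int[mu2]_(x in tcell Z j) (sqd x y - sqd x (Z j)) =
  sqd y (Z j) * (\int[mu2]_(x in tcell Z j) 1) -
  2 * ((y.1 - (Z j).1) * (\int[mu2]_(x in tcell Z j) (x.1 - (Z j).1)) +
       (y.2 - (Z j).2) * (\int[mu2]_(x in tcell Z j) (x.2 - (Z j).2))).
Proof.
have mt := measurable_tcell Z j; set z := Z j.
have i0 : mu2.-integrable (tcell Z j) (EFin \o (fun=> 1)).
  by apply: (@intble_on_tcell _ _ _ 1) => // x _; rewrite normr1.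
have i1 : mu2.-integrable (tcell Z j) (EFin \o (fun x => x.1 - z.1)).
  apply: (@intble_on_tcell _ _ _ (B + (`|z.1| + `|z.2|))); first exact: measurable_funB.
  by move=> x /(coord_bounded z)[].
have i2 : mu2.-integrable (tcell Z j) (EFin \o (fun x => x.2 - z.2)).
  apply: (@intble_on_tcell _ _ _ (B + (`|z.1| + `|z.2|))); first exact: measurable_funB.
  by move=> x /(coord_bounded z)[].
rewrite -[X in _ = X - _]RintegralZl//.
rewrite -[X in 2 * (X + _)]RintegralZl// -[X in 2 * (_ + X)]RintegralZl//.
rewrite -RintegralD//; [|exact: intbleMl|exact: intbleMl].
rewrite -RintegralZl//; last by apply: intbleD => //; exact: intbleMl.
rewrite -RintegralB//; [|exact: intbleMl|by apply: intbleMl => //; apply: intbleD => //; exact: intbleMl].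
by apply: eq_Rintegral => x _; rewrite /sqd; ring.
Qed.

Lemma sqd_lip (B' e : R) (x z z' : R * R) : D x ->
  `|z.1| <= B' -> `|z.2| <= B' -> `|z'.1| <= B' -> `|z'.2| <= B' ->
  `|z.1 - z'.1| <= e -> `|z.2 - z'.2| <= e ->
  `|sqd x z - sqd x z'| <= 4 * (B + B') * e.
Proof.
move=> Dx z1 z2 w1 w2 e1 e2; have [x1 x2] := DB Dx.
have one (a u v : R) : `|a| <= B -> `|u| <= B' -> `|v| <= B' -> `|u - v| <= e ->
    `|(a - u) ^+ 2 - (a - v) ^+ 2| <= 2 * (B + B') * e.
  move=> ha hu hv huv; rewrite subr_sqr normrM mulrC ler_pM//.
    rewrite (_ : a - u + (a - v) = a + a - (u + v)); last by ring.
    rewrite (le_trans (ler_normB _ _))// mulr_natl mulrnDl !mulr2n lerD//.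
      by rewrite (le_trans (ler_normD _ _))// lerD.
    by rewrite (le_trans (ler_normD _ _))// lerD.
  by rewrite (_ : a - u - (a - v) = v - u) 1?distrC//; ring.
rewrite /sqd (_ : _ - _ = ((x.1 - z.1) ^+ 2 - (x.1 - z'.1) ^+ 2) +
  ((x.2 - z.2) ^+ 2 - (x.2 - z'.2) ^+ 2)); last by ring.
rewrite (le_trans (ler_normD _ _))//.
rewrite (_ : 4 * (B + B') * e = 2 * (B + B') * e + 2 * (B + B') * e); last by ring.
by rewrite lerD// one.
Qed.

(* Where the cells of [Z j] and [Z' j] differ, the point is close to a bisector
   of [Z j]. *)
Lemma tcell_lip (B' s e M : R) Z Z' j (f f' : P2 -> R) :
  0 <= B' -> 0 < s -> 0 <= e -> 0 <= M -> separated s Z ->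
  (forall i, `|(Z i).1| <= B' /\ `|(Z i).2| <= B') ->
  (forall i, `|(Z' i).1| <= B' /\ `|(Z' i).2| <= B') ->
  (forall i, `|(Z i).1 - (Z' i).1| <= e /\ `|(Z i).2 - (Z' i).2| <= e) ->
  measurable_fun setT f -> measurable_fun setT f' ->
  (forall x, D x -> `|f x| <= M) -> (forall x, D x -> `|f' x| <= M) ->
  (forall x, D x -> `|f x - f' x| <= e) ->
  `|\int[mu2]_(x in tcell Z j) f x - \int[mu2]_(x in tcell Z' j) f' x| <=
    (fine (mu2 D) + 2 * M * (#|J|%:R * (2 * B * (2 * (8 * (B + B')) / s)))) * e.
Proof.
move=> B'0 s0 e0 M0 sZ ZB Z'B ZZ' mf mf' fM f'M ff'.
(* A difference of two squared distances changes by at most twice the bound [4 * (B + B') * e] of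
   [sqd_lip]. *)
pose w := 8 * (B + B') * e.
have w0 : 0 <= w by rewrite !mulr_ge0// addr_ge0.
pose S i := if i == j then set0 else bisector w (Z j) (Z i).
have mS i : measurable (S i).
  by rewrite /S; case: ifP => _; [exact: measurable0|exact: measurable_strip].
pose c := 2 * B * (2 * w / s).
have c0 : 0 <= c by apply: mulr_ge0; [exact: mulr_ge0|apply: divr_ge0; [exact: mulr_ge0|exact: ltW]].
have Sc i : (mu2 (S i `&` D) <= c%:E)%E.
  rewrite /S; case: ifPn => ij.
    by rewrite set0I (_ : mu2 set0 = 0%E) ?lee_fin//; exact: measure0.
  by apply: bisector_le => //; apply: sZ; rewrite eq_sym.
have diff x i : D x -> `|(sqd x (Z i) - sqd x (Z j)) - (sqd x (Z' i) - sqd x (Z' j))| <= w.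
  move=> Dx; rewrite (_ : _ - _ = (sqd x (Z i) - sqd x (Z' i)) -
    (sqd x (Z j) - sqd x (Z' j))); last by ring.
  have [a1 a2] := ZB i; have [a3 a4] := Z'B i; have [a5 a6] := ZZ' i.
  have [b1 b2] := ZB j; have [b3 b4] := Z'B j; have [b5 b6] := ZZ' j.
  rewrite (_ : w = 4 * (B + B') * e + 4 * (B + B') * e); last by rewrite /w; ring.
  apply: (le_trans (ler_normB _ _)); apply: lerD; exact: sqd_lip.
have key x : D x -> `|\1_(tcell Z j) x * f x - \1_(tcell Z' j) x * f' x| <=
    e + 2 * M * \sum_i \1_(S i) x.
  move=> Dx; have fx := fM _ Dx; have f'x := f'M _ Dx; have fd := ff' _ Dx.
  have [[i xi]|nS] := pselect (exists i, S i x).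
    have h1 : 1 <= \sum_i \1_(S i) x :> R.
      rewrite (bigD1 i)//= indicE mem_set// lerDl sumr_ge0//.
    apply: (@le_trans _ _ (e + 2 * M * 1)); last by rewrite lerD2l ler_wpM2l// mulr_ge0.
    rewrite mulr1 !indicE (le_trans (ler_normB _ _))//.
    apply: (@le_trans _ _ (M + M)); last by rewrite mulr_natl mulr2n lerDr.
    by apply: lerD; case: (x \in _); rewrite ?mul1r ?mul0r ?normr0.
  (* If exactly one of the two cells contained [x], some comparison with [j] would change sign
     between [Z] and [Z'], which puts [x] within [w] of that bisector of [Z]. *)
  have -> : \1_(tcell Z' j) x = \1_(tcell Z j) x :> R.
    suff E : tcell Z' j x <-> tcell Z j x.
      rewrite !indicE; congr (nat_of_bool _)%:R.
      by apply/idP/idP; rewrite !inE; apply E.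
    split=> -[_ H]; split=> // i ij.
      rewrite ltNge; apply/negP => h; apply: nS; exists i; rewrite /S (negbTE ij).
      apply: bisectorP => //; have := diff x i Dx; have := H _ ij.
      move: (sqd x (Z i)) (sqd x (Z j)) (sqd x (Z' i)) (sqd x (Z' j)) h => a b c' d h h1.
      by move=> /ler_normlP[h2 h3]; rewrite ler0_norm ?subr_le0//; lra.
    rewrite ltNge; apply/negP => h; apply: nS; exists i; rewrite /S (negbTE ij).
    apply: bisectorP => //; have := diff x i Dx; have := H _ ij.
    move: (sqd x (Z i)) (sqd x (Z j)) (sqd x (Z' i)) (sqd x (Z' j)) h => a b c' d h h1.
    by move=> /ler_normlP[h2 h3]; rewrite ger0_norm ?subr_ge0//; lra.
  rewrite -mulrBr indicE.
  have h0 : 0 <= 2 * M * \sum_i \1_(S i) x.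
    by rewrite !mulr_ge0// sumr_ge0.
  case: (x \in _); rewrite ?mul1r ?mul0r ?normr0; last by rewrite addr_ge0.
  by rewrite (le_trans fd)// lerDl.
have i1 := intble_tcell Z j mf fM; have i2 := intble_tcell Z' j mf' f'M.
have M20 : 0 <= 2 * M by rewrite mulr_ge0.
rewrite !tcell_restr.
have E : (fine (mu2 D) + 2 * M * (#|J|%:R * (2 * B * (2 * (8 * (B + B')) / s)))) * e =
  e * fine (mu2 D) + 2 * M * (#|J|%:R * c) by rewrite /c /w; ring.
rewrite E ler_norml; apply/andP; split.
  have := Rintegral_le_except mD lebesgue2_bounded_lty M20 mS Sc i2 i1 (e := e).
  rewrite lerBrDr -lerBrDl opprK addrC => -> // x Dx.
  have /ler_normlP[+ _] := key x Dx; lra.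
have := Rintegral_le_except mD lebesgue2_bounded_lty M20 mS Sc i1 i2 (e := e).
rewrite -lerBlDl => -> // x Dx.
have /ler_normlP[_ +] := key x Dx; lra.
Qed.

End Tessellation.

Section TcellAe.
Variables (R : realType) (J : finType).
Notation mu2 := (@lebesgue2 R).
Notation P2 := (measurableTypeR R * measurableTypeR R)%type.
Variables (D : set P2) (B : R).
Hypothesis mD : measurable D.
Hypothesis DB : forall x, D x -> `|x.1| <= B /\ `|x.2| <= B.
Hypothesis B0 : 0 <= B.
Implicit Types Z Y : J -> R * R.

Lemma tcell_disjoint Z i j x : tcell D Z i x -> tcell D Z j x -> i = j.
Proof.
move=> [_ hi] [_ hj]; apply/eqP/negP => /negP ij.
have := hi j; rewrite eq_sym ij => /(_ isT) h1.
have := lt_trans h1 (hj i ij); by rewrite ltxx.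
Qed.

Lemma tcell_cover_ae s Z (j0 : J) : 0 < s -> separated s Z ->
  exists N : set P2, [/\ measurable N, mu2 N = 0%E &
    forall x, D x -> ~ N x -> exists j, tcell D Z j x].
Proof.
move=> s0 sZ; pose N := D `\` \bigcup_(j in [set: J]) tcell D Z j.
have mU : measurable (\bigcup_(j in [set: J]) tcell D Z j).
  by apply: fin_bigcup_measurable; [exact: finite_finset|move=> j _; exact: measurable_tcell].
have mN : measurable N by exact: measurableD.
exists N; split=> //; last first.
  move=> x Dx nN; apply: contrapT => h; apply: nN; split=> // -[j _ xj]; apply: h.
  by exists j.
have fN : (mu2 N < +oo)%E.
  apply: le_lt_trans (lebesgue2_bounded_lty mD DB B0).
  by apply: le_measure; rewrite ?inE//; move=> x [].
(* A point outside all cells lies on the bisector of two nearest generators. *)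
pose tie (p : J * J) : set P2 := if p.1 == p.2 then set0 else bisector B 0 (Z p.1) (Z p.2).
have mtie p : measurable (tie p).
  by rewrite /tie; case: ifP => _; [exact: measurable0|exact: measurable_bisector].
have tie0 p : (mu2 (tie p `&` D) <= 0%:E)%E.
  rewrite /tie; case: ifPn => np.
    by rewrite set0I (_ : mu2 set0 = 0%E) ?lee_fin//; exact: measure0.
  by apply: (le_trans (bisector_le mD B0 s0 _ (sZ _ _ np))) => //; rewrite mulr0 mul0r mulr0.
have := @Rintegral_le_except _ _ R mu2 D mD (lebesgue2_bounded_lty mD DB B0) (J * J)%type tie
  (\1_N) (fun=> 0) 0 1 0 ler01 mtie tie0.
rewrite Rintegral_indic// ?Rintegral_cst// !mul0r !mulr0 !addr0.
move=> H; have {}H : fine (mu2 (N `&` D)) <= 0.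
  apply: H.
  - by apply: intble_indic => //; exact: lebesgue2_bounded_lty mD DB B0.
  - by apply: intble_cst => //; exact: lebesgue2_bounded_lty mD DB B0.
  - move=> x Dx; rewrite !add0r mul1r indicE; case: (boolP (x \in N)); last first.
      by move=> _; rewrite sumr_ge0.
    rewrite inE => -[_ nx].
    have [i Ei] := inf_finType_attained j0 (fun j => sqd x (Z j)).
    have leZ j : sqd x (Z i) <= sqd x (Z j) by rewrite -Ei; exact: (inf_finType_le (fun j => sqd x (Z j))).
    have [j [ji Ej]] : exists j, j != i /\ sqd x (Z j) = sqd x (Z i).
      apply: contrapT => nH; apply: nx; exists i => //; split=> // j ji.
      rewrite lt_neqAle leZ andbT; apply/eqP => E; apply: nH; exists j; split=> //.
    have tx : tie (i, j) x.
      rewrite /tie /= eq_sym (negbTE ji); apply: (bisectorP DB) => //.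
      by rewrite Ej subrr normr0.
    by rewrite (bigD1 (i, j))//= indicE mem_set// lerDl sumr_ge0.
apply/eqP; rewrite eq_le measure_ge0 andbT -(setIidl (_ : N `<=` D)); last by move=> x [].
rewrite -(@fineK _ (mu2 (N `&` D))) ?lee_fin//.
rewrite ge0_fin_numE//; apply: le_lt_trans fN.
by apply: le_measure; rewrite ?inE//; exact: measurableI.
Qed.

End TcellAe.

(** * Lattice reduction *)

Section LatticeOf.
Variable R : realType.
Implicit Types (Om : domain R) (x y z k : R * R).

(** A planar domain counts as a quotient by the trivial lattice, so that one argument covers both
    kinds of domain. *)
Definition lat Om : set (R * R) :=
  match Om with Planar _ => [set 0] | Torus l1 l2 => lattice l1 l2 end.

Lemma lat0 Om : lat Om 0.
Proof. by case: Om => //= l1 l2; exists 0, 0; rewrite !mulr0z addr0. Qed.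

Lemma latN Om k : lat Om k -> lat Om (- k).
Proof.
case: Om => [A -> /=|l1 l2 /= [a [b ->]]]; first by rewrite oppr0.
by exists (- a), (- b); rewrite !mulrNz opprD.
Qed.

Lemma latD Om k k' : lat Om k -> lat Om k' -> lat Om (k + k').
Proof.
case: Om => [A -> -> /=|l1 l2 /= [a [b ->]] [c [d ->]]]; first by rewrite addr0.
by exists (a + c), (b + d); rewrite !mulrzDr addrACA.
Qed.

Lemma pdistE Om x y : pdist Om x y = inf [set enorm (x - y - k) | k in lat Om].
Proof.
case: Om => [A|l1 l2] //=.
rewrite (_ : [set _ | _ in _] = [set enorm (x - y)]) ?inf1//.
apply/seteqP; split=> [_ [k /= -> <-]|_ /= ->]; first by rewrite subr0.
by exists 0 => //; rewrite subr0.
Qed.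

Lemma pdist_le Om x y k : lat Om k -> pdist Om x y <= enorm (x - y - k).
Proof.
move=> lk; rewrite pdistE; apply: ge_inf; last by exists k.
by exists 0 => _ [k' _ <-]; exact: enorm_ge0.
Qed.

Lemma pdist_lat0 Om x y : lat Om (x - y) -> pdist Om x y = 0.
Proof.
move=> l; apply/eqP; rewrite eq_le pdist_ge0 andbT.
by rewrite (le_trans (pdist_le x y l))// subrr enorm0.
Qed.

Lemma pdist_latr Om x y y' : lat Om (y - y') -> pdist Om x y = pdist Om x y'.
Proof.
move=> l; apply/eqP; rewrite eq_le; apply/andP; split.
  by rewrite (le_trans (pdist_triangle Om x y' y))// (pdistC Om y') (pdist_lat0 l) addr0.
by rewrite (le_trans (pdist_triangle Om x y y'))// (pdist_lat0 l) addr0.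
Qed.

Lemma pdist_latl Om x x' y : lat Om (x - x') -> pdist Om x y = pdist Om x' y.
Proof. by move=> l; rewrite pdistC (pdist_latr _ l) pdistC. Qed.

Lemma pdist_le_enorm Om x y : pdist Om x y <= enorm (x - y).
Proof. by have := pdist_le x y (lat0 Om); rewrite subr0. Qed.

Lemma enorm_sqd x z : enorm (x - z) = Num.sqrt (sqd x z).
Proof. by rewrite /enorm /dot /sqd /= !expr2. Qed.

Lemma enormB_sqd x z k : enorm (x - z - k) = Num.sqrt (sqd x (z + k)).
Proof. by rewrite -enorm_sqd opprD addrA. Qed.

Lemma enorm_ge1 x : `|x.1| <= enorm x.
Proof.
rewrite /enorm /dot -sqrtr_sqr ler_wsqrtr// expr2 lerDl -expr2; exact: sqr_ge0.
Qed.

Lemma enorm_ge2 x : `|x.2| <= enorm x.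
Proof.
rewrite /enorm /dot -sqrtr_sqr ler_wsqrtr// expr2 lerDr -expr2; exact: sqr_ge0.
Qed.

Lemma enorm_le_add x : enorm x <= `|x.1| + `|x.2|.
Proof.
rewrite -[leRHS]ger0_norm ?addr_ge0// -sqrtr_sqr ler_wsqrtr// /dot sqrrD -!expr2.
by rewrite !real_normK ?num_real// addrAC lerDl mulrn_wge0// mulr_ge0.
Qed.

Lemma enorm_ge_half x s : s <= enorm x -> s / 2 <= `|x.1| \/ s / 2 <= `|x.2|.
Proof.
move=> h; have := le_trans h (enorm_le_add x).
by have [|h1 h2] := leP (s / 2) `|x.1|; [left|right; lra].
Qed.

Lemma enorm_sqr x z : enorm (x - z) ^+ 2 = sqd x z.
Proof. by rewrite enorm_sqd sqr_sqrtr ?sqd_ge0. Qed.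

End LatticeOf.

Notation P2 R := (measurableTypeR R * measurableTypeR R)%type.

(* Seen from a point of the fundamental set, the translates of a generator by
   the finitely many vectors [red_vec] contain the nearest one. *)
Record lattice_reduction (R : realType) (Om : domain R) := LatticeReduction {
  red_bd : R;
  red_idx : finType;
  red_vec : red_idx -> R * R;
  red_idx0 : red_idx;
  red_bd_ge0 : 0 <= red_bd;
  red_measurable : measurable (fundamental Om : set (P2 R));
  red_bounded : forall x, fundamental Om x -> `|x.1| <= red_bd /\ `|x.2| <= red_bd;
  red_points : fundamental Om `<=` points Om;
  red_vec0 : red_vec red_idx0 = 0;
  red_vec_inj : injective red_vec;
  red_vec_lat : forall k, lat Om (red_vec k);
  red_far : forall x z k, fundamental Om x -> lat Om k ->
    `|z.1| <= red_bd + 1 -> `|z.2| <= red_bd + 1 ->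
    (exists j, red_vec j = k) \/ sqd x z < sqd x (z + k);
  red_disjoint : forall x y, fundamental Om x -> fundamental Om y ->
    lat Om (x - y) -> x = y;
  red_tile : forall y, points Om y -> exists2 m, lat Om m & fundamental Om (y + m);
  red_min : exists2 m : R, 0 < m & forall k, lat Om k -> k != 0 -> m <= enorm k
}.

Section RintegralPlane.
Variable R : realType.
Notation mu2 := (@lebesgue2 R).
Variables (D : set (P2 R)).
Hypothesis mD : measurable D.

Lemma Rintegral_eq_except (N : set (P2 R)) (f g : P2 R -> R) :
  measurable N -> mu2 N = 0%E ->
  mu2.-integrable D (EFin \o f) -> mu2.-integrable D (EFin \o g) ->
  (forall x, D x -> ~ N x -> f x = g x) ->
  \int[mu2]_(x in D) f x = \int[mu2]_(x in D) g x.
Proof.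
move=> mN N0 hf hg fg; rewrite /Rintegral.
rewrite (negligible_integral mN mD hf N0) (negligible_integral mN mD hg N0).
by congr fine; apply: eq_integral => x; rewrite inE => -[Dx Nx] /=; rewrite fg.
Qed.

Lemma Rintegral_translation (c : P2 R) (f : P2 R -> R) (M : R) :
  (mu2 D < +oo)%E -> measurable_fun setT f -> (forall x, D x -> `|f x| <= M) ->
  \int[mu2]_(x in (fun x : P2 R => (x.1 + c.1, x.2 + c.2)) @^-1` D)
     f (x.1 + c.1, x.2 + c.2) = \int[mu2]_(x in D) f x.
Proof.
move=> fD mf fM; set T := fun x : P2 R => _.
have mT := measurable_translation c.
have mTD : measurable (T @^-1` D) by rewrite -[X in measurable X]setTI; exact: mT.
rewrite /Rintegral; congr fine.
transitivity (\int[pushforward_measure mu2 mT]_(x in D) (f x)%:E)%E.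
  rewrite (@integral_pushforward _ _ _ _ _ _ mT _ D)//.
    by apply/measurable_EFinP.
  have := @intble_bounded _ _ R mu2 (T @^-1` D) mTD _ (f \o T) M; apply.
  - apply: le_lt_trans fD; rewrite le_eqVlt; apply/orP; left; apply/eqP.
    exact: lebesgue2_translation.
  - by apply: measurable_funTS; exact: measurableT_comp.
  - by move=> x Dx; exact: fM.
by apply: eq_measure_integral => A mA _; exact: lebesgue2_translation.
Qed.

Lemma Rintegral_bigsetU (K : finType) (F : K -> set (P2 R)) (f : P2 R -> R) :
  (forall k, measurable (F k)) -> trivIset setT F -> D = \bigcup_(k in [set: K]) F k ->
  mu2.-integrable D (EFin \o f) ->
  \int[mu2]_(x in D) f x = \sum_k \int[mu2]_(x in F k) f x.
Proof.
move=> mF tF DE hf.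
have DE' : D = \big[setU/set0]_(k <- index_enum K) F k.
  by rewrite DE -bigcup_seq; apply: eq_bigcupl; split=> k //= _; exact: mem_index_enum.
have hFk k : mu2.-integrable (F k) (EFin \o f).
  apply: integrableS hf => //; rewrite DE => x Fx; by exists k.
apply: EFin_inj; rewrite /Rintegral fineK; last exact: integrable_fin_num hf.
rewrite -sumEFin DE' (@integral_bigsetU_EFin _ _ _ mu2 _ _ f) //=.
- by apply: eq_bigr => i _; rewrite fineK//; exact: integrable_fin_num (hFk i).
- exact: index_enum_uniq.
- by apply: sub_trivIset tF.
- by rewrite -DE'; exact: measurable_int hf.
Qed.

End RintegralPlane.

(** * Voronoi integrals through the lifted generators *)

Section Reduction.
Variables (R : realType) (Om : domain R) (N : nat).
Variable rd : lattice_reduction Om.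
Notation mu2 := (@lebesgue2 R).
Notation K := (red_idx rd).
Notation vec := (@red_vec _ _ rd).
Notation B := (red_bd rd).
Notation D := (fundamental Om : set (P2 R)).
Implicit Types X Y : config Om N.

Let mD := red_measurable rd.
Let DB := @red_bounded _ _ rd.
Let B0 := red_bd_ge0 rd.
Let fD : (mu2 D < +oo)%E. Proof. exact: lebesgue2_bounded_lty mD DB B0. Qed.

(** The slack [1] over the size of the fundamental set leaves room for a second configuration at sup
    distance at most [1], moved by the same lattice vectors. *)
Definition normalized X : Prop := forall i, `|(X i).1| <= B + 1 /\ `|(X i).2| <= B + 1.

Definition equivalent X X' : Prop := forall i, lat Om (X i - X' i).

Definition lift X : 'I_N * K -> R * R := fun p => X p.1 + vec p.2.

(** A minimizer over the finitely many [vec k] exists. By [red_far] any other lattice vector loses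
    against the zero vector, which is itself one of the [vec k]. *)
Lemma nearest_translate x z : D x -> `|z.1| <= B + 1 -> `|z.2| <= B + 1 ->
  exists k : K, pdist Om x z = enorm (x - z - vec k) /\
    forall k', lat Om k' -> sqd x (z + vec k) <= sqd x (z + k').
Proof.
move=> Dx z1 z2.
have [k Hk] : exists k : K, forall k' : K, sqd x (z + vec k) <= sqd x (z + vec k').
  have [k E] := inf_finType_attained (red_idx0 rd) (fun k => sqd x (z + vec k)).
  exists k => k'; rewrite -E; exact: (inf_finType_le (fun k => sqd x (z + vec k))).
have Hk' k' : lat Om k' -> sqd x (z + vec k) <= sqd x (z + k').
  move=> lk'; have [[j <-]//|h] := red_far Dx lk' z1 z2.
  by apply: le_trans (ltW h); have := Hk (red_idx0 rd); rewrite red_vec0 addr0.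
exists k; split=> //; apply/eqP; rewrite eq_le pdist_le/=; last exact: red_vec_lat.
rewrite pdistE; apply: lb_le_inf; first by exists (enorm (x - z - 0)); exists 0 => //; exact: lat0.
by move=> _ [k' lk' <-]; rewrite !enormB_sqd ler_wsqrtr// Hk'.
Qed.

Lemma pdist_sqr x z : D x -> `|z.1| <= B + 1 -> `|z.2| <= B + 1 ->
  pdist Om x z ^+ 2 = inf [set sqd x (z + vec k) | k in [set: K]].
Proof.
move=> Dx z1 z2; have [k [-> Hk]] := nearest_translate Dx z1 z2.
rewrite enormB_sqd sqr_sqrtr ?sqd_ge0//; apply/eqP; rewrite eq_le; apply/andP; split.
  apply: lb_le_inf; first by exists (sqd x (z + vec k)); exists k.
  by move=> _ [k' _ <-]; apply: Hk; exact: red_vec_lat.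
exact: (inf_finType_le (fun k => sqd x (z + vec k))).
Qed.

Lemma energy_lift X X' : (0 < N)%N -> equivalent X X' -> normalized X' ->
  energy X = tenergy D (lift X').
Proof.
move=> N0 eX nX'; rewrite /energy /tenergy; apply: eq_Rintegral => x /[!inE] Dx.
have E i : pdist Om x (X i) ^+ 2 = inf [set sqd x (X' i + vec k) | k in [set: K]].
  by have [h1 h2] := nX' i; rewrite (pdist_latr _ (eX i)) pdist_sqr.
pose i0 := Ordinal N0; apply/eqP; rewrite eq_le; apply/andP; split.
  have [[i k] ->] := inf_finType_attained (i0, red_idx0 rd) (fun p => sqd x (lift X' p)).
  apply: (le_trans (inf_finType_le (fun i => pdist Om x (X i) ^+ 2) i)).
  by rewrite E; exact: (inf_finType_le (fun k => sqd x (X' i + vec k))).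
have [i ->] := inf_finType_attained i0 (fun i => pdist Om x (X i) ^+ 2).
rewrite E; have [k ->] := inf_finType_attained (red_idx0 rd) (fun k => sqd x (X' i + vec k)).
exact: (inf_finType_le (fun p => sqd x (lift X' p)) (i, k)).
Qed.

(** The distance to another generator is attained by one of its lifted translates, with which the
    strict inequality of [tcell] compares. The converse holds only up to ties between translates of
    the same generator. *)
Lemma cell_lift X X' i x : equivalent X X' -> normalized X' -> D x ->
  (exists k, tcell D (lift X') (i, k) x) -> cell X i x.
Proof.
move=> eX nX' Dx [k [_ H]]; split; first exact: (red_points rd Dx).
move=> j ji; have [h1 h2] := nX' i; have [h3 h4] := nX' j.
rewrite (pdist_latr _ (eX i)) (pdist_latr _ (eX j)).
have [k' [-> _]] := nearest_translate Dx h3 h4.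
apply: (le_lt_trans (pdist_le _ _ (red_vec_lat k))).
rewrite !enormB_sqd ltr_sqrt; last first.
  apply: (le_lt_trans (sqd_ge0 x (X' i + vec k))); apply: (H (j, k')).
  by apply: contraNneq ji => -[->].
by apply: (H (j, k')); apply: contraNneq ji => -[->].
Qed.

Lemma cell_measurable X X' i : equivalent X X' -> normalized X' ->
  measurable (D `&` cell X i : set (P2 R)).
Proof.
move=> eX nX'; pose pd j x := inf [set sqd x (X' j + vec k) | k in [set: K]].
have mpd j : measurable_fun [set: P2 R] (pd j).
  by apply: (measurable_inf_finType (red_idx0 rd)) => k; exact: sqd_measurable.
rewrite (_ : D `&` cell X i = D `&` \bigcap_(j in [set j | j != i]) [set x | pd i x < pd j x]).
  apply: measurableI => //; apply: fin_bigcap_measurable; first exact: finite_finset.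
  move=> j _; rewrite -[X in measurable X]setTI.
  rewrite (_ : [set x | _] = (fun x => pd j x - pd i x) @^-1` `]0, +oo[%classic).
    have : measurable_fun [set: P2 R] (fun x => pd j x - pd i x).
      by apply: measurable_funB.
    by apply => //; exact: measurable_itv.
  by apply/seteqP; split=> x /=; rewrite in_itv/= andbT subr_gt0.
have E x j : D x -> pdist Om x (X j) ^+ 2 = pd j x.
  by move=> Dx; have [h1 h2] := nX' j; rewrite (pdist_latr _ (eX j)) pdist_sqr.
have lt2 x j : D x -> (pdist Om x (X i) < pdist Om x (X j)) = (pd i x < pd j x).
  by move=> Dx; rewrite -!E// ltr_pXn2r ?nnegrE ?pdist_ge0.
apply/seteqP; split=> x /= [Dx H]; split=> //.
  by move=> j ji; have [_ h] := H; have := h j ji; rewrite lt2.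
split; first exact: (red_points rd Dx).
by move=> j ji; rewrite lt2//; exact: H.
Qed.

Lemma intble_D (f : P2 R -> R) (M : R) : measurable_fun D f ->
  (forall x, D x -> `|f x| <= M) -> mu2.-integrable D (EFin \o f).
Proof. exact: (@intble_bounded _ _ R mu2 D mD fD). Qed.

Lemma intble_indicM (A : set (P2 R)) (f : P2 R -> R) (M : R) : measurable A ->
  measurable_fun setT f -> (forall x, D x -> `|f x| <= M) ->
  mu2.-integrable D (EFin \o (fun x => \1_A x * f x)).
Proof.
move=> mA mf fM; apply: (@intble_D _ M).
  by apply: measurable_funTS; apply: measurable_funM => //; exact: measurable_indic.
move=> x Dx; rewrite indicE; case: (x \in _); rewrite ?mul1r ?mul0r; first exact: fM.
by rewrite normr0 (le_trans _ (fM _ Dx)).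
Qed.

Lemma Rintegral_restr (A : set (P2 R)) (f : P2 R -> R) :
  \int[mu2]_(x in D `&` A) f x = \int[mu2]_(x in D) (\1_A x * f x).
Proof.
rewrite Rintegral_mkcondr; apply: eq_Rintegral => x _.
by rewrite patchE indicE; case: (x \in _); rewrite ?mul1r ?mul0r.
Qed.

(* The sets [A] and the union of the cells of the translates of [X' i] agree up
   to the ties. *)
Lemma Rintegral_lift_cells X' i s (A : set (P2 R)) (f : P2 R -> R) (M : R) :
  0 < s -> separated s (lift X') -> measurable (D `&` A) ->
  (forall x k, tcell D (lift X') (i, k) x -> A x) ->
  (forall x j k, j != i -> tcell D (lift X') (j, k) x -> ~ A x) ->
  measurable_fun setT f -> (forall x, D x -> `|f x| <= M) ->
  \int[mu2]_(x in D `&` A) f x =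
    \sum_k \int[mu2]_(x in tcell D (lift X') (i, k)) f x.
Proof.
move=> s0 sX mA HA HA' mf fM.
have [Nl [mN N0 HN]] := tcell_cover_ae mD DB B0 (i, red_idx0 rd) s0 sX.
have mt p : measurable (tcell D (lift X') p) by exact: measurable_tcell.
rewrite -(setIidr (_ : D `&` A `<=` D)); last by move=> x [].
rewrite Rintegral_restr.
rewrite (eq_bigr (fun k => \int[mu2]_(x in D) (\1_(tcell D (lift X') (i, k)) x * f x))); last first.
  by move=> k _; rewrite tcell_restr.
have ik k : mu2.-integrable D (EFin \o (fun x => \1_(tcell D (lift X') (i, k)) x * f x)).
  exact: (@intble_indicM _ _ M).
rewrite -Rintegral_sum//; apply: (Rintegral_eq_except mD mN N0).
- exact: (@intble_indicM _ _ M).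
- exact: intble_sum.
move=> x Dx Nx; have [[j k] xjk] := HN x Dx Nx; rewrite -mulr_suml; congr (_ * _).
have [ji|ji] := eqVneq j i.
  rewrite -ji in HA *; rewrite (bigD1 k)//= big1 => [|k' k'k].
    by rewrite addr0 !indicE !mem_set//; split=> //; exact: HA xjk.
  rewrite indicE memNset// => /tcell_disjoint /(_ xjk) [] /eqP.
  by rewrite (negbTE k'k).
rewrite big1 => [|k' _].
  by rewrite indicE memNset// => -[_]; exact: HA' xjk.
by rewrite indicE memNset// => /tcell_disjoint /(_ xjk) [] E; rewrite E eqxx in ji.
Qed.

Lemma cell_Rintegral X X' i s (f : P2 R -> R) (M : R) : equivalent X X' -> normalized X' ->
  0 < s -> separated s (lift X') ->
  measurable_fun setT f -> (forall x, D x -> `|f x| <= M) ->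
  \int[mu2]_(x in D `&` cell X i) f x =
    \sum_k \int[mu2]_(x in tcell D (lift X') (i, k)) f x.
Proof.
move=> eX nX' s0 sX; apply: (Rintegral_lift_cells s0 sX).
- exact: (cell_measurable _ eX nX').
- by move=> x k xk; apply: (cell_lift eX nX'); [case: xk|exists k].
- move=> x j k ji xk [_ /(_ j ji) h].
  have [_ /(_ i) h'] : cell X j x by apply: (cell_lift eX nX'); [case: xk|exists k].
  by have := lt_trans h (h' _); rewrite eq_sym ltxx => /(_ ji).
Qed.

(** Moments of order zero and one of a Voronoi cell, cut into pieces inside the fundamental set,
    each piece seen from its own translate of the generator. In this form [tcell_lip] applies to
    them. *)
Definition moment_area X i : R :=
  \sum_k \int[mu2]_(x in tcell D (lift X) (i, k)) 1.

Definition moment1 X i : R :=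
  \sum_k \int[mu2]_(x in tcell D (lift X) (i, k)) (x.1 - (lift X (i, k)).1).

Definition moment2 X i : R :=
  \sum_k \int[mu2]_(x in tcell D (lift X) (i, k)) (x.2 - (lift X (i, k)).2).

Lemma cell_area_lift X X' i s : equivalent X X' -> normalized X' ->
  0 < s -> separated s (lift X') -> cell_area X i = moment_area X' i.
Proof.
move=> eX nX' s0 sX.
rewrite /moment_area -(@cell_Rintegral X X' i s (fun=> 1) 1)//; last by move=> x _; rewrite normr1.
rewrite Rintegral_cst; last exact: (@cell_measurable X X' i).
by rewrite mul1r setIC.
Qed.

(** Closed counterpart of [tcell], because [lattice_cell] is defined by large inequalities; the two
    differ by ties only. *)
Let ccell (Z : 'I_N * K -> R * R) p : set (P2 R) :=
  [set x | D x /\ forall q, sqd x (Z p) <= sqd x (Z q)].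

Let measurable_ccell Z p : measurable (ccell Z p).
Proof.
rewrite (_ : ccell Z p = D `&` \bigcap_(q in [set: 'I_N * K]) [set x | sqd x (Z p) <= sqd x (Z q)]).
  apply: measurableI => //; apply: fin_bigcap_measurable; first exact: finite_finset.
  move=> q _; rewrite -[X in measurable X]setTI.
  rewrite (_ : [set x | _] = (fun x => sqd x (Z q) - sqd x (Z p)) @^-1` `[0, +oo[%classic).
    have : measurable_fun [set: P2 R] (fun x => sqd x (Z q) - sqd x (Z p)).
      by apply: measurable_funB; exact: sqd_measurable.
    by apply => //; exact: measurable_itv.
  by apply/seteqP; split=> x /=; rewrite in_itv/= andbT subr_ge0.
by apply/seteqP; split=> x /= [Dx H]; split=> // q; [move=> _; exact: H|exact: H].
Qed.

Let Rintegral_ccell s X' i k (f : P2 R -> R) M : 0 < s -> separated s (lift X') ->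
  measurable_fun setT f -> (forall x, D x -> `|f x| <= M) ->
  \int[mu2]_(x in ccell (lift X') (i, k)) f x =
  \int[mu2]_(x in tcell D (lift X') (i, k)) f x.
Proof.
move=> s0 sX mf fM.
have [Nl [mN N0 HN]] := tcell_cover_ae mD DB B0 (i, k) s0 sX.
rewrite -(setIidr (_ : ccell (lift X') (i, k) `<=` D)); last by move=> x [].
rewrite -(setIidr (_ : tcell D (lift X') (i, k) `<=` D)); last by move=> x [].
rewrite !Rintegral_restr; apply: (Rintegral_eq_except mD mN N0).
- exact: (@intble_indicM _ _ M).
- by apply: (@intble_indicM _ _ M) => //; exact: measurable_tcell.
move=> x Dx Nx; have [p xp] := HN x Dx Nx; congr (_ * _); rewrite !indicE.
congr (nat_of_bool _)%:R; apply/idP/idP; rewrite !inE => -[_ H].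
  have [<-//|np] := eqVneq p (i, k).
  by case: xp => _ /(_ (i, k)); rewrite eq_sym np => /(_ isT); rewrite ltNge H.
by split=> // q; have [->//|nq] := eqVneq q (i, k); exact: ltW (H _ nq).
Qed.

(* Cutting the lattice cell along the translates of the fundamental set and
   translating the pieces back gives the cells of the translated generators. *)
Lemma Rintegral_lattice_cell X X' i s (P : set (P2 R)) (g : P2 R -> R) (M : R -> R) :
  equivalent X X' -> normalized X' -> 0 < s -> separated s (lift X') ->
  (forall y, exists2 m, lat Om m & fundamental Om (y + m)) ->
  P = [set y | forall j k, lat Om k -> enorm (y - X i) <= enorm (y - X j - k)] ->
  measurable_fun setT g ->
  (forall b p, `|p.1| <= b -> `|p.2| <= b -> `|g p| <= M b) ->
  [/\ measurable P, (mu2 P < +oo)%E & \int[mu2]_(y in P) g (y - X i) =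
    \sum_k \int[mu2]_(x in tcell D (lift X') (i, k)) g (x - lift X' (i, k))].
Proof.
move=> eX nX' s0 sX tile PE mg gM.
(* [kap] records the lattice vectors lost in the normalization; [T k] carries the piece of [P]
   belonging to the translate [k] into the fundamental set. *)
pose kap i := X i - X' i.
pose T (k : K) := fun y : P2 R => (y.1 + (vec k - kap i).1, y.2 + (vec k - kap i).2).
have TE k y : T k y = y + (vec k - kap i) by [].
pose F k := T k @^-1` ccell (lift X') (i, k).
have mF k : measurable (F k).
  rewrite -[X in measurable X]setTI.
  exact: (measurable_translation (vec k - kap i)).
have Teq k y : T k y - lift X' (i, k) = y - X i.
  rewrite TE /kap /lift /=; apply/pair_equal_spec; split; rewrite /=; ring.
have PF : P = \bigcup_(k in [set: K]) F k.
  rewrite PE; apply/seteqP; split=> y /=.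
    move=> Py; have [m lm Dm] := tile y.
    have lkm : lat Om (kap i + m) by apply: latD => //; exact: eX.
    have [n1 n2] := nX' i.
    have Ei : y + m - (X' i + (kap i + m)) = y - X i.
      by rewrite /kap; apply/pair_equal_spec; split; rewrite /=; ring.
    (* In the remaining case [y + m] is strictly closer to [X' i] than to the translate
       corresponding to [X i]; moving back by [m], a translate of [X i] beats [X i] itself, against
       membership in [P]. *)
    have [[k Ek]|h] := red_far Dm lkm n1 n2; last first.
      exfalso; move: h; rewrite ltNge -!enorm_sqr Ei lerXn2r ?nnegrE ?enorm_ge0//.
      have := Py i (- (kap i + m)) (latN lkm) => h.
      apply: (le_trans h); rewrite le_eqVlt; apply/orP; left; apply/eqP; congr enorm.
      by rewrite /kap; apply/pair_equal_spec; split; rewrite /=; ring.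
    exists k => //; have Ty : T k y = y + m by rewrite TE Ek addrAC subrr add0r.
    split; first by rewrite Ty.
    move=> [j k2]; rewrite -!enorm_sqr Teq lerXn2r ?nnegrE ?enorm_ge0//.
    have lj : lat Om (vec k2 - kap j - m).
      by apply: latD; [apply: latD; [exact: red_vec_lat|apply: latN; exact: eX]|exact: latN].
    apply: (le_trans (Py j _ lj)); rewrite le_eqVlt; apply/orP; left; apply/eqP; congr enorm.
    by rewrite Ty /kap /lift; apply/pair_equal_spec; split; rewrite /=; ring.
  move=> [k _ [DT H]] j k2 lk2.
  have [n1 n2] := nX' j.
  have [k3 [_ H3]] := nearest_translate DT n1 n2.
  have l4 : lat Om (k2 + kap j + vec k - kap i).
    apply: latD; last by apply: latN; exact: eX.
    by apply: latD; [apply: latD; [|exact: eX]|exact: red_vec_lat].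
  have h := le_trans (H (j, k3)) (H3 _ l4).
  rewrite -(ler_pXn2r (_ : 0 < 2)%N) ?nnegrE ?enorm_ge0// -(Teq k).
  rewrite enorm_sqr; apply: (le_trans h); rewrite -enorm_sqr.
  rewrite le_eqVlt; apply/orP; left; apply/eqP; congr (enorm _ ^+ 2).
  by rewrite TE /kap; apply/pair_equal_spec; split; rewrite /=; ring.
(* A point in two pieces has two lattice translates in the fundamental set; these coincide, and
   [vec] is injective. *)
have tF : trivIset setT F.
  move=> k k' _ _ [y [[Dk _] [Dk' _]]]; apply: (@red_vec_inj _ _ rd).
  have E : T k y = T k' y.
    apply: (@red_disjoint _ _ rd _ _ Dk Dk'); rewrite !TE.
    rewrite (_ : _ - _ = vec k - vec k'); last first.
      by apply/pair_equal_spec; split; rewrite /=; ring.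
    by apply: latD; [exact: red_vec_lat|apply: latN; exact: red_vec_lat].
  by move: E; rewrite !TE => /addrI /addIr.
have mP : measurable P.
  by rewrite PF; apply: fin_bigcup_measurable; [exact: finite_finset|move=> k _; exact: mF].
pose b := B + (B + 1) + \sum_k (`|(vec k).1| + `|(vec k).2|).
have b0 : 0 <= b by rewrite addr_ge0 ?addr_ge0 ?sumr_ge0// => k _; rewrite addr_ge0.
have cellb x k : D x -> `|(x - lift X' (i, k)).1| <= b /\ `|(x - lift X' (i, k)).2| <= b.
  move=> Dx; have [x1 x2] := DB Dx; have [n1 n2] := nX' i.
  have hk : `|(vec k).1| + `|(vec k).2| <= \sum_k (`|(vec k).1| + `|(vec k).2|).
    by rewrite [leRHS](bigD1 k)//= lerDl sumr_ge0// => j _; rewrite addr_ge0.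
  split; rewrite /lift /= opprD addrA (le_trans (ler_normB _ _))//; apply: lerD.
  - by rewrite (le_trans (ler_normB _ _))// lerD.
  - by apply: le_trans hk; rewrite lerDl.
  - by rewrite (le_trans (ler_normB _ _))// lerD.
  - by apply: le_trans hk; rewrite lerDr.
have Pb y : P y -> `|(y - X i).1| <= b /\ `|(y - X i).2| <= b.
  by rewrite PF => -[k _ [DT _]]; rewrite -(Teq k); exact: cellb.
have fP : (mu2 P < +oo)%E.
  apply: (@lebesgue2_bounded_lty _ P (b + `|(X i).1| + `|(X i).2|) mP).
    move=> y /Pb[h1 h2]; split.
      have := ler_normD (y - X i).1 (X i).1.
      rewrite [X in `|X|](_ : _ = y.1); last by rewrite /=; ring.
      move=> h; apply: (le_trans h).
      by rewrite -addrA; apply: lerD => //; rewrite lerDl.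
    have := ler_normD (y - X i).2 (X i).2.
    rewrite [X in `|X|](_ : _ = y.2); last by rewrite /=; ring.
    move=> h; apply: (le_trans h).
    by rewrite -addrA; apply: lerD => //; rewrite lerDr.
  by apply: addr_ge0 => //; apply: addr_ge0.
have mgX (z : R * R) : measurable_fun [set: P2 R] (fun y : P2 R => g (y - z)).
  apply: (measurableT_comp mg).
  exact: (measurable_translation (- z)).
split=> //; rewrite (Rintegral_bigsetU mP mF tF PF); last first.
  apply: (@intble_bounded _ _ R mu2 P mP fP _ (M b)); first exact: measurable_funTS.
  by move=> y /Pb[h1 h2]; exact: gM.
apply: eq_bigr => k _.
rewrite -(@Rintegral_ccell s X' i k _ (M b))//; last first.
  by move=> x Dx; have [h1 h2] := cellb x k Dx; exact: gM.
rewrite -(@Rintegral_translation _ (ccell (lift X') (i, k)) (measurable_ccell _ _)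
  (vec k - kap i) _ (M b))//.
- by apply: eq_Rintegral => y _; rewrite -(Teq k).
- by apply: le_lt_trans fD; apply: le_measure; rewrite ?inE// => x [].
- by move=> x [Dx _]; have [h1 h2] := cellb x k Dx; exact: gM.
Qed.

End Reduction.

Arguments normalized {R Om N} rd X.
Arguments lift {R Om N} rd X _.
Arguments moment_area {R Om N} rd X i.
Arguments moment1 {R Om N} rd X i.
Arguments moment2 {R Om N} rd X i.

(** Measurability refers to the product sigma-algebra, openness to the product topology: the
    countably many rational boxes contained in [A] link the two. *)
Lemma open_measurable_plane (R : realType) (A : set (R * R)) :
  open A -> measurable (A : set (P2 R)).
Proof.
move=> oA.
pose box (r : rat * rat * (rat * rat)) : set (P2 R) :=
  `]ratr r.1.1, ratr r.1.2[%classic `*` `]ratr r.2.1, ratr r.2.2[%classic.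
pose F r : set (P2 R) := if `[< box r `<=` A >] then box r else set0.
rewrite (_ : A = \bigcup_r F r).
  apply: countable_bigcupT_measurable => [|r]; first exact: countableP.
  rewrite /F; case: ifP => _; last exact: measurable0.
  by apply: measurableX; exact: measurable_itv.
apply/seteqP; split=> [x Ax|x [r _]]; last first.
  by rewrite /F; case: asboolP => [h|_ []]; exact: h.
have /nbhs_ballP[e /= e0 He] : nbhs x A by exact: open_nbhs_nbhs.
have near (u : R) : exists p q : rat, [/\ u - e < ratr p, ratr p < u, u < ratr q & ratr q < u + e].
  have /rat_in_itvoo[p /itvP hp] : u - e < u by rewrite gtrDl oppr_lt0.
  have /rat_in_itvoo[q /itvP hq] : u < u + e by rewrite ltrDl.
  by exists p, q; rewrite !hp !hq.
have [p [q [p1 p2 q1 q2]]] := near x.1; have [p' [q' [p1' p2' q1' q2']]] := near x.2.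
exists ((p, q), (p', q')) => //; rewrite /F; case: asboolP => [_|].
  by split; rewrite /= in_itv/= ?p2 ?q1 ?p2' ?q1'.
case=> y [/=]; rewrite !in_itv/= => /andP[y1 y2] /andP[y3 y4]; apply: He.
by split; rewrite /ball/= ltr_distlC; apply/andP; split; lra.
Qed.

Lemma planar_reduction (R : realType) (A : set (R * R)) :
  bounded_convex_lipschitz_domain A -> exists rd : lattice_reduction (Planar A), True.
Proof.
move=> [_ oA [M [_ bA]] _ _].
(* [bounded_set] provides bounds strictly above [M] only, and [M] may be negative. *)
have bd x : A x -> `|x.1| <= Num.max 0 (M + 1) /\ `|x.2| <= Num.max 0 (M + 1).
  move=> Ax; have := bA (M + 1); rewrite ltrDl ltr01 => /(_ isT x Ax) /=.
  by rewrite prod_normE ge_max !le_max => /andP[-> ->]; rewrite !orbT.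
have mA : measurable (A : set (P2 R)) by exact: open_measurable_plane.
unshelve eexists (@LatticeReduction R (Planar A) (Num.max 0 (M + 1)) unit (fun=> 0) tt _ mA bd _ _ _ _ _ _ _ _) => //=.
- by rewrite le_max lexx.
- by move=> [] [].
- by move=> x z k _ -> _ _; left; exists tt.
- by move=> x y _ _ /eqP; rewrite subr_eq0 => /eqP.
- by move=> y Ay; exists 0 => //; rewrite addr0.
- by exists 1 => // k ->; rewrite eqxx.
Qed.

Lemma plane_eq (R : realType) (p q : R * R) : p.1 = q.1 -> p.2 = q.2 -> p = q.
Proof. by case: p q => [a b] [c d] /= -> ->. Qed.

Lemma int_shift (m : nat) (a : int) : (absz a <= m)%N ->
  exists i : 'I_(2 * m).+1, (i : nat)%:Z - m%:Z = a.
Proof.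
move=> am; have h : (absz (a + m%:Z)%R < (2 * m).+1)%N by lia.
by exists (Ordinal h) => /=; lia.
Qed.

Lemma int_small_eq0 (c : int) : - 1 < c -> c < 1 -> c = 0.
Proof. lia. Qed.

(** * The lattice reduction of a torus *)

Section TorusReduction.
Variables (R : realType) (l1 l2 : R * R).
Hypothesis free : forall a b : R, a *: l1 + b *: l2 = 0 -> a = 0 /\ b = 0.

Let det := l1.1 * l2.2 - l1.2 * l2.1.

(** If the determinant vanished, the rows of the cofactor matrix would be relations between [l1] and
    [l2]; independence then forces [l1 = 0], which is itself a relation. *)
Let det_neq0 : det != 0.
Proof.
apply/negP => /eqP d0.
have e1 : l2.2 *: l1 + (- l1.2) *: l2 = 0.
  by apply: plane_eq; rewrite /= /GRing.scale/=; [rewrite -[RHS]d0 /det|]; ring.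
have e2 : l2.1 *: l1 + (- l1.1) *: l2 = 0.
  apply: plane_eq; rewrite /= /GRing.scale/=; first by ring.
  by rewrite -[RHS]oppr0 -[in RHS]d0 /det; ring.
have [_ /eqP] := free e1; rewrite oppr_eq0 => /eqP h1.
have [_ /eqP] := free e2; rewrite oppr_eq0 => /eqP h2.
have e3 : 1 *: l1 + 0 *: l2 = 0.
  by apply: plane_eq; rewrite /= /GRing.scale/= ?h1 ?h2 mulr0 mul0r addr0.
by have [/eqP] := free e3; rewrite oner_eq0.
Qed.

(** Together with [t], the coordinates in the basis [l1], [l2] by Cramer's rule. *)
Let s (z : R * R) := (z.1 * l2.2 - z.2 * l2.1) / det.
Let t (z : R * R) := (l1.1 * z.2 - l1.2 * z.1) / det.

Let coordK z : z = s z *: l1 + t z *: l2.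
Proof.
apply: plane_eq; rewrite /= /GRing.scale/= /s /t;
  by move: det_neq0; rewrite /det => d0; field.
Qed.

Let coord_s a b : s (a *: l1 + b *: l2) = a.
Proof. by rewrite /s /= /GRing.scale/=; move: det_neq0; rewrite /det => d0; field. Qed.

Let coord_t a b : t (a *: l1 + b *: l2) = b.
Proof. by rewrite /t /= /GRing.scale/=; move: det_neq0; rewrite /det => d0; field. Qed.

Let latE (a b : int) : l1 *~ a + l2 *~ b = (a%:~R : R) *: l1 + (b%:~R : R) *: l2.
Proof. by rewrite !scaler_int. Qed.

Let B := `|l1.1| + `|l1.2| + (`|l2.1| + `|l2.2|).

Let B0 : 0 <= B. Proof. by rewrite !addr_ge0. Qed.

Let fund_bd x : fundamental (Torus l1 l2) x -> `|x.1| <= B /\ `|x.2| <= B.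
Proof.
have one (a b u v : R) : 0 <= a < 1 -> 0 <= b < 1 -> `|a * u + b * v| <= `|u| + `|v|.
  move=> /andP[a0 a1] /andP[b0 b1]; rewrite (le_trans (ler_normD _ _))// !normrM.
  by rewrite (ger0_norm a0) (ger0_norm b0) lerD// ler_piMl// ltW.
move=> [a [b [ha hb ->]]]; split; rewrite /= /GRing.scale/=;
  by apply: le_trans (one _ _ _ _ ha hb) _; apply: lerD; rewrite ?lerDl ?lerDr.
Qed.

Let fund_st x : fundamental (Torus l1 l2) x <-> (0 <= s x < 1) /\ (0 <= t x < 1).
Proof.
split=> [[a [b [ha hb ->]]]|[hs ht]]; first by rewrite coord_s coord_t.
by exists (s x), (t x); split=> //; exact: coordK.
Qed.

Let measurable_fund : measurable (fundamental (Torus l1 l2) : set (P2 R)).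
Proof.
have ms : measurable_fun [set: P2 R] s.
  by apply: measurable_funM => //; apply: measurable_funB; apply: measurable_funM.
have mt : measurable_fun [set: P2 R] t.
  by apply: measurable_funM => //; apply: measurable_funB; apply: measurable_funM.
rewrite (_ : fundamental _ = s @^-1` `[0, 1[%classic `&` t @^-1` `[0, 1[%classic).
  by apply: measurableI; rewrite -[X in measurable X]setTI; [apply: ms|apply: mt].
by apply/seteqP; split=> x /=; rewrite !in_itv/= => /fund_st.
Qed.

Let tile (y : R * R) : exists2 m, lattice l1 l2 m & fundamental (Torus l1 l2) (y + m).
Proof.
pose a := - Num.floor (s y); pose b := - Num.floor (t y).
exists (l1 *~ a + l2 *~ b); first by exists a, b.
have -> : y + (l1 *~ a + l2 *~ b) = (s y + a%:~R) *: l1 + (t y + b%:~R) *: l2.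
  by rewrite latE {1}[y]coordK addrACA -!scalerDl.
apply/fund_st; rewrite coord_s coord_t /a /b.
rewrite !mulrNz !subr_ge0 !ltrBlDl.
have f1 := floor_itv (s y); have f2 := floor_itv (t y).
by move: f1 f2; rewrite !intrD !mulr1z => /andP[-> ->] /andP[-> ->].
Qed.

Let disjoint x y : fundamental (Torus l1 l2) x -> fundamental (Torus l1 l2) y ->
  lattice l1 l2 (x - y) -> x = y.
Proof.
move=> /fund_st[/andP[s0 s1] /andP[t0 t1]] /fund_st[/andP[s0' s1'] /andP[t0' t1']] [a [b E]].
have intlt1 (c : int) (u v : R) : 0 <= u -> u < 1 -> 0 <= v -> v < 1 -> u - v = c%:~R -> c = 0.
  move=> u0 u1 v0 v1 uv.
  have c1 : (c%:~R : R) < 1 by rewrite -uv; lra.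
  have c2 : (-1 : R) < c%:~R by rewrite -uv; lra.
  move: c1 c2; rewrite -[1 in X in X -> _](mulr1z 1) ltr_int -(mulrN1z 1) ltr_int.
  by move=> h1 h2; exact: int_small_eq0.
have Es : s x - s y = a%:~R.
  by rewrite -(coord_s a%:~R b%:~R) -latE -E /s /=; ring.
have Et : t x - t y = b%:~R.
  by rewrite -(coord_t a%:~R b%:~R) -latE -E /t /=; ring.
have a0 := intlt1 _ _ _ s0 s1 s0' s1' Es.
have b0 := intlt1 _ _ _ t0 t1 t0' t1' Et.
by move/eqP: E; rewrite a0 b0 !mulr0z addr0 subr_eq0 => /eqP.
Qed.

Lemma torus_reduction : exists rd : lattice_reduction (Torus l1 l2), True.
Proof.
pose c := B / `|det|.
have c0 : 0 <= c by rewrite divr_ge0.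
(* The constant [c] bounds lattice coordinates by the sup norm, so a lattice vector with a
   coordinate beyond [m] has sup norm above [8 * B + 8]. *)
pose m := `|Num.ceil (c * (8 * B + 9))|%N.
pose vec (p : 'I_(2 * m).+1 * 'I_(2 * m).+1) : R * R :=
  l1 *~ ((p.1 : nat)%:Z - m%:Z) + l2 *~ ((p.2 : nat)%:Z - m%:Z).
have mE : c * (8 * B + 9) <= m%:R.
  apply: (le_trans (ceil_ge _)); rewrite -[m%:R]/((m%:Z)%:~R) ler_int /m.
  exact: ler_norm.
have lt_m : (m < (2 * m).+1)%N by rewrite ltnS leq_pmull.
have bd_st z : `|s z| <= c * Num.max `|z.1| `|z.2| /\ `|t z| <= c * Num.max `|z.1| `|z.2|.
  have z1 : `|z.1| <= Num.max `|z.1| `|z.2| by rewrite le_max lexx.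
  have z2 : `|z.2| <= Num.max `|z.1| `|z.2| by rewrite le_max lexx orbT.
  move: z1 z2; move: (Num.max _ _) => q z1 z2.
  rewrite /s /t /c !normrM !normfV mulrAC; split; rewrite ler_wpM2r ?invr_ge0//.
    rewrite (le_trans (ler_normB _ _))// !normrM /B !mulrDl addrC.
    rewrite (le_trans (_ : _ <= `|l2.1| * q + `|l2.2| * q))//; last by rewrite lerDr addr_ge0// mulr_ge0// (le_trans _ z1).
    by rewrite mulrC [X in _ + X <= _]mulrC lerD// ler_wpM2l.
  rewrite (le_trans (ler_normB _ _))// !normrM /B !mulrDl.
  rewrite (le_trans (_ : _ <= `|l1.1| * q + `|l1.2| * q))//; last by rewrite lerDl addr_ge0// mulr_ge0// (le_trans _ z1).
  by rewrite lerD// ler_wpM2l.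
unshelve eexists (@LatticeReduction R (Torus l1 l2) B _ vec (Ordinal lt_m, Ordinal lt_m) B0 measurable_fund fund_bd _ _ _ _ _ _ _ _) => //=.
- by rewrite /vec /= !subrr !mulr0z addr0.
- move=> [i j] [i' j']; rewrite /vec /= !latE => E.
  have := congr1 s E; have := congr1 t E; rewrite !coord_s !coord_t => /intr_inj h1 /intr_inj h2.
  by congr pair; apply: val_inj; [case: (addIr _ h2)|case: (addIr _ h1)].
- by move=> p; eexists; eexists.
- move=> x z k Dx [a [b kE]] z1 z2; have [x1 x2] := fund_bd Dx.
  have [/andP[am bm]|nab] := boolP ((absz a <= m)%N && (absz b <= m)%N).
    have [i Ei] := int_shift am; have [j Ej] := int_shift bm.
    by left; exists (i, j); rewrite /vec /= Ei Ej.
  right; set q := Num.max `|k.1| `|k.2|.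
  have qbig : 8 * B + 8 < q.
    rewrite ltNge; apply/negP => qs; move/negP: nab; apply.
    have [h1 h2] := bd_st k; move: h1 h2; rewrite -/q {1}kE latE coord_s {1}kE latE coord_t => h1 h2.
    have cq : c * q <= m%:R.
      by apply: le_trans mE; rewrite ler_wpM2l// (le_trans qs)// lerD2l ler_nat.
    have := le_trans h1 cq; have := le_trans h2 cq.
    rewrite -!intr_norm -[m%:R]/((m%:Z)%:~R) !ler_int.
    by move=> h3 h4; rewrite -!lez_nat !abszE h3 h4.
  (* Without [k] each coordinate difference is at most [2 * B + 1]; adding [k] makes one of them at
     least [6 * B + 7], whose square exceeds [2 * (2 * B + 1) ^+ 2]. *)
  have big (u v : R) : `|u| <= B -> `|v| <= B + 1 -> `|u - v| <= 2 * B + 1.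
    by move=> hu hv; rewrite (le_trans (ler_normB _ _))//; lra.
  have d1 := big _ _ x1 z1; have d2 := big _ _ x2 z2.
  have sq (u : R) : 0 <= u ^+ 2 by exact: sqr_ge0.
  have upper : sqd x z <= 2 * (2 * B + 1) ^+ 2.
    rewrite /sqd mulr_natl mulr2n; apply: lerD; rewrite -real_normK ?num_real//.
      by rewrite lerXn2r ?nnegrE// (le_trans _ d1).
    by rewrite lerXn2r ?nnegrE// (le_trans _ d1).
  have low (u v : R) : `|u| <= 2 * B + 1 -> q = `|v| -> (6 * B + 7) ^+ 2 <= (u - v) ^+ 2.
    move=> hu hq; rewrite -[leRHS]real_normK ?num_real// lerXn2r ?nnegrE//.
      by have := B0; lra.
    have := lerB_dist v u; rewrite distrC -hq; lra.
  have lower : (6 * B + 7) ^+ 2 <= sqd x (z + k).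
    rewrite (_ : sqd x (z + k) = (x.1 - z.1 - k.1) ^+ 2 + (x.2 - z.2 - k.2) ^+ 2);
      last by rewrite /sqd /=; ring.
    have [E|E] : q = `|k.1| \/ q = `|k.2| by rewrite /q /Num.max; case: ifP; [right|left].
      by apply: (le_trans (low _ _ d1 E)); rewrite lerDl.
    by apply: (le_trans (low _ _ d2 E)); rewrite lerDr.
  apply: (le_lt_trans upper); apply: lt_le_trans lower.
  have := B0; move: (B) => u u0; nra.
- by move=> y _; exact: tile.
(* A nonzero lattice vector has an integer coordinate of modulus at least [1], and coordinates are
   at most [c] times the norm; [c + 1] makes the inverse positive at once. *)
- exists (c + 1)^-1; first by rewrite invr_gt0 ltr_wpDl.
  move=> k [a [b kE]] k0; rewrite -[leLHS]mul1r ler_pdivrMr ?ltr_wpDl//.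
  have [h1 h2] := bd_st k; move: h1 h2; set q := Num.max _ _.
  rewrite {1}kE latE coord_s {1}kE latE coord_t => h1 h2.
  have qk : q <= enorm k by rewrite ge_max enorm_ge1 enorm_ge2.
  have q0 : 0 <= q by rewrite le_max normr_ge0.
  apply: (@le_trans _ _ (c * q)); last first.
    by rewrite mulrDr mulr1 mulrC ler_wpDr ?enorm_ge0// ler_wpM2r.
  have [a0|a0] := eqVneq a 0; last first.
    by apply: le_trans h1; rewrite -intr_norm -[1](mulr1z 1) ler_int -gtz0_ge1 normr_gt0.
  have [b0|b0] := eqVneq b 0; last first.
    by apply: le_trans h2; rewrite -intr_norm -[1](mulr1z 1) ler_int -gtz0_ge1 normr_gt0.
  by move: k0; rewrite kE a0 b0 !mulr0z addr0 eqxx.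
Qed.

End TorusReduction.

Lemma reduction_exists (R : realType) (Om : domain R) :
  admissible Om -> exists rd : lattice_reduction Om, True.
Proof. by case: Om => [A|l1 l2] /=; [exact: planar_reduction|exact: torus_reduction]. Qed.

(** * Areas and moments of Voronoi cells *)

(** The last clause keeps the generators away from the boundary of a planar domain, so that a small
    box around each of them lies in its cell; it holds automatically on the torus. *)
Definition well_spaced (R : realType) (Om : domain R) (N : nat) (s : R) (X : config Om N) : Prop :=
  [/\ configs Om N X, forall i j, i != j -> s <= pdist Om (X i) (X j) &
      forall i y, enorm (y - X i) < s -> points Om y].

Section VoronoiMoments.
Variables (R : realType) (Om : domain R) (N : nat).
Variable rd : lattice_reduction Om.
Notation mu2 := (@lebesgue2 R).
Notation K := (red_idx rd).
Notation vec := (@red_vec _ _ rd).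
Notation B := (red_bd rd).
Notation D := (fundamental Om : set (P2 R)).
Implicit Types X Y : config Om N.

Let mD := red_measurable rd.
Let DB := @red_bounded _ _ rd.
Let B0 := red_bd_ge0 rd.

Lemma normalize X : configs Om N X -> exists X' : config Om N,
  equivalent X X' /\ forall i, `|(X' i).1| <= B /\ `|(X' i).2| <= B.
Proof.
move=> cX; have H i : exists m, lat Om m /\ fundamental Om (X i + m).
  by have [m lm Dm] := red_tile rd (cX i); exists m.
exists (fun i => X i + sval (cid (H i))); split=> i.
  rewrite opprD addrA subrr add0r; apply: latN.
  by case: (svalP (cid (H i))).
by apply: DB; case: (svalP (cid (H i))).
Qed.

(** Translates of one generator differ by a nonzero lattice vector, of norm at least [m]; translates
    of different generators are [s] apart. The factor [1/2] passes from the Euclidean norm to a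
    single coordinate. *)
Lemma separated_lift : exists2 m : R, 0 < m & forall s X X', equivalent X X' ->
  well_spaced s X -> separated (Num.min s m / 2) (lift rd X').
Proof.
have [m m0 Hm] := red_min rd; exists m => // s X X' eX [_ sX _] [i k] [j k'] ne.
apply: (@enorm_ge_half _ (X' i + vec k - (X' j + vec k'))).
have [ij|ij] := eqVneq i j.
  subst j; rewrite (_ : _ - _ = vec k - vec k'); last by apply: plane_eq => /=; ring.
  rewrite ge_min Hm ?orbT//; first by apply: latD; [|apply: latN]; exact: red_vec_lat.
  by rewrite subr_eq0; apply: contraNneq ne => /(@red_vec_inj _ _ rd) ->.
rewrite ge_min (le_trans (sX _ _ ij))//.
rewrite (pdist_latr _ (eX j)) (pdist_latl _ (eX i)).
have l : lat Om (vec k' - vec k) by apply: latD; [|apply: latN]; exact: red_vec_lat.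
apply: (le_trans (pdist_le _ _ l)); rewrite le_eqVlt; apply/orP; left; apply/eqP.
by congr enorm; apply: plane_eq => /=; ring.
Qed.

End VoronoiMoments.

(** Integrating [x - x_i] over the cell gives the area times the displacement, provided that the
    division by the area in [centroid] is genuine. All lattice vectors are [0] here, so lifting
    changes nothing. *)
Lemma planar_displacement (R : realType) (A : set (R * R)) (N : nat)
    (rd : lattice_reduction (Planar A)) (X X' : config (Planar A) N) i s :
  equivalent X X' -> normalized rd X' -> 0 < s -> separated s (lift rd X') ->
  cell_area X i != 0 ->
  cell_area X i * (displacement X i).1 = moment1 rd X' i /\
  cell_area X i * (displacement X i).2 = moment2 rd X' i.
Proof.
move=> eX nX' s0 sX V0.
have EX j : X' j = X j by have /eqP := eX j; rewrite subr_eq0 => /eqP.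
have v0 k : red_vec k = 0 :> R * R := @red_vec_lat _ _ rd k.
have mc := cell_measurable i eX nX'.
have cE : A `&` cell X i = cell X i by apply: setIidr => x [].
have fc : (@lebesgue2 R (A `&` cell X i) < +oo)%E.
  apply: le_lt_trans (lebesgue2_bounded_lty (red_measurable rd) (@red_bounded _ _ rd) (red_bd_ge0 rd)).
  by apply: le_measure; rewrite ?inE//; exact: red_measurable rd.
have key (f : P2 R -> R) (c : R) : measurable_fun setT f ->
    (forall x : P2 R, A x -> `|f x| <= red_bd rd) ->
    cell_area X i * ((cell_area X i)^-1 * \int[@lebesgue2 R]_(x in cell X i) f x - c) =
    \sum_k \int[@lebesgue2 R]_(x in tcell A (lift rd X') (i, k)) (f x - c).
  move=> mf fb.
  rewrite -(@cell_Rintegral _ _ _ rd X X' i s _ (red_bd rd + `|c|) eX nX' s0 sX); first last.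
  - by move=> x Dx; rewrite (le_trans (ler_normB _ _))// lerD2r fb.
  - exact: measurable_funB.
  rewrite RintegralB//.
  - rewrite Rintegral_cst// mulrBr mulrA divff// mul1r cE; congr (_ - _).
    by rewrite mulrC /cell_area /area /= setIC cE.
  - apply: (@intble_bounded _ _ R _ _ mc fc _ (red_bd rd)); first exact: measurable_funTS.
    by move=> x [Ax _]; exact: fb.
  - exact: (intble_cst mc fc).
rewrite /moment1 /moment2 /displacement /centroid /vintegral /=; split.
  rewrite key//; last by move=> x /(@red_bounded _ _ rd)[].
  by apply: eq_bigr => k _; apply: eq_Rintegral => x _; rewrite /lift /= EX v0 addr0.
rewrite key//; last by move=> x /(@red_bounded _ _ rd)[].
by apply: eq_bigr => k _; apply: eq_Rintegral => x _; rewrite /lift /= EX v0 addr0.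
Qed.

Lemma torus_moment (R : realType) (l1 l2 : R * R) (N : nat)
    (rd : lattice_reduction (Torus l1 l2)) (X X' : config (Torus l1 l2) N) i s
    (g : P2 R -> R) (M : R -> R) :
  equivalent X X' -> normalized rd X' -> 0 < s -> separated s (lift rd X') ->
  measurable_fun setT g ->
  (forall b p, `|p.1| <= b -> `|p.2| <= b -> `|g p| <= M b) ->
  [/\ measurable (lattice_cell l1 l2 X i : set (P2 R)),
      (@lebesgue2 R (lattice_cell l1 l2 X i) < +oo)%E &
      \int[@lebesgue2 R]_(y in lattice_cell l1 l2 X i) g (y - X i) =
      \sum_k \int[@lebesgue2 R]_(x in tcell (fundamental (Torus l1 l2)) (lift rd X') (i, k))
        g (x - lift rd X' (i, k))].
Proof.
move=> eX nX' s0 sX mg gM.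
by apply: (Rintegral_lattice_cell eX nX' s0 sX _ _ mg gM) => // y; exact: red_tile.
Qed.

Lemma torus_displacement (R : realType) (l1 l2 : R * R) (N : nat)
    (rd : lattice_reduction (Torus l1 l2)) (X X' : config (Torus l1 l2) N) i s :
  equivalent X X' -> normalized rd X' -> 0 < s -> separated s (lift rd X') ->
  cell_area X i != 0 ->
  cell_area X i * (displacement X i).1 = moment1 rd X' i /\
  cell_area X i * (displacement X i).2 = moment2 rd X' i.
Proof.
move=> eX nX' s0 sX V0; rewrite /displacement /vintegral /= /GRing.scale/=.
rewrite !mulrA divff// !mul1r; split.
  by case: (@torus_moment R l1 l2 N rd X X' i s fst id).
by case: (@torus_moment R l1 l2 N rd X X' i s snd id).
Qed.

Lemma displacement_lift (R : realType) (Om : domain R) (N : nat)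
    (rd : lattice_reduction Om) (X X' : config Om N) i s :
  equivalent X X' -> normalized rd X' -> 0 < s -> separated s (lift rd X') ->
  cell_area X i != 0 ->
  cell_area X i * (displacement X i).1 = moment1 rd X' i /\
  cell_area X i * (displacement X i).2 = moment2 rd X' i.
Proof.
by case: Om rd X X' => [A|l1 l2] rd X X'; [exact: planar_displacement|exact: torus_displacement].
Qed.

Lemma box_area (R : realType) (z : R * R) (q : R) : 0 <= q ->
  @lebesgue2 R (`[z.1 - q, z.1 + q]%classic `*` `[z.2 - q, z.2 + q]%classic) = ((2 * q) ^+ 2)%:E.
Proof.
move=> q0; rewrite /lebesgue2 product_measure1E; [|exact: measurable_itv|exact: measurable_itv].
have itv_len (u : R) : lebesgue_measure `[u - q, u + q]%classic = (2 * q)%:E.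
  rewrite lebesgue_measure_itv/= lte_fin; case: ltP => [_|h].
    by rewrite -EFinB; congr EFin; ring.
  by rewrite (_ : q = 0) ?mulr0//; apply/eqP; rewrite eq_le q0 andbT; lra.
by rewrite expr2 EFinM; congr (_ * _)%E; exact: itv_len.
Qed.

Lemma fine_measure_ge (R : realType) (A C : set (P2 R)) (c : R) : measurable A -> measurable C ->
  A `<=` C -> (@lebesgue2 R C < +oo)%E -> @lebesgue2 R A = c%:E -> c <= fine (@lebesgue2 R C).
Proof.
move=> mA mC AC fC Ac; rewrite -lee_fin -Ac fineK ?ge0_fin_numE//.
by apply: le_measure; rewrite ?inE.
Qed.

Definition box (R : realType) (z : R * R) (q : R) : set (P2 R) :=
  `[z.1 - q, z.1 + q]%classic `*` `[z.2 - q, z.2 + q]%classic.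

Lemma box_enorm (R : realType) (z y : R * R) (q : R) : box z q y -> enorm (y - z) <= 2 * q.
Proof.
move=> [/=]; rewrite !in_itv/= -!ler_distl => h1 h2.
by apply: (le_trans (enorm_le_add _)); rewrite mulr_natl mulr2n lerD.
Qed.

Lemma measurable_box (R : realType) (z : R * R) (q : R) : measurable (box z q).
Proof. by apply: measurableX; exact: measurable_itv. Qed.

Section CellAreaLower.
Variables (R : realType) (N : nat) (m s : R).
Hypotheses (m0 : 0 < m) (s0 : 0 < s).

(** The box of half side [q] stays within [2 * q] of its generator, while all competing translates
    are at least [8 * q] from that generator. The box thus lies in the cell, and its area is the
    square of [2 * q = Num.min s m / 4]. *)
Let q := Num.min s m / 8.

Let q0 : 0 < q. Proof. by rewrite divr_gt0// lt_min s0. Qed.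

Let sE : Num.min s m = 8 * q. Proof. by rewrite /q mulrC divfK. Qed.

Let q8s : 8 * q <= s. Proof. by rewrite -sE ge_min lexx. Qed.

Let q8m : 8 * q <= m. Proof. by rewrite -sE ge_min lexx orbT. Qed.

Lemma planar_cell_area_ge (A : set (R * R)) (rd : lattice_reduction (Planar A))
    (X X' : config (Planar A) N) i :
  equivalent X X' -> normalized rd X' -> well_spaced s X ->
  (Num.min s m / 4) ^+ 2 <= cell_area X i.
Proof.
move=> eX nX' [_ sX bX]; rewrite (_ : Num.min s m / 4 = 2 * q); last by rewrite /q; field.
have mc := cell_measurable i eX nX'.
rewrite /cell_area /area setIC; apply: (@fine_measure_ge _ (box (X i) q)) => //.
- exact: measurable_box.
- move=> y /box_enorm yq; have yA : A y by apply: bX; apply: le_lt_trans yq _; have := q0; have := q8s; lra.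
  split=> //; split=> // j ji; have := sX j i ji; rewrite /= => h.
  have := enormD (X j - y) (y - X i); rewrite addrA subrK -[in X in _ <= X + _]enormN opprB => h'.
  have := q0; have := q8s; lra.
- apply: le_lt_trans (lebesgue2_bounded_lty (red_measurable rd) (@red_bounded _ _ rd) (red_bd_ge0 rd)).
  by apply: le_measure; rewrite ?inE//; exact: red_measurable rd.
- by rewrite /box box_area// ltW.
Qed.

Lemma torus_cell_area_ge (l1 l2 : R * R) (rd : lattice_reduction (Torus l1 l2))
    (X X' : config (Torus l1 l2) N) i s' :
  (forall k, lattice l1 l2 k -> k != 0 -> m <= enorm k) ->
  equivalent X X' -> normalized rd X' -> well_spaced s X ->
  0 < s' -> separated s' (lift rd X') ->
  (Num.min s m / 4) ^+ 2 <= cell_area X i.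
Proof.
move=> Hm eX nX' [_ sX _] s'0 s'X; rewrite (_ : Num.min s m / 4 = 2 * q); last by rewrite /q; field.
rewrite (cell_area_lift _ eX nX' s'0 s'X) /moment_area.
have g1 (b : R) (p : P2 R) : `|p.1| <= b -> `|p.2| <= b -> `|1 : R| <= 1.
  by rewrite normr1.
have [mP fP <-] := @torus_moment R l1 l2 N rd X X' i s' (fun=> 1) (fun=> 1)
  eX nX' s'0 s'X (measurable_cst _) g1.
rewrite Rintegral_cst// mul1r; apply: (@fine_measure_ge _ (box (X i) q)) => //.
- exact: measurable_box.
- move=> y /box_enorm yq j k lk.
  have [E|ne] := boolP ((j == i) && (k == 0)).
    by case/andP: E => /eqP -> /eqP ->; rewrite subr0.
  suff h : 8 * q <= enorm (X i - X j - k).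
    have := enormD (X i - y) (y - X j - k); rewrite !addrA subrK -[in X in _ <= X + _]enormN opprB => h'.
    have := q0; lra.
  have [ji|ji] := eqVneq j i.
    by move: ne; rewrite ji eqxx subrr sub0r enormN /= => k0; apply: (le_trans q8m); exact: Hm.
  by apply: (le_trans q8s); apply: (le_trans (sX i j _)); [rewrite eq_sym|exact: pdist_le].
- by rewrite /box box_area// ltW.
Qed.

End CellAreaLower.

(** A lower bound uniform in the configuration: it makes the division by the area in the
    displacement harmless. *)
Lemma cell_area_ge (R : realType) (Om : domain R) (N : nat) (rd : lattice_reduction Om) (s : R) :
  0 < s -> exists2 c : R, 0 < c & forall (X : config Om N) i, well_spaced s X -> c <= cell_area X i.
Proof.
move=> s0; have [m m0 Hm] := red_min rd; have [m' m'0 Hm'] := @separated_lift R Om N rd.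
exists ((Num.min s m / 4) ^+ 2); first by rewrite exprn_gt0// divr_gt0// lt_min s0.
move=> X i wX; have [X' [eX nX]] := normalize rd (let: And3 c _ _ := wX in c).
have nX' : normalized rd X' by move=> j; have [h1 h2] := nX j; rewrite !(le_trans h1, le_trans h2)// lerDl.
have sX := Hm' _ _ _ eX wX.
have s'0 : 0 < Num.min s m' / 2 by rewrite divr_gt0// lt_min s0.
case: Om rd Hm Hm' X X' i wX eX nX nX' sX => [A|l1 l2] rd Hm Hm' X X' i wX eX nX nX' sX.
  exact: (planar_cell_area_ge m0 s0 i eX nX').
exact: (torus_cell_area_ge m0 s0 i Hm eX nX' wX s'0).
Qed.

(** Compares representatives in the plane, not points of the torus: this is the norm in which the
    Picard iteration is run on lifted curves. *)
Definition sup_close (R : realType) (N : nat) (X Y : 'I_N -> R * R) (e : R) : Prop :=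
  forall i, `|(X i).1 - (Y i).1| <= e /\ `|(X i).2 - (Y i).2| <= e.

Lemma sup_close_sym (R : realType) (N : nat) (X Y : 'I_N -> R * R) (e : R) :
  sup_close X Y e -> sup_close Y X e.
Proof. by move=> h i; have := h i; rewrite (distrC (X i).1) (distrC (X i).2). Qed.

(** * Lipschitz dependence of areas, displacements and energy on the generators *)

Section VoronoiRegularity.
Variables (R : realType) (Om : domain R) (N : nat).
Variable rd : lattice_reduction Om.
Hypothesis N0 : (0 < N)%N.
Notation mu2 := (@lebesgue2 R).
Notation K := (red_idx rd).
Notation vec := (@red_vec _ _ rd).
Notation B := (red_bd rd).
Notation D := (fundamental Om : set (P2 R)).
Implicit Types X Y : config Om N.

Let mD := red_measurable rd.
Let DB := @red_bounded _ _ rd.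
Let B0 := red_bd_ge0 rd.

Let B' := B + 1 + \sum_k (`|(vec k).1| + `|(vec k).2|).

Let B'0 : 0 <= B'.
Proof. by rewrite addr_ge0 ?addr_ge0// sumr_ge0// => k _; rewrite addr_ge0. Qed.

Let BB'0 : 0 <= B + B'. Proof. exact: addr_ge0. Qed.

Let fine0 : 0 <= fine (mu2 D). Proof. exact: fine_ge0. Qed.

Let lift_bd X : normalized rd X -> forall p, `|(lift rd X p).1| <= B' /\ `|(lift rd X p).2| <= B'.
Proof.
move=> nX [i k]; have [h1 h2] := nX i.
have hk : `|(vec k).1| + `|(vec k).2| <= \sum_k (`|(vec k).1| + `|(vec k).2|).
  by rewrite [leRHS](bigD1 k)//= lerDl sumr_ge0// => j _; rewrite addr_ge0.
split; rewrite /lift /= (le_trans (ler_normD _ _))//; apply: lerD => //; apply: le_trans hk.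
  by rewrite lerDl.
by rewrite lerDr.
Qed.

Let lift_close X Y e : sup_close X Y e -> forall p,
  `|(lift rd X p).1 - (lift rd Y p).1| <= e /\ `|(lift rd X p).2 - (lift rd Y p).2| <= e.
Proof.
move=> XY [i k]; have [h1 h2] := XY i; rewrite /lift /=; split.
  by rewrite opprD addrACA subrr addr0.
by rewrite opprD addrACA subrr addr0.
Qed.

(** Equals the sum of [V_i (|c_i - y_i|^2 - |c_i - x_i|^2)], the change of the energy when the
    generators move but the cells of [X] are kept. *)
Definition gradient_energy_bound X Y : R :=
  \sum_i cell_area X i * (sqd (Y i) (X i) -
    2 * (((Y i).1 - (X i).1) * (displacement X i).1 +
         ((Y i).2 - (X i).2) * (displacement X i).2)).

(** A single constant and an arbitrary set [W], so that the descent estimate needs no further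
    knowledge of Voronoi cells. The restriction [e <= 1] reflects the slack in [normalized]. *)
Definition regular_on (W : set (config Om N)) (C : R) : Prop := forall X, W X ->
  (forall i, [/\ 0 < cell_area X i, cell_area X i <= C, `|(displacement X i).1| <= C &
     `|(displacement X i).2| <= C]) /\
  forall Y e, W Y -> sup_close X Y e -> e <= 1 ->
    (forall i, [/\ `|cell_area X i - cell_area Y i| <= C * e,
       `|(displacement X i).1 - (displacement Y i).1| <= C * e &
       `|(displacement X i).2 - (displacement Y i).2| <= C * e]) /\
    energy Y <= energy X + gradient_energy_bound X Y.

(* Representatives of [X] and [Y] moved by the same lattice vectors. *)
Let joint_normalize X Y e : configs Om N X -> sup_close X Y e -> e <= 1 ->
  exists X' Y' : config Om N, [/\ equivalent X X', equivalent Y Y',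
    normalized rd X', normalized rd Y' & sup_close X' Y' e /\ forall i, Y' i - X' i = Y i - X i].
Proof.
move=> cX XY e1; have [X' [eX nX]] := normalize rd cX.
exists X', (fun i => Y i - (X i - X' i)).
have dE i : Y i - (X i - X' i) - X' i = Y i - X i.
  by apply: plane_eq => /=; ring.
have XY' : sup_close X' (fun i => Y i - (X i - X' i)) e.
  move=> i; have [h1 h2] := XY i; have := dE i => E; split.
    by rewrite distrC -[_ - _]/((Y i - (X i - X' i) - X' i).1) E distrC.
  by rewrite distrC -[_ - _]/((Y i - (X i - X' i) - X' i).2) E distrC.
split => //.
- by move=> i; rewrite opprB addrC subrK; exact: eX.
- by move=> i; have [h1 h2] := nX i; split; [apply: (le_trans h1)|apply: (le_trans h2)]; rewrite lerDl.
- move=> i; have [h1 h2] := nX i; have [h3 h4] := XY' i; split.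
    rewrite -[X in `|X|](subrK (X' i).1) (le_trans (ler_normD _ _))// addrC lerD//.
    by rewrite distrC (le_trans h3).
  rewrite -[X in `|X|](subrK (X' i).2) (le_trans (ler_normD _ _))// addrC lerD//.
  by rewrite distrC (le_trans h4).
Qed.

(** The nearest generator of [X] is a competitor for [Y], so the integrand grows by at most the
    bound of [sqd_lip]; no separation of the generators is involved. *)
Lemma energy_lip : exists2 C : R, 0 <= C & forall X Y e, configs Om N X -> configs Om N Y ->
  sup_close X Y e -> e <= 1 -> energy Y <= energy X + C * e.
Proof.
exists (4 * (B + B') * fine (mu2 D)).
  by apply: mulr_ge0 => //; exact: mulr_ge0.
move=> X Y e cX cY XY e1.
have [X' [Y' [eX eY nX nY [XY' _]]]] := joint_normalize cX XY e1.
rewrite (energy_lift N0 eX nX) (energy_lift N0 eY nY) /tenergy.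
pose p0 : 'I_N * K := (Ordinal N0, red_idx0 rd).
have iX := intble_tenergy mD DB B0 (lift rd X') p0.
have iY := intble_tenergy mD DB B0 (lift rd Y') p0.
have fD := lebesgue2_bounded_lty mD DB B0.
rewrite mulrAC -Rintegral_cst// -RintegralD//; last exact: (intble_cst mD fD).
apply: le_Rintegral => //; first by apply: intbleD => //; exact: (intble_cst mD fD).
move=> x Dx.
have [p ->] := inf_finType_attained p0 (fun p => sqd x (lift rd X' p)).
apply: (le_trans (inf_finType_le (fun p => sqd x (lift rd Y' p)) p)).
rewrite -lerBlDl; apply: (le_trans (ler_norm _)); rewrite distrC.
have [a1 a2] := lift_bd nX p; have [b1 b2] := lift_bd nY p; have [c1 c2] := lift_close XY' p.
exact: (sqd_lip DB Dx a1 a2 b1 b2 c1 c2).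
Qed.

Lemma energy_bounded : exists2 C : R, 0 <= C & forall X, configs Om N X -> 0 <= energy X <= C.
Proof.
exists (((B + B') ^+ 2 + (B + B') ^+ 2) * fine (mu2 D)).
  by apply: mulr_ge0 => //; rewrite addr_ge0// sqr_ge0.
move=> X cX; have [X' [eX nX]] := normalize rd cX.
have nX' : normalized rd X'.
  by move=> i; have [h1 h2] := nX i; split; [apply: (le_trans h1)|apply: (le_trans h2)]; rewrite lerDl.
rewrite (energy_lift N0 eX nX') /tenergy.
pose p0 : 'I_N * K := (Ordinal N0, red_idx0 rd).
have iX := intble_tenergy mD DB B0 (lift rd X') p0.
have fD := lebesgue2_bounded_lty mD DB B0.
apply/andP; split.
  apply: Rintegral_ge0 => x Dx.
  by have [p ->] := inf_finType_attained p0 (fun p => sqd x (lift rd X' p)); exact: sqd_ge0.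
rewrite -Rintegral_cst//; apply: le_Rintegral => //; first exact: (intble_cst mD fD).
move=> x Dx; apply: (le_trans (inf_finType_le (fun p => sqd x (lift rd X' p)) p0)).
have [a1 a2] := lift_bd nX' p0; have [x1 x2] := DB Dx.
have sq (u v : R) : `|u| <= B -> `|v| <= B' -> (u - v) ^+ 2 <= (B + B') ^+ 2.
  move=> hu hv; rewrite -real_normK ?num_real// lerXn2r ?nnegrE//.
  by rewrite (le_trans (ler_normB _ _))// lerD.
by apply: lerD; exact: sq.
Qed.

Let bigK (C : R) (f : K -> R) : (forall k, `|f k| <= C) -> `|\sum_k f k| <= #|K|%:R * C.
Proof.
move=> H; apply: (le_trans (ler_norm_sum _ _ _)).
by rewrite -sum1_card natr_sum mulr_suml; apply: ler_sum => k _; rewrite mul1r.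
Qed.

Let coord_bd (X : config Om N) : normalized rd X -> forall p x, D x ->
  `|x.1 - (lift rd X p).1| <= B + B' /\ `|x.2 - (lift rd X p).2| <= B + B'.
Proof.
move=> nX p x Dx; have [a1 a2] := lift_bd nX p; have [x1 x2] := DB Dx.
by split; rewrite (le_trans (ler_normB _ _))// lerD.
Qed.

Let moments_bounded : exists2 C : R, 0 <= C & forall X i, normalized rd X ->
  [/\ moment_area rd X i <= C, `|moment1 rd X i| <= C & `|moment2 rd X i| <= C].
Proof.
have M0 : 0 <= 1 + (B + B') by exact: addr_ge0.
exists (#|K|%:R * ((1 + (B + B')) * fine (mu2 D))).
  by apply: mulr_ge0 => //; exact: mulr_ge0.
move=> X i nX; split; [apply: (le_trans (ler_norm _))| |]; apply: bigK => k.
- apply: (le_normr_tcell mD DB B0) => //.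
  by move=> x _; rewrite normr1 lerDl.
- apply: (le_normr_tcell mD DB B0) => //; first exact: measurable_funB.
  by move=> x Dx; have [h _] := coord_bd nX (i, k) Dx; apply: (le_trans h); rewrite lerDr.
- apply: (le_normr_tcell mD DB B0) => //; first exact: measurable_funB.
  by move=> x Dx; have [_ h] := coord_bd nX (i, k) Dx; apply: (le_trans h); rewrite lerDr.
Qed.

Let moments_lip s : 0 < s -> exists2 C : R, 0 <= C & forall X Y e i,
  normalized rd X -> normalized rd Y -> separated s (lift rd X) -> sup_close X Y e ->
  [/\ `|moment_area rd X i - moment_area rd Y i| <= C * e,
      `|moment1 rd X i - moment1 rd Y i| <= C * e &
      `|moment2 rd X i - moment2 rd Y i| <= C * e].
Proof.
(* One bound for the integrand [1] of the area and for the coordinate differences in the first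
   moments. *)
move=> s0; pose M := 1 + (B + B').
have M0 : 0 <= M by exact: addr_ge0.
pose C := fine (mu2 D) + 2 * M * (#|{: 'I_N * K}|%:R * (2 * B * (2 * (8 * (B + B')) / s))).
exists (#|K|%:R * C).
  apply: mulr_ge0 => //; apply: addr_ge0 => //; apply: mulr_ge0; first exact: mulr_ge0.
  apply: mulr_ge0 => //; apply: mulr_ge0; first exact: mulr_ge0.
  by apply: divr_ge0; [apply: mulr_ge0 => //; exact: mulr_ge0|exact: ltW].
move=> X Y e i nX nY sX XY.
have e0 : 0 <= e by have [h _] := XY (Ordinal N0); exact: le_trans h.
have bX := lift_bd nX; have bY := lift_bd nY; have cXY := lift_close XY.
have L k (f f' : P2 R -> R) := @tcell_lip R _ D B mD DB B0 B' s e M (lift rd X) (lift rd Y) (i, k)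
  f f' B'0 s0 e0 M0 sX bX bY cXY.
have big (f : K -> R) : (forall k, `|f k| <= C * e) -> `|\sum_k f k| <= #|K|%:R * C * e.
  by move=> h; rewrite -mulrA; exact: bigK.
have lM (u : R) : u <= B + B' -> u <= M by move=> h; apply: (le_trans h); rewrite lerDr.
have lif (a b c : R) : a - b - (a - c) = c - b by ring.
split; rewrite -sumrB; apply: big => k; apply: L.
- exact: measurable_cst.
- exact: measurable_cst.
- by move=> x _; rewrite normr1 lerDl.
- by move=> x _; rewrite normr1 lerDl.
- by move=> x _; rewrite subrr normr0.
- exact: measurable_funB.
- exact: measurable_funB.
- by move=> x Dx; have [h _] := coord_bd nX (i, k) Dx; exact: lM.
- by move=> x Dx; have [h _] := coord_bd nY (i, k) Dx; exact: lM.
- by move=> x Dx; rewrite lif distrC; case: (cXY (i, k)).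
- exact: measurable_funB.
- exact: measurable_funB.
- by move=> x Dx; have [_ h] := coord_bd nX (i, k) Dx; exact: lM.
- by move=> x Dx; have [_ h] := coord_bd nY (i, k) Dx; exact: lM.
- by move=> x Dx; rewrite lif distrC; case: (cXY (i, k)).
Qed.

(** The displacement is moment over area. The identity [(d - d') * v = (w - w') - d' * (v - v')]
    divides by [v] alone, which is at least [c]. *)
Let quotient_lip (c C v v' w w' d d' e : R) : 0 < c -> c <= v -> v * d = w -> v' * d' = w' ->
  `|v - v'| <= C * e -> `|w - w'| <= C * e -> `|d'| <= C ->
  `|d - d'| <= (C + C * C) / c * e.
Proof.
move=> c0 cv <- <- hv hw hd; have v0 : 0 < v by exact: lt_le_trans cv.
rewrite mulrAC ler_pdivlMr// (le_trans (_ : _ <= `|d - d'| * v))//; first by rewrite ler_wpM2l.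
rewrite -[X in _ * X <= _](gtr0_norm v0) -normrM.
rewrite (_ : (d - d') * v = (v * d - v' * d') - d' * (v - v')); last by ring.
apply: (le_trans (ler_normB _ _)); rewrite mulrDl; apply: lerD => //.
by rewrite normrM -mulrA ler_pM.
Qed.

Let sup_closexx X : sup_close X X 0.
Proof. by move=> i; rewrite !subrr normr0. Qed.

Lemma voronoi_regular s : 0 < s -> exists2 C : R, 0 <= C & regular_on (well_spaced s) C.
Proof.
move=> s0; have [m m0 Hm] := @separated_lift R Om N rd.
have [c c0 Hc] := @cell_area_ge R Om N rd s s0.
have [Cb Cb0 Hb] := moments_bounded.
pose t := Num.min s m / 2; have t0 : 0 < t by rewrite divr_gt0// lt_min s0.
have [Cl Cl0 Hl] := moments_lip t0.
(* The summands dominate the moments, the displacements (moments over an area of at least [c]) and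
   the Lipschitz constants of the moments; the extra term in [C] comes from [quotient_lip]. *)
pose C1 := Cb + Cb / c + Cl.
have C10 : 0 <= C1 by rewrite !addr_ge0// divr_ge0// ltW.
pose C := C1 + (C1 + C1 * C1) / c.
have CC : 0 <= (C1 + C1 * C1) / c.
  by apply: divr_ge0; [apply: addr_ge0 => //; exact: mulr_ge0|exact: ltW].
have C0 : 0 <= C by rewrite addr_ge0.
have Cb1 : Cb <= C1 by rewrite /C1 -addrA lerDl addr_ge0// divr_ge0// ltW.
have Cl1 : Cl <= C1 by rewrite /C1 lerDr addr_ge0// divr_ge0// ltW.
have Cc1 : Cb / c <= C1 by rewrite /C1 addrAC lerDr addr_ge0.
have C1C : C1 <= C by rewrite lerDl.
have basic X X' i : well_spaced s X -> equivalent X X' -> normalized rd X' ->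
    [/\ separated t (lift rd X'), cell_area X i = moment_area rd X' i, c <= cell_area X i,
      cell_area X i * (displacement X i).1 = moment1 rd X' i &
      cell_area X i * (displacement X i).2 = moment2 rd X' i].
  move=> wX eX nX; have sX := Hm _ _ _ eX wX; have cX := Hc X i wX.
  have V0 : cell_area X i != 0 by rewrite gt_eqF// (lt_le_trans c0).
  have [d1 d2] := @displacement_lift R Om N rd X X' i t eX nX t0 sX V0.
  by split=> //; exact: cell_area_lift eX nX t0 sX.
have dbound X i : well_spaced s X ->
    `|(displacement X i).1| <= C1 /\ `|(displacement X i).2| <= C1.
  move=> wX; have [cX _ _] := wX.
  have [X' [_ [eX _ nX _ _]]] := @joint_normalize X X 0 cX (sup_closexx X) ler01.
  have [_ _ cV d1 d2] := basic X X' i wX eX nX; have [_ m1 m2] := Hb X' i nX.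
  have V0 : 0 < cell_area X i by exact: lt_le_trans cV.
  have key d : `|cell_area X i * d| <= Cb -> `|d| <= C1.
    rewrite normrM (gtr0_norm V0) => h; apply: le_trans Cc1; rewrite ler_pdivlMr//.
    by apply: le_trans h; rewrite mulrC ler_wpM2r.
  by split; apply: key; rewrite ?d1 ?d2.
exists C => // X wX; have [cX _ _] := wX; split.
  move=> i; have [h1 h2] := dbound X i wX.
  have [X' [_ [eX _ nX _ _]]] := @joint_normalize X X 0 cX (sup_closexx X) ler01.
  have [_ EV cV _ _] := basic X X' i wX eX nX; have [mV _ _] := Hb X' i nX.
  split; rewrite ?(le_trans _ C1C)//; first exact: lt_le_trans cV.
  by rewrite EV (le_trans mV).
move=> Y e wY XY e1; have [cY _ _] := wY.
have [X' [Y' [eX eY nX nY [XY' dXY]]]] := joint_normalize cX XY e1.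
have e0 : 0 <= e by have [h _] := XY (Ordinal N0); exact: le_trans h.
split.
  move=> i; have [sX EV cV d1 d2] := basic X X' i wX eX nX.
  have [_ EV' _ d1' d2'] := basic Y Y' i wY eY nY.
  have [h1 h2] := dbound Y i wY; have [l0 l1 l2] := Hl X' Y' e i nX nY sX XY'.
  have leC (z : R) : z <= Cl * e -> z <= C1 * e by move=> h; apply: (le_trans h); rewrite ler_wpM2r.
  have leC' (z : R) : z <= (C1 + C1 * C1) / c * e -> z <= C * e.
    by move=> h; apply: (le_trans h); rewrite ler_wpM2r// lerDr.
  split.
  - by rewrite EV EV'; apply: (le_trans (leC _ l0)); rewrite ler_wpM2r.
  - apply: leC'; apply: (quotient_lip c0 cV d1 d1') => //; last by apply: leC.
    by rewrite EV EV'; exact: leC.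
  - apply: leC'; apply: (quotient_lip c0 cV d2 d2') => //; last by apply: leC.
    by rewrite EV EV'; exact: leC.
rewrite (energy_lift N0 eX nX) (energy_lift N0 eY nY).
have [sX _ _ _ _] := basic X X' (Ordinal N0) wX eX nX.
apply: (le_trans (tenergy_le mD DB B0 (lift rd Y') t0 sX)); rewrite lerD2l.
(* From here on an identity: all translates of a generator move by the same vector, so the pieces of
   each cell recombine into its area and moments. *)
rewrite /gradient_energy_bound le_eqVlt; apply/orP; left; apply/eqP.
rewrite [RHS](eq_bigr (fun i => \sum_k \int[mu2]_(x in tcell D (lift rd X') (i, k))
  (sqd x (lift rd Y' (i, k)) - sqd x (lift rd X' (i, k))))).
  by rewrite pair_bigA; apply: eq_bigr => -[i k].
move=> i _; have [_ EV _ d1 d2] := basic X X' i wX eX nX.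
under [RHS]eq_bigr do rewrite (tcell_sqdB mD DB B0).
have eqn (V S a b u v : R) : V * (S - 2 * (a * u + b * v)) = S * V - 2 * (a * (V * u) + b * (V * v)).
  by ring.
rewrite eqn d1 d2 EV.
rewrite sumrB -mulr_sumr big_split/= /moment_area /moment1 /moment2.
have dE j k : (lift rd Y' (j, k)).1 - (lift rd X' (j, k)).1 = (Y j).1 - (X j).1 /\
   (lift rd Y' (j, k)).2 - (lift rd X' (j, k)).2 = (Y j).2 - (X j).2.
  rewrite -[(Y j).1 - (X j).1]/((Y j - X j).1) -[(Y j).2 - (X j).2]/((Y j - X j).2) -dXY.
  by rewrite /lift /=; split; ring.
congr (_ - _ * _).
  rewrite mulr_sumr; apply: eq_bigr => k _; congr (_ * _).
  by have [h1 h2] := dE i k; rewrite /sqd h1 h2.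
by congr (_ + _); rewrite mulr_sumr; apply: eq_bigr => k _; have [h1 h2] := dE i k; rewrite ?h1 ?h2.
Qed.

End VoronoiRegularity.

(** * The tube around the minimizers *)

Section ConfigTopology.
Variables (R : realType) (Om : domain R) (N : nat).
Implicit Types X Y : config Om N.

Lemma config_nbhsP X (A : set (config Om N)) :
  nbhs X A <-> exists2 e : R, 0 < e & forall Y, cdist X Y < e -> A Y.
Proof.
split=> [/nbhs_ballP[e /= e0 H]|[e e0 H]]; first by exists e.
by apply/nbhs_ballP; exists e.
Qed.

Lemma config_closureP (A : set (config Om N)) X :
  closure A X <-> forall e : R, 0 < e -> exists2 Y, A Y & cdist X Y < e.
Proof.
split=> [cA e e0|H B /config_nbhsP[e e0 He]].
  have [|Y [AY XY]] := cA [set Y | cdist X Y < e]; last by exists Y.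
  by apply/config_nbhsP; exists e.
by have [Y AY XY] := H e e0; exists Y; split=> //; exact: He.
Qed.

Lemma pdist_le_cdist X Y i : pdist Om (X i) (Y i) <= cdist X Y.
Proof.
rewrite /cdist -[leLHS]ger0_norm ?pdist_ge0// -sqrtr_sqr ler_wsqrtr//.
by rewrite (bigD1 i)//= lerDl sumr_ge0// => j _; exact: sqr_ge0.
Qed.

Lemma cdist_le_sum X Y : cdist X Y <= \sum_i pdist Om (X i) (Y i).
Proof.
have s0 (s : seq 'I_N) : 0 <= \sum_(i <- s) pdist Om (X i) (Y i).
  by apply: sumr_ge0 => i _; exact: pdist_ge0.
rewrite /cdist -[leRHS]ger0_norm ?s0// -sqrtr_sqr ler_wsqrtr//.
suff H (s : seq 'I_N) : \sum_(i <- s) pdist Om (X i) (Y i) ^+ 2 <=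
    (\sum_(i <- s) pdist Om (X i) (Y i)) ^+ 2 by exact: H.
elim: s => [|i s IH]; first by rewrite !big_nil expr0n.
rewrite !big_cons sqrrD -addrA lerD2l (le_trans IH)// lerDr mulrn_wge0// mulr_ge0//.
exact: pdist_ge0.
Qed.

Lemma cdist_ge0 X Y : 0 <= cdist X Y. Proof. exact: sqrtr_ge0. Qed.

Lemma cdist_sup_close X Y e : 0 <= e -> sup_close X Y e -> cdist X Y <= N%:R * (2 * e).
Proof.
move=> e0 XY; apply: (le_trans (cdist_le_sum X Y)).
rewrite -[N in N%:R]card_ord -sum1_card natr_sum mulr_suml; apply: ler_sum => i _.
rewrite mul1r (le_trans (pdist_le_enorm _ _ _))// (le_trans (enorm_le_add _))//.
by have [h1 h2] := XY i; rewrite mulr_natl mulr2n; apply: lerD.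
Qed.

Lemma cdist_equivalent X Y Y' : equivalent Y Y' -> cdist X Y = cdist X Y'.
Proof.
by move=> eY; congr Num.sqrt; apply: eq_bigr => i _; rewrite (pdist_latr _ (eY i)).
Qed.

Lemma equivalent_configs X X' : configs Om N X -> equivalent X X' -> configs Om N X'.
Proof.
move=> + + i => /(_ i) + /(_ i); case: (Om) X X' => [A|l1 l2] //= X X' h /eqP.
by rewrite subr_eq0 => /eqP <-.
Qed.

Lemma energy_equivalent X X' : equivalent X X' -> energy X = energy X'.
Proof.
move=> eX; apply: eq_Rintegral => x _; congr inf; apply/seteqP.
by split=> _ [i _ <-]; exists i => //; rewrite (pdist_latr _ (eX i)).
Qed.

(** Passes from closeness on the torus to closeness of representatives, where the estimates for
    [sup_close] are available. *)
Lemma close_representative X Y e : cdist X Y < e -> exists Y' : config Om N,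
  equivalent Y Y' /\ sup_close X Y' e.
Proof.
move=> XY; have H i : exists k, lat Om k /\ enorm (X i - Y i - k) < e.
  have : pdist Om (X i) (Y i) < e by exact: le_lt_trans (pdist_le_cdist X Y i) XY.
  rewrite pdistE => /inf_lt h; have [|_ [k lk <-] ke] := h.
    by exists (enorm (X i - Y i - 0)); exists 0 => //; exact: lat0.
  by exists k.
pose k i := sval (cid (H i)).
have kP i : lat Om (k i) /\ enorm (X i - Y i - k i) < e := svalP (cid (H i)).
exists (fun i => Y i + k i); split=> i; have [lk ke] := kP i.
  by rewrite opprD addrA subrr add0r; exact: latN.
have E : X i - (Y i + k i) = X i - Y i - k i by rewrite opprD addrA.
rewrite -[_.1 - _]/((X i - (Y i + k i)).1) -[_.2 - _]/((X i - (Y i + k i)).2) E.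
by rewrite !(le_trans (enorm_ge1 _), le_trans (enorm_ge2 _)) ?ltW.
Qed.

(** Representatives may be unbounded, so each configuration is first moved by lattice vectors into a
    fixed square; Tychonoff gives a cluster point there. It also clusters the original filter
    because [cdist] does not see lattice shifts. *)
Lemma closed_config_compact (rd : lattice_reduction Om) (A : set (config Om N)) :
  closed A -> A `<=` configs Om N -> compact A.
Proof.
move=> cA Ac F PF FA.
have red X : exists X' : config Om N, A X -> equivalent X X' /\
    forall i, `|(X' i).1| <= red_bd rd /\ `|(X' i).2| <= red_bd rd.
  have [AX|nA] := pselect (A X); last by exists X.
  by have [X' h] := normalize rd (Ac _ AX); exists X'.
pose rho X := sval (cid (red X)).
have rhoP X : A X -> equivalent X (rho X) /\
    forall i, `|(rho X i).1| <= red_bd rd /\ `|(rho X i).2| <= red_bd rd.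
  exact: svalP (cid (red X)).
pose b := red_bd rd.
pose square : set (R * R) := `[- b, b]%classic `*` `[- b, b]%classic.
have csquare : compact square by apply: compact_setX; exact: segment_compact.
have Fsq : F (rho @^-1` [set f | forall i : 'I_N, square (f i)]).
  apply: filterS FA => X AX; have [_ h] := rhoP _ AX.
  by move=> i; have [h1 h2] := h i; split; rewrite /= in_itv/= -ler_norml.
have [a [_ ca]] := @tychonoff 'I_N (fun=> (R * R)%type) (fun=> square) (fun=> csquare)
  (rho @ F) (fmap_proper_filter rho PF) Fsq.
have cFa : cluster F (a : config Om N).
  move=> B V FB /config_nbhsP[e e0 He].
  have f1 : F (rho @^-1` (rho @` (B `&` A))).
    by apply: filterS (filterI FB FA) => X BA; exists X.
  have e'0 : 0 < e / (2 * (N%:R + 1)) by rewrite divr_gt0// mulr_gt0// ltr_wpDl.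
  have f2 : nbhs (a : prod_topology (fun _ : 'I_N => (R * R)%type))
      [set f | forall i : 'I_N, ball (a i) (e / (2 * (N%:R + 1))) (f i)].
    have := @filter_forall (prod_topology (fun _ : 'I_N => (R * R)%type)) 'I_N
      (fun i f => ball (a i) (e / (2 * (N%:R + 1))) (f i)) (nbhs a) (nbhs_filter a).
    apply=> i.
    exact: (@proj_continuous 'I_N (fun=> (R * R)%type) i a _ (nbhsx_ballx (a i) _ e'0)).
  have [_ [[X [BX AX] <-] Xa]] := ca _ _ f1 f2.
  exists X; split=> //; apply: He; have [eX _] := rhoP _ AX.
  rewrite (cdist_equivalent _ eX).
  apply: (@le_lt_trans _ _ (N%:R * (2 * (e / (2 * (N%:R + 1)))))).
    apply: cdist_sup_close => [|i]; first by rewrite divr_ge0 ?mulr_ge0 ?addr_ge0// ltW.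
    by have [h1 h2] := Xa i; split; apply: ltW.
  rewrite (_ : _ * _ = e * (N%:R / (N%:R + 1))); last first.
    by field; rewrite gt_eqF// ltr_wpDl.
  by rewrite gtr_pMr// ltr_pdivrMr ?mul1r ?ltrDl// ltr_wpDl.
exists a; split=> //; apply: cA => B nB.
by have [Y [AY BY]] := cFa A B FA nB; exists Y.
Qed.

End ConfigTopology.

Lemma finType_pos_lb (R : realType) (I : finType) (f : I -> R) :
  (forall i, 0 < f i) -> exists2 e : R, 0 < e & forall i, e <= f i.
Proof.
move=> f0; have [[i0 _]|nI] := pselect (exists i : I, True); last first.
  by exists 1 => // i; case: nI; exists i.
exists (inf [set f i | i in [set: I]]); last by move=> i; exact: inf_finType_le.
by have [i ->] := inf_finType_attained i0 f.
Qed.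

Lemma half_gap (R : realType) (x y m g c t : R) :
  g = x - m -> c <= g / 2 -> t < g / 2 -> x - c <= y -> t <= y - m.
Proof. lra. Qed.

Section Tube.
Variables (R : realType) (Om : domain R) (N : nat) (r : R).
Variable rd : lattice_reduction Om.
Hypothesis aOm : admissible Om.
Hypothesis N0 : (0 < N)%N.
Hypothesis r0 : 0 < r.
Hypothesis M0 : minimizers Om N !=set0.
Hypothesis distinct : forall X, closure (tube Om N r) X -> pairwise_distinct X.
Hypothesis inside : closure (tube Om N r) `<=` configs Om N.
Implicit Types X Y : config Om N.

Local Notation dM X := (dist_to X (minimizers Om N)).

Let dM_has_inf X : has_inf [set cdist X Y | Y in minimizers Om N].
Proof.
split; first by have [Y MY] := M0; exists (cdist X Y); exists Y.
by exists 0 => _ [Y _ <-]; exact: cdist_ge0.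
Qed.

Lemma dist_to_lip X Y : dM X <= cdist X Y + dM Y.
Proof.
apply/ler_addgt0Pr => e e0.
have [_ [Z MZ <-] hZ] := inf_adherent e0 (dM_has_inf Y).
apply: (@le_trans _ _ (cdist X Z)); first by apply: ge_inf; [case: (dM_has_inf X)|exists Z].
by rewrite (le_trans (cdist_triangle X Y Z))// -addrA lerD2l; exact: ltW.
Qed.

Lemma points_open x : points Om x -> exists2 e : R, 0 < e &
  forall y, enorm (y - x) < e -> points Om y.
Proof.
case: (Om) aOm => [A [_ oA _ _ _] /= Ax|l1 l2 _ _]; last by exists 1.
have /nbhs_ballP[e /= e0 He] : nbhs x A by exact: open_nbhs_nbhs.
exists e => // y yx; apply: He; split; rewrite /ball/= distrC.
  exact: le_lt_trans (enorm_ge1 (y - x)) yx.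
exact: le_lt_trans (enorm_ge2 (y - x)) yx.
Qed.

Lemma pdist_points_near (X : config Om N) : configs Om N X -> exists2 e : R, 0 < e &
  forall i y, pdist Om (X i) y < e -> points Om y.
Proof.
move=> cX; have H i : exists e : R, 0 < e /\ forall y, enorm (y - X i) < e -> points Om y.
  by have [e e0 He] := points_open (cX i); exists e.
have [e e0 He] := finType_pos_lb (fun i => proj1 (svalP (cid (H i)))).
exists e => // i y; case: (Om) X cX H e e0 He => [A|//] X cX H e e0 He /= Xy.
apply: (proj2 (svalP (cid (H i)))); rewrite -enormN opprB; exact: lt_le_trans (He i).
Qed.

Lemma tube_open X : tube Om N r X -> exists2 e : R, 0 < e &
  forall Y, cdist X Y < e -> tube Om N r Y.
Proof.
move=> [cX dX]; have [e e0 He] := pdist_points_near cX.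
exists (Num.min e (r - dM X)); first by rewrite lt_min e0 subr_gt0.
move=> Y; rewrite lt_min => /andP[h1 h2]; split.
  by move=> i; apply: (He i); exact: le_lt_trans (pdist_le_cdist X Y i) h1.
by apply: le_lt_trans (dist_to_lip Y X) _; rewrite cdistC -ltrBrDr.
Qed.

(** After a move into the fundamental set the infimum over the lattice is a minimum, so distance [0]
    is realized by a lattice vector. *)
Lemma pdist_eq0 x y : points Om x -> points Om y -> pdist Om x y = 0 -> lat Om (x - y).
Proof.
move=> px py; have [m lm Dx] := red_tile rd px; have [n ln Dy] := red_tile rd py.
have lmn k : lat Om k -> lat Om (k - m + n) by move=> lk; apply: latD => //; apply: latD => //; exact: latN.
have [b1 b2] := red_bounded rd Dy.
have w (u : R) : u <= red_bd rd -> u <= red_bd rd + 1.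
  by move=> h; apply: (le_trans h); rewrite lerDl.
have [k [E _]] := nearest_translate (rd := rd) Dx (w _ b1) (w _ b2).
rewrite (pdist_latl _ (_ : lat Om (x - (x + m)))); last first.
  by rewrite opprD addrA subrr add0r; exact: latN.
rewrite (pdist_latr _ (_ : lat Om (y - (y + n)))); last first.
  by rewrite opprD addrA subrr add0r; exact: latN.
rewrite E => /eqP; rewrite sqrtr_eq0 => h.
have E1 : x + m - (y + n) - red_vec k = 0.
  set z := _ - red_vec k in h *.
  have h1 : z.1 ^+ 2 + z.2 ^+ 2 <= 0 by rewrite !expr2.
  have z1 : z.1 ^+ 2 = 0 by apply/eqP; rewrite eq_le sqr_ge0 andbT; apply: le_trans h1; rewrite lerDl sqr_ge0.
  have z2 : z.2 ^+ 2 = 0 by apply/eqP; rewrite eq_le sqr_ge0 andbT; apply: le_trans h1; rewrite lerDr sqr_ge0.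
  by apply: plane_eq; apply/eqP; rewrite -sqrf_eq0 ?z1 ?z2.
have -> : x - y = red_vec k - m + n.
  by move/eqP: E1; rewrite subr_eq0 => /eqP <-; apply: plane_eq => /=; ring.
by apply: lmn; exact: red_vec_lat.
Qed.

Lemma closure_tube_compact : compact (closure (tube Om N r)).
Proof. by apply: (closed_config_compact rd) => //; exact: closed_closure. Qed.

Lemma closure_tube_dist X : closure (tube Om N r) X -> dM X <= r.
Proof.
move/config_closureP => H; apply/ler_addgt0Pr => e e0.
have [Y [_ tY] XY] := H e e0; rewrite addrC; apply: (le_trans (dist_to_lip X Y)).
by apply: lerD; exact: ltW.
Qed.

Lemma same_point_lat x y : same_point Om x y <-> lat Om (x - y).
Proof.
case: (Om) => [A|l1 l2] //=; split=> [->|/eqP]; first by rewrite subrr.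
by rewrite subr_eq0 => /eqP.
Qed.

(** Each configuration of the closed tube is spaced by some positive amount, and an amount four
    times smaller serves a whole neighbourhood; compactness makes it uniform. *)
Lemma tube_well_spaced : exists2 s : R, 0 < s &
  forall X, closure (tube Om N r) X -> well_spaced s X.
Proof.
have /compact_near_coveringP ct := closure_tube_compact.
have := ct R (0^'+) (fun e X => well_spaced e X) _ _.
move=> H.
have {}H : \forall e \near 0^'+, closure (tube Om N r) `<=` well_spaced e.
  apply: H => X cX; have cfX := inside cX.
  have d0 (p : 'I_N * 'I_N) : 0 < (if p.1 == p.2 then 1 else pdist Om (X p.1) (X p.2)).
    case: eqVneq => // ne; rewrite lt_neqAle pdist_ge0 andbT eq_sym; apply/eqP => h.
    by have := distinct cX ne; apply; apply/same_point_lat; apply: pdist_eq0 h; exact: cfX.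
  have [d dp0 Hd] := finType_pos_lb d0.
  have [q q0 Hq] := pdist_points_near cfX.
  pose e := Num.min d q / 4.
  have e0 : 0 < e by rewrite divr_gt0// lt_min dp0.
  have ed : 4 * e <= d by rewrite /e mulrC divfK// ge_min lexx.
  have eq_ : 4 * e <= q by rewrite /e mulrC divfK// ge_min lexx orbT.
  exists ([set Y | cdist X Y < e], [set t : R | t < e]); first split.
  - by apply/config_nbhsP; exists e.
  - exact: nbhs_right_lt.
  move=> [Y t] [/= XY te]; split.
  - move=> i; apply: (Hq i); apply: (le_lt_trans (pdist_le_cdist X Y i)); lra.
  - move=> i j ij; have := Hd (i, j); rewrite /= (negbTE ij) => h.
    have h1 := pdist_triangle Om (X i) (Y i) (X j).
    have h2 := pdist_triangle Om (Y i) (Y j) (X j).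
    have := pdist_le_cdist X Y i; have := pdist_le_cdist X Y j.
    rewrite (pdistC _ (X j)) => h3 h4; lra.
  - move=> i y yY; apply: (Hq i); have h1 := pdist_triangle Om (X i) (Y i) y.
    have h2 := pdist_le_cdist X Y i.
    have : pdist Om (Y i) y <= enorm (y - Y i) by rewrite pdistC pdist_le_enorm.
    lra.
have [e [e0 He]] : exists e : R, 0 < e /\ closure (tube Om N r) `<=` well_spaced e.
  near (0 : R)^'+ => e; exists e; split => //.
  by near: e.
by exists e.
Unshelve. all: by end_near. Qed.

Lemma energy_cdist : exists2 C : R, 0 <= C & forall X Y, configs Om N X -> configs Om N Y ->
  forall e, cdist X Y < e -> e <= 1 -> `|energy Y - energy X| <= C * e.
Proof.
have [C C0 HC] := @energy_lip R Om N rd N0; exists C => // X Y cX cY e XY e1.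
have [Y' [eY XY']] := close_representative XY.
have cY' := equivalent_configs cY eY; rewrite (energy_equivalent eY).
have YX' : sup_close Y' X e by apply: sup_close_sym.
rewrite ler_norml; apply/andP; split; last by rewrite lerBlDl; exact: HC.
by rewrite lerBrDl lerBlDr; exact: HC.
Qed.

Lemma min_energy_le X : configs Om N X -> min_energy Om N <= energy X.
Proof.
move=> cX; have [C C0 HC] := @energy_bounded R Om N rd N0.
apply: ge_inf; last by exists X.
by exists 0 => _ [Y cY <-]; have /andP[] := HC Y cY.
Qed.

(** A configuration at distance [r > 0] is no minimizer, so its excess energy is positive;
    continuity of the energy and compactness of the lateral boundary turn this into a uniform
    bound. *)
Lemma energy_gap_gt0 : (0 < energy_gap Om N r)%E.
Proof.
pose K := closure (tube Om N r) `&` [set X | dM X = r].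
have cK : compact K.
  apply: (@subclosed_compact _ _ (closure (tube Om N r))); [|exact: closure_tube_compact|by move=> X []].
  apply: closedI; first exact: closed_closure.
  move=> X /config_closureP H /=; apply/eqP; rewrite eq_le; apply/andP; split;
    apply/ler_addgt0Pr => e e0; have [Y /= <- XY] := H e e0.
    by rewrite addrC (le_trans (dist_to_lip X Y))// lerD2r ltW.
  by rewrite (le_trans (dist_to_lip Y X))// addrC lerD2l cdistC ltW.
move/compact_near_coveringP : cK => cK.
have H : \forall e \near (0 : R)^'+, K `<=` [set X | e <= energy X - min_energy Om N].
  apply: cK => X [cX dX]; have cfX := inside cX.
  have g0 : 0 < energy X - min_energy Om N.
    rewrite subr_gt0 lt_neqAle min_energy_le// andbT eq_sym; apply/eqP => E.
    have : dM X <= cdist X X by apply: ge_inf; [case: (dM_has_inf X)|exists X].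
    by rewrite dX cdistxx leNgt r0.
  set g := energy X - min_energy Om N in g0.
  have [C C0 HC] := energy_cdist.
  (* Within this radius the energy varies by at most [g / 2], so half of the excess at [X]
     survives. *)
  pose e := Num.min 1 (g / (2 * (C + 1))).
  have C1 : 0 < 2 * (C + 1) by rewrite mulr_gt0// ltr_wpDl.
  have e0 : 0 < e by rewrite lt_min ltr01 divr_gt0.
  have Ce : C * e <= g / 2.
    apply: (@le_trans _ _ ((C + 1) * (g / (2 * (C + 1))))).
      by apply: ler_pM => //; [exact: ltW|rewrite lerDl|rewrite /e ge_min lexx orbT].
    by rewrite le_eqVlt; apply/orP; left; apply/eqP; field; rewrite gt_eqF// ltr_wpDl.
  exists ([set Y | cdist X Y < e /\ configs Om N Y], [set t : R | t < g / 2]); first split.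
  - have [q q0 Hq] := pdist_points_near cfX.
    apply/config_nbhsP; exists (Num.min q e); first by rewrite lt_min q0.
    move=> Y; rewrite lt_min => /andP[h1 h2]; split=> // i; apply: (Hq i).
    exact: le_lt_trans (pdist_le_cdist X Y i) h1.
  - by apply: nbhs_right_lt; rewrite divr_gt0.
  move=> [Y t] [/= [XY cY] tg].
  have e1 : e <= 1 by rewrite ge_min lexx.
  have := HC X Y cfX cY e XY e1; rewrite ler_distl => /andP[h _].
  exact: (half_gap (g := g) (c := C * e) erefl Ce tg h).
have [e [e0 He]] : exists e : R, 0 < e /\ K `<=` [set X | e <= energy X - min_energy Om N].
  by near (0 : R)^'+ => e; exists e; split => //; near: e.
apply: (@lt_le_trans _ _ e%:E); first by rewrite lte_fin.
by apply: le_ereal_inf_tmp => _ [X KX <-]; rewrite lee_fin; exact: He.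
Unshelve. all: by end_near. Qed.

End Tube.

(** * The velocity field *)

(** The integral of a nonnegative function is a supremum over simple functions below it, so
    monotonicity asks for no measurability. The norm of the velocity is known to be measurable only
    on a subset of full measure of the time interval. *)
Lemma ge0_le_integralT d (T : measurableType d) (R : realType) (mu : {measure set T -> \bar R})
    (f g : T -> \bar R) : (forall x, (0 <= f x)%E) -> (forall x, (f x <= g x)%E) ->
  (\int[mu]_x f x <= \int[mu]_x g x)%E.
Proof.
move=> f0 fg; have g0 x : (0 <= g x)%E by exact: le_trans (fg x).
rewrite !ge0_integralTE//; apply: ereal_sup_le => _ [h /= hf <-]; exists h => //= x.
exact: le_trans (fg x).
Qed.

Section Velocity.
Variables (R : realType) (Om : domain R).
Variable rd : lattice_reduction Om.
Hypothesis pts0 : points Om !=set0.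
Notation mu := (@lebesgue_measure R).
Implicit Types (f g : R * R -> R * R) (v : R -> R * R -> R * R).

Let S1 f : set (\bar R) := [set (enorm (f x))%:E | x in points Om].
Let S2 f : set (\bar R) := [set (enorm (f z.1 - f z.2) / pdist Om z.1 z.2)%:E
             | z in points Om `*` points Om].

Let C01E f : C01_norm Om f = (ereal_sup (S1 f) + ereal_sup (S2 f))%E. Proof. by []. Qed.

Let S1_ge0 f : (0 <= ereal_sup (S1 f))%E.
Proof.
have [x px] := pts0; apply: le_ereal_sup_tmp; exists (enorm (f x))%:E; first by exists x.
by rewrite lee_fin enorm_ge0.
Qed.

Let S2_ge0 f : (0 <= ereal_sup (S2 f))%E.
Proof.
have [x px] := pts0; apply: le_ereal_sup_tmp.
exists (enorm (f x - f x) / pdist Om x x)%:E; first by exists (x, x).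
by rewrite lee_fin divr_ge0 ?enorm_ge0 ?pdist_ge0.
Qed.

Lemma C01_norm_ge0 f : (0 <= C01_norm Om f)%E.
Proof. by rewrite C01E adde_ge0. Qed.

Lemma C01_norm_sup f x : points Om x -> ((enorm (f x))%:E <= C01_norm Om f)%E.
Proof.
move=> px; rewrite C01E; apply: (@le_trans _ _ (ereal_sup (S1 f))); last by rewrite leeDl.
by apply: ereal_sup_ubound; exists x.
Qed.

Lemma C01_norm_quotient f x y : points Om x -> points Om y ->
  ((enorm (f x - f y) / pdist Om x y)%:E <= C01_norm Om f)%E.
Proof.
move=> px py; rewrite C01E; apply: (@le_trans _ _ (ereal_sup (S2 f))); last by rewrite leeDr.
by apply: ereal_sup_ubound; exists (x, y).
Qed.

Lemma C01_norm_triangle f g : (C01_norm Om f <= C01_norm Om g + C01_norm Om (fun x => (f x - g x)%R))%E.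
Proof.
rewrite !C01E addeACA; apply: leeD; apply: ge_ereal_sup.
  move=> _ [x px <-]; apply: (@le_trans _ _ ((enorm (g x))%:E + (enorm (f x - g x))%:E)%E).
    rewrite -EFinD lee_fin; have := enormD (g x) (f x - g x).
    by rewrite addrC subrK addrC.
  by apply: leeD; apply: ereal_sup_ubound; exists x.
move=> _ [[x y] [/= px py] <-].
apply: (@le_trans _ _ ((enorm (g x - g y) / pdist Om x y)%:E +
    (enorm (f x - g x - (f y - g y)) / pdist Om x y)%:E)%E).
  rewrite -EFinD lee_fin -mulrDl ler_wpM2r ?invr_ge0 ?pdist_ge0//.
  have := enormD (g x - g y) (f x - g x - (f y - g y)).
  by rewrite (_ : _ + _ = f x - f y)//; apply: plane_eq => /=; ring.
by apply: leeD; apply: ereal_sup_ubound; exists (x, y).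
Qed.

Lemma C01_norm_fin f : C01 Om f -> (C01_norm Om f \is a fin_num)%E.
Proof. by move=> [_ h]; rewrite ge0_fin_numE// C01_norm_ge0. Qed.

Lemma C01_bound f x : C01 Om f -> points Om x -> enorm (f x) <= fine (C01_norm Om f).
Proof.
by move=> cf px; rewrite -lee_fin fineK ?C01_norm_fin//; exact: C01_norm_sup.
Qed.

(** At distance [0] the quotient in the norm carries no information; there the lattice periodicity
    contained in [C01] takes over. *)
Lemma C01_lip f x y : C01 Om f -> points Om x -> points Om y ->
  enorm (f x - f y) <= fine (C01_norm Om f) * pdist Om x y.
Proof.
move=> cf px py; have [d0|d0] := eqVneq (pdist Om x y) 0.
  have [h _] := cf; rewrite (h x y); last by apply/same_point_lat; apply: pdist_eq0 d0.
  by rewrite d0 subrr enorm0 mulr0.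
rewrite -ler_pdivrMr; last by rewrite lt_neqAle eq_sym d0 pdist_ge0.
by rewrite -lee_fin fineK ?C01_norm_fin//; exact: C01_norm_quotient.
Qed.

Lemma C01_norm_cvg (u : nat -> R * R -> R * R) f : C01 Om f ->
  C01_norm Om (fun x => u n x - f x) @[n --> \oo] --> 0%E ->
  C01_norm Om (u n) @[n --> \oo] --> C01_norm Om f.
Proof.
move=> cf uf; have ff := C01_norm_fin cf.
have uN n : C01_norm Om (fun x => u n x - f x) = C01_norm Om (fun x => f x - u n x).
  rewrite !C01E; congr (ereal_sup _ + ereal_sup _)%E; apply/seteqP.
    by split=> _ [x px <-]; exists x => //; congr EFin; rewrite -[LHS]enormN opprB.
  by split=> _ [[x y] pxy <-]; exists (x, y) => //=;
    congr (_ / _)%:E; rewrite -[LHS]enormN; congr enorm; apply: plane_eq => /=; ring.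
apply: (@squeeze_cvge _ _ _ _ (fun n => C01_norm Om f - C01_norm Om (fun x => (u n x - f x)%R))%E
  _ (fun n => C01_norm Om f + C01_norm Om (fun x => (u n x - f x)%R))%E).
- apply: nearW => n; rewrite C01_norm_triangle andbT.
  have := C01_norm_triangle f (u n); rewrite -uN.
  case: (C01_norm Om (fun x => u n x - f x)) (C01_norm_ge0 (fun x => u n x - f x)) => [d|//|] d0.
  + by rewrite leeBlDr.
  + by move: ff; case: (C01_norm Om f) => //= r _ _; rewrite leNye.
  + by [].
- rewrite -[X in _ --> X]sube0; apply: cvgeB => //; last exact: cvg_cst.
  by rewrite fin_num_adde_defr.
- rewrite -[X in _ --> X]adde0; apply: cvgeD => //; last exact: cvg_cst.
  by rewrite fin_num_adde_defr.
Qed.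

Lemma C01_norm_cvg_pointwise (u : nat -> R * R -> R * R) f x : points Om x ->
  C01_norm Om (fun x => u n x - f x) @[n --> \oo] --> 0%E ->
  (u n x).1 @[n --> \oo] --> (f x).1 /\ (u n x).2 @[n --> \oo] --> (f x).2.
Proof.
move=> px uf.
have near0 e : 0 < e -> \forall n \near \oo, enorm (f x - u n x) < e.
  move=> e0.
  have : \forall n \near \oo, (C01_norm Om (fun x => (u n x - f x)%R) < e%:E)%E.
    exact: (uf _ (@nbhs_open_ereal_lt R 0 (fun=> e) e0)).
  apply: filterS => n h; rewrite -lte_fin -enormN opprB; apply: le_lt_trans h.
  exact: (@C01_norm_sup (fun x => u n x - f x)).
split; apply/cvgrPdist_lt => e e0; have := near0 e e0; apply: filterS => n; apply: le_lt_trans.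
  exact: (enorm_ge1 (f x - u n x)).
exact: (enorm_ge2 (f x - u n x)).
Qed.

(** A simple field depends on time only through the pattern of the sets [E k] that contain it. There
    are finitely many patterns, each met on a measurable set, so any function of the pattern is
    measurable. *)
Let measurable_pattern m (E : 'I_m -> set R) (G : {ffun 'I_m -> bool} -> \bar R) :
  (forall k, measurable (E k : set (measurableTypeR R))) ->
  measurable_fun [set: measurableTypeR R] (fun t : R => G [ffun k => t \in E k]).
Proof.
move=> mE _ Y mY; rewrite setTI.
rewrite (_ : _ @^-1` Y = \bigcup_(p in [set p : {ffun 'I_m -> bool} | Y (G p)])
    \bigcap_(k in [set: 'I_m]) (if p k then E k else ~` E k)).
  apply: fin_bigcup_measurable => [|p _]; first exact: finite_finset.
  apply: fin_bigcap_measurable => [|k _]; first exact: finite_finset.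
  by case: ifP => _ //; exact: measurableC.
apply/seteqP; split=> [t /= Yt|t [p /= Yp tp]].
  exists [ffun k => t \in E k] => // k _; rewrite ffunE.
  by case: ifPn => [|/negP h tE]; [rewrite inE|apply: h; rewrite inE].
rewrite (_ : [ffun k => t \in E k] = p)//; apply/ffunP => k; rewrite ffunE.
by have := tp k I; case: (p k) => h; [exact: mem_set|exact: memNset].
Qed.

Lemma simple_C01_norm_measurable (s : R -> R * R -> R * R) : simple_C01 Om s ->
  measurable_fun [set: measurableTypeR R] (fun t => C01_norm Om (s t)).
Proof.
move=> [m [E [f [mE cf sE]]]].
pose G (p : {ffun 'I_m -> bool}) := C01_norm Om (fun x => \sum_(k < m) ((p k)%:R : R) *: f k x).
rewrite (_ : (fun t => _) = (fun t => G [ffun k => t \in E k])); first exact: measurable_pattern.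
apply/funext => t; rewrite /G; congr C01_norm; apply/funext => x; rewrite sE.
by apply: eq_bigr => k _; rewrite ffunE indicE.
Qed.

Lemma simple_C01_measurable (s : R -> R * R -> R * R) (w : R -> R) (y : R -> R * R) :
  simple_C01 Om s ->
  (forall f, C01 Om f -> measurable_fun [set: measurableTypeR R] (fun t => w t * (f (y t)).1) /\
     measurable_fun [set: measurableTypeR R] (fun t => w t * (f (y t)).2)) ->
  measurable_fun [set: measurableTypeR R] (fun t => w t * (s t (y t)).1) /\
  measurable_fun [set: measurableTypeR R] (fun t => w t * (s t (y t)).2).
Proof.
move=> [m [E [f [mE cf sE]]]] H.
have fst_sum (F : 'I_m -> R * R) : (\sum_k F k).1 = \sum_k (F k).1.
  by elim/big_rec2: _ => // k u1 u2 _ <-.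
have snd_sum (F : 'I_m -> R * R) : (\sum_k F k).2 = \sum_k (F k).2.
  by elim/big_rec2: _ => // k u1 u2 _ <-.
have mI k : measurable_fun [set: measurableTypeR R] (\1_(E k) : _ -> R).
  by apply: measurable_indic; exact: mE.
split.
  rewrite (_ : (fun t => _) = (fun t => \sum_(k < m) \1_(E k) t * (w t * (f k (y t)).1))).
    by apply: measurable_sum => k; apply: measurable_funM => //; case: (H _ (cf k)).
  apply/funext => t; rewrite sE fst_sum mulr_sumr; apply: eq_bigr => k _.
  by rewrite mulrCA.
rewrite (_ : (fun t => _) = (fun t => \sum_(k < m) \1_(E k) t * (w t * (f k (y t)).2))).
  by apply: measurable_sum => k; apply: measurable_funM => //; case: (H _ (cf k)).
apply/funext => t; rewrite sE snd_sum mulr_sumr; apply: eq_bigr => k _.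
by rewrite mulrCA.
Qed.

(** On [G] every [v t] is Lipschitz and is the limit of the simple fields, so [m] is measurable as a
    limit of norms. The weight [w] in the last clause silences the times at which [y] is outside the
    domain, where nothing is known about [v]. *)
Lemma velocity_majorant (T : R) v : L1_C01 Om T v ->
  exists (G : set (measurableTypeR R)) (m : R -> R),
  [/\ measurable G, G `<=` `]0, T[, {ae mu, forall t : R, 0 < t < T -> G t},
    forall t, 0 <= m t & forall t, ~ G t -> m t = 0] /\
  [/\ mu.-integrable setT (EFin \o m),
    forall t x, G t -> points Om x -> enorm (v t x) <= m t,
    forall t x y, G t -> points Om x -> points Om y ->
      enorm (v t x - v t y) <= m t * pdist Om x y &
    forall (w : R -> R) (y : R -> R * R),
      (forall f, C01 Om f -> measurable_fun [set: measurableTypeR R] (fun t => w t * (f (y t)).1) /\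
         measurable_fun [set: measurableTypeR R] (fun t => w t * (f (y t)).2)) ->
      (forall t, w t != 0 -> points Om (y t)) ->
      measurable_fun G (fun t => w t * (v t (y t)).1) /\
      measurable_fun G (fun t => w t * (v t (y t)).2)].
Proof.
move=> [[A [mA A0 HA]] [s ss [A' [mA' A'0 HA']]] vfin].
pose G : set (measurableTypeR R) := `]0, T[%classic `\` (A `|` A').
have mAA : measurable (A `|` A') by exact: measurableU.
have mG : measurable G by apply: measurableD => //; exact: measurable_itv.
have Gv t : G t -> C01 Om (v t).
  move=> [/=]; rewrite in_itv/= => tT nA; apply: contrapT => nc; apply: nA; left.
  by apply: HA => /= h; apply: nc; exact: h.
have Gs t : G t -> C01_norm Om (fun x => s n t x - v t x) @[n --> \oo] --> 0%E.
  move=> [/=]; rewrite in_itv/= => tT nA; apply: contrapT => nc; apply: nA; right.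
  by apply: HA' => /= h; apply: nc; exact: h.
have mC : measurable_fun G (fun t => C01_norm Om (v t)).
  apply: (emeasurable_fun_cvg (fun n t => C01_norm Om (s n t))).
    by move=> n; apply: measurable_funTS; exact: simple_C01_norm_measurable.
  by move=> t Gt; exact: C01_norm_cvg (Gv t Gt) (Gs t Gt).
pose m t := if t \in G then fine (C01_norm Om (v t)) else 0.
have m0 t : 0 <= m t by rewrite /m; case: ifP => // _; apply: fine_ge0; exact: C01_norm_ge0.
have mE t : G t -> m t = fine (C01_norm Om (v t)) by move=> Gt; rewrite /m mem_set.
have mm : measurable_fun [set: measurableTypeR R] m.
  have -> : m = (fun t => fine (C01_norm Om (v t))) \_ G.
    by apply/funext => t; rewrite /m patchE.
  apply/(measurable_restrictT _ _).1 => //.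
  exact: (measurableT_comp (@fine_measurable R setT measurableT) mC).
exists G, m; split; split => //.
- by move=> t [].
- have : mu.-negligible (A `|` A') by apply: negligibleU; [exists A; split|exists A'; split].
  apply: negligibleS => t /= nG; apply: contrapT => nA; apply: nG => tT.
  by split=> //; rewrite /= in_itv.
- by move=> t nG; rewrite /m memNset.
- apply/integrableP; split; first exact/measurable_EFinP.
  apply: le_lt_trans vfin; rewrite [leRHS]integral_mkcond.
  apply: ge0_le_integralT => t; first by [].
  rewrite /= ger0_norm// patchE.
  case: ifPn => ht; first last.
    rewrite /m memNset// => -[h _]; move/negP: ht; apply; exact: mem_set.
  rewrite /m; case: ifPn => hG; last exact: C01_norm_ge0.
  by rewrite fineK// C01_norm_fin//; apply: Gv; rewrite inE in hG.
- by move=> t x Gt px; rewrite mE//; apply: C01_bound => //; exact: Gv.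
- by move=> t x y Gt px py; rewrite mE//; apply: C01_lip => //; exact: Gv.
- move=> w y H wy.
  have mw n := simple_C01_measurable (ss n) H.
  have cv t : G t -> (w t * (s n t (y t)).1 @[n --> \oo] --> w t * (v t (y t)).1) /\
      (w t * (s n t (y t)).2 @[n --> \oo] --> w t * (v t (y t)).2).
    move=> Gt; have [w0|w0] := eqVneq (w t) 0.
      rewrite w0 !mul0r; split; under eq_fun do rewrite mul0r; exact: cvg_cst.
    have [h1 h2] := C01_norm_cvg_pointwise (wy t w0) (Gs t Gt).
    by split; apply: cvgM => //; exact: cvg_cst.
  split.
    apply: (measurable_fun_cvg (h := fun n t => w t * (s n t (y t)).1)).
      by move=> n; apply: measurable_funTS; case: (mw n).
    by move=> t /cv[].
  apply: (measurable_fun_cvg (h := fun n t => w t * (s n t (y t)).2)).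
    by move=> n; apply: measurable_funTS; case: (mw n).
  by move=> t /cv[].
Qed.

End Velocity.

(** * The cutoff *)

Section PlaneCurves.
Variable R : realType.
Implicit Types (f : R -> R * R).

Lemma is_derive_pair f (t a b : R) :
  is_derive t (1 : R) (fun s => (f s).1) a -> is_derive t (1 : R) (fun s => (f s).2) b ->
  is_derive t (1 : R) (f : R -> R * R) (a, b).
Proof.
move=> [d1 E1] [d2 E2].
have h1 : (fun u : R => u^-1 *: ((f (u *: 1 + t)).1 - (f t).1)) u @[u --> 0^'] --> a by rewrite -E1.
have h2 : (fun u : R => u^-1 *: ((f (u *: 1 + t)).2 - (f t).2)) u @[u --> 0^'] --> b by rewrite -E2.
have h : (fun u : R => u^-1 *: (f (u *: 1 + t) - f t)) u @[u --> 0^'] --> (a, b) by exact: cvg_pair h1 h2.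
split; first by apply/cvg_ex; exists (a, b).
exact: (cvg_lim _ h).
Qed.

Lemma is_derive_coords f (t : R) (l : R * R) : is_derive t (1 : R) (f : R -> R * R) l ->
  is_derive t (1 : R) (fun s => (f s).1) l.1 /\ is_derive t (1 : R) (fun s => (f s).2) l.2.
Proof.
move=> [d E].
have h : (fun u : R => u^-1 *: (f (u *: 1 + t) - f t)) u @[u --> 0^'] --> l by rewrite -E.
have h1 : (fun u : R => u^-1 *: ((f (u *: 1 + t)).1 - (f t).1)) u @[u --> 0^'] --> l.1.
  by apply: (cvg_comp _ fst h); apply: cvg_fst.
have h2 : (fun u : R => u^-1 *: ((f (u *: 1 + t)).2 - (f t).2)) u @[u --> 0^'] --> l.2.
  by apply: (cvg_comp _ snd h); apply: cvg_snd.
split; split.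
- by apply/cvg_ex; exists l.1.
- exact: (cvg_lim _ h1).
- by apply/cvg_ex; exists l.2.
- exact: (cvg_lim _ h2).
Qed.

Lemma absolutely_continuousP (T : R) f : absolutely_continuous T f <->
  ac_increments T (fun a b => `|(f b).1 - (f a).1|) /\
  ac_increments T (fun a b => `|(f b).2 - (f a).2|).
Proof.
split=> [h|[h1 h2]]; last first.
  rewrite /absolutely_continuous -/(ac_increments T (fun a b => enorm (f b - f a))).
  apply: (ac_increments_le ler01 _ (ac_incrementsD h1 h2)) => a b _ _.
  by rewrite mul1r; exact: (enorm_le_add (f b - f a)).
have h' : ac_increments T (fun a b => enorm (f b - f a)) by exact: h.
split; apply: (ac_increments_le ler01 _ h') => a b _ _; rewrite mul1r.
  exact: (enorm_ge1 (f b - f a)).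
exact: (enorm_ge2 (f b - f a)).
Qed.

Definition clamp01 (u : R) : R := Num.max 0 (Num.min 1 u).

Lemma clamp01_itv u : 0 <= clamp01 u <= 1.
Proof. by rewrite le_max lexx ge_max ler01 ge_min lexx. Qed.

Lemma clamp01_ge1 u : 1 <= u -> clamp01 u = 1.
Proof. by move=> u1; rewrite /clamp01 min_l// max_r. Qed.

Lemma clamp01_le (u b : R) : 0 <= b -> u <= b -> clamp01 u <= b.
Proof. by move=> b0 ub; rewrite ge_max b0 ge_min ub orbT. Qed.

Lemma clamp01_lip u w : `|clamp01 u - clamp01 w| <= `|u - w|.
Proof.
wlog uw : u w / w <= u.
  move=> H; have [|/ltW] := leP w u; first exact: H.
  by rewrite distrC (distrC u); exact: H.
rewrite [leRHS]ger0_norm ?subr_ge0//; rewrite /clamp01 /Num.max /Num.min.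
rewrite ler_norml; case: (ltP 1 u) => ?; case: (ltP 1 w) => ?;
  rewrite ?ltr01; try (case: (ltP 0 u) => ?); try (case: (ltP 0 w) => ?);
  apply/andP; split; lra.
Qed.

End PlaneCurves.

Lemma dist_interp_le (R : realType) (p q t e : R) : 0 < t -> t <= 1 -> `|p - q| <= e ->
  `|p - (p + t * (q - p))| <= e.
Proof.
move=> t0 t1 h; rewrite (_ : p - _ = t * (p - q)); last by ring.
by rewrite normrM (gtr0_norm t0) (le_trans _ h)// ler_piMl.
Qed.

Lemma mulrB_split (R : realType) (a b x y : R) : a * x - b * y = (a - b) * x + b * (x - y).
Proof. by ring. Qed.

Lemma subrB_cancel (R : realType) (a x y : R) : a - y - (a - x) = x - y.
Proof. by ring. Qed.

Lemma itv_dist_le (R : realType) (x y c : R) : 0 <= x <= c -> 0 <= y <= c -> `|x - y| <= c.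
Proof. by rewrite ler_norml; lra. Qed.

Lemma le_sub_trans (R : realType) (x y d e1 : R) : - (x - y) <= d -> e1 <= y -> e1 - x <= d.
Proof. lra. Qed.

(** [P] holds on a relatively open set of times, so if it ever fails, it already fails at the
    infimum of the failure times. *)
Lemma first_failure (R : realType) (T : R) (P : R -> Prop) : P 0 ->
  (forall t, 0 <= t <= T -> P t -> exists2 d : R, 0 < d &
     forall u, 0 <= u <= T -> `|u - t| < d -> P u) ->
  (forall t, 0 <= t <= T -> P t) \/
  exists t, [/\ 0 < t <= T, forall u, 0 <= u < t -> P u & ~ P t].
Proof.
move=> P0 oP; have [h|nh] := pselect (forall t, 0 <= t <= T -> P t); first by left.
right; pose S := [set t | 0 <= t <= T /\ ~ P t].
have S0 : S !=set0.
  by apply: contrapT => nS; apply: nh => t tT; apply: contrapT => nt; apply: nS; exists t.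
have hS : has_inf S by split=> //; exists 0 => t [/andP[]].
pose t := inf S.
have t0 : 0 <= t by apply: lb_le_inf => // u [/andP[]].
have tT : t <= T.
  by have [u Su] := S0; apply: (le_trans (ge_inf (proj2 hS) Su)); have [/andP[]] := Su.
have before u : 0 <= u < t -> P u.
  move=> /andP[u0 ut]; apply: contrapT => nu.
  have Su : S u by split=> //; rewrite u0 (le_trans (ltW ut)).
  by have := ge_inf (proj2 hS) Su; rewrite leNgt ut.
have tT' : 0 <= t <= T by rewrite t0.
have nt : ~ P t.
  move=> tt; have [d d0 Hd] := oP t tT' tt.
  have [w Sw wt] := inf_adherent d0 hS; have tw := ge_inf (proj2 hS) Sw.
  case: Sw => wT; apply; apply: Hd => //.
  by rewrite ger0_norm ?subr_ge0// ltrBlDl.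
have tpos : 0 < t by rewrite lt_neqAle t0 andbT; apply/eqP => E; apply: nt; rewrite -E.
by exists t; split=> //; rewrite tpos.
Qed.

Lemma left_neighbour (R : realType) (t d : R) : 0 < t -> 0 < d ->
  exists2 u, 0 <= u < t & `|u - t| < d.
Proof.
move=> t0 d0; exists (Num.max 0 (t - d / 2)).
  by rewrite le_max lexx gt_max t0 gtrBl divr_gt0.
rewrite ltr_distl lt_max gt_max; apply/andP; split; last by apply/andP; split; lra.
by apply/orP; right; lra.
Qed.

Section Cutoff.
Variables (R : realType) (Om : domain R) (N : nat) (r : R).
Variable rd : lattice_reduction Om.
Hypothesis aOm : admissible Om.
Hypothesis N0 : (0 < N)%N.
Hypothesis r0 : 0 < r.
Hypothesis M0 : minimizers Om N !=set0.
Hypothesis inside : closure (tube Om N r) `<=` configs Om N.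
Implicit Types X Y : config Om N.
Notation tube := (tube Om N r).

(** For [e > 1] the boundedness of the energy gives the estimate for free. *)
Lemma energy_lip_global : exists2 C : R, 0 <= C & forall X Y e,
  configs Om N X -> configs Om N Y -> sup_close X Y e -> `|energy X - energy Y| <= C * e.
Proof.
have [C C0 HC] := @energy_lip R Om N rd N0; have [C' C'0 HC'] := @energy_bounded R Om N rd N0.
exists (C + C'); first exact: addr_ge0.
move=> X Y e cX cY XY.
have e0 : 0 <= e by have [h _] := XY (Ordinal N0); exact: le_trans h.
have YX : sup_close Y X e by apply: sup_close_sym.
have [e1|/ltW e1] := leP e 1.
  apply: (@le_trans _ _ (C * e)); last by rewrite ler_wpM2r// lerDl.
  by rewrite ler_distl; apply/andP; split; [rewrite lerBlDr|]; exact: HC.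
apply: (@le_trans _ _ C').
  exact: itv_dist_le (HC' X cX) (HC' Y cY).
by rewrite mulrDl (@le_trans _ _ (C' * e))// ?ler_peMr// lerDr mulr_ge0.
Qed.

Definition cdist_continuous (T : R) (gam : R -> config Om N) : Prop :=
  forall t, 0 <= t <= T -> forall e : R, 0 < e -> exists2 d : R, 0 < d &
    forall u, 0 <= u <= T -> `|u - t| < d -> cdist (gam t) (gam u) < e.

Lemma first_exit T (gam : R -> config Om N) : cdist_continuous T gam -> tube (gam 0) ->
  (forall t, 0 <= t <= T -> tube (gam t)) \/
  exists t, [/\ 0 < t <= T, forall u, 0 <= u < t -> tube (gam u),
     closure tube (gam t) & ~ tube (gam t)].
Proof.
move=> cg tg0; have [|h|[t [/andP[t0 tT] before nt]]] := @first_failure R T (fun t => tube (gam t)) tg0.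
- move=> t tT tt; have [e eps0 He] := tube_open aOm M0 tt.
  have [d d0 Hd] := cg t tT e eps0; exists d; first exact: d0.
  by move=> u uT ut; apply: He; exact: Hd uT ut.
- by left.
have tT' : 0 <= t <= T by rewrite ltW.
right; exists t; split; [by rewrite t0|exact: before| |exact: nt].
apply/config_closureP => e eps0; have [d d0 Hd] := cg t tT' e eps0.
have [u /andP[u0 ut] utd] := left_neighbour t0 d0.
exists (gam u); first by apply: before; rewrite u0.
by apply: Hd utd; rewrite u0 (le_trans (ltW ut)).
Qed.

Variables (e0 e1 : R).
Hypothesis e01 : e0 < e1.
Hypothesis e1_gap : ((e1 - min_energy Om N)%:E <= energy_gap Om N r)%E.

(** Such an [X] is at distance exactly [r]: at most [r] by closure, and not less since it is an
    admissible configuration outside the tube. It therefore competes in [energy_gap]. *)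
Lemma exit_energy X : closure tube X -> ~ tube X -> e1 <= energy X.
Proof.
move=> cX nX; have cfX := inside cX.
have dX : dist_to X (minimizers Om N) = r.
  apply/eqP; rewrite eq_le closure_tube_dist//= leNgt; apply/negP => h; apply: nX.
  by split.
rewrite -(lerD2r (- min_energy Om N)) -lee_fin; apply: (le_trans e1_gap).
by apply: ereal_inf_lbound; exists X.
Qed.

(** The clamped energy is [0] from [e1] on, so the jump of the tube indicator is invisible at the
    lateral boundary. The indicator itself removes low-energy configurations far from the tube. *)
Definition chi X : R :=
  if `[< tube X >] then clamp01 ((e1 - energy X) / (e1 - e0)) else 0.

Lemma chi_itv X : 0 <= chi X <= 1.
Proof. by rewrite /chi; case: ifP => _; [exact: clamp01_itv|rewrite lexx ler01]. Qed.

Lemma chi_neq0 X : chi X != 0 -> tube X.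
Proof. by rewrite /chi; case: asboolP => //; rewrite eqxx. Qed.

Lemma chi_eq1 X : tube X -> energy X <= e0 -> chi X = 1.
Proof.
move=> tX EX; rewrite /chi asboolT// clamp01_ge1// ler_pdivlMr ?subr_gt0// mul1r.
by rewrite lerD2l lerN2.
Qed.

Lemma tube_configs X : tube X -> configs Om N X. Proof. by case. Qed.

Lemma sup_close_cdist_continuous X Y : cdist_continuous 1
  (fun t i => (X i + t *: (Y i - X i) : R * R)).
Proof.
move=> t _ e eps0.
pose b := \sum_i (`|(Y i - X i).1| + `|(Y i - X i).2|).
have b0 : 0 <= b by apply: sumr_ge0 => i _; exact: addr_ge0.
have q0 : 0 < 2 * N%:R * b + 1 by rewrite ltr_wpDl// !mulr_ge0.
exists (e / (2 * N%:R * b + 1)); first by rewrite divr_gt0.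
move=> u _ ut; apply: (@le_lt_trans _ _ (N%:R * (2 * (`|u - t| * b)))).
  apply: cdist_sup_close => [|i]; first by rewrite mulr_ge0.
  have hb : `|(Y i - X i).1| + `|(Y i - X i).2| <= b.
    by rewrite /b [leRHS](bigD1 i)//= lerDl sumr_ge0// => j _; rewrite addr_ge0.
  have E (p q : R) : p + t * q - (p + u * q) = (t - u) * q by ring.
  rewrite /= /GRing.scale/= !E !normrM (distrC t u); split; rewrite ler_wpM2l//.
    by apply: le_trans hb; rewrite /= lerDl.
  by apply: le_trans hb; rewrite /= lerDr.
have [->|un] := eqVneq u t; first by rewrite subrr normr0 !(mul0r, mulr0).
rewrite (_ : N%:R * _ = `|u - t| * (2 * N%:R * b)); last by ring.
apply: (@le_lt_trans _ _ (`|u - t| * (2 * N%:R * b + 1))); first by rewrite ler_wpM2l// lerDl.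
by rewrite -ltr_pdivlMr.
Qed.

(* The segment from [X] to [Y] leaves the tube through its lateral boundary,
   where the energy is at least [e1]. *)
Lemma chi_exit C X Y e : 0 <= C -> (forall X Y e,
  configs Om N X -> configs Om N Y -> sup_close X Y e -> `|energy X - energy Y| <= C * e) ->
  tube X -> ~ tube Y -> sup_close X Y e -> chi X <= C / (e1 - e0) * e.
Proof.
move=> C0 HC tX nY XY.
have e00 : 0 <= e by have [h _] := XY (Ordinal N0); exact: le_trans h.
have X0 : (fun i => X i + 0 *: (Y i - X i)) = X by apply/funext => i; rewrite scale0r addr0.
have X1 : (fun i => X i + 1 *: (Y i - X i)) = Y by apply/funext => i; rewrite scale1r addrC subrK.
have tX' : tube (fun i => X i + 0 *: (Y i - X i)) by rewrite X0.
have [h|[t [/andP[t0 t1] _ ct nt]]] := first_exit (@sup_close_cdist_continuous X Y)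
    tX'.
  by move: (h 1); rewrite ler01 lexx X1 => /(_ isT).
have HZ : sup_close X (fun i => X i + t *: (Y i - X i)) e.
  by move=> i; have [h1 h2] := XY i; split; apply: dist_interp_le.
have EZ := exit_energy ct nt.
have := HC _ _ _ (tube_configs tX) (inside ct) HZ.
move=> /ler_normlP[EX _]; rewrite /chi (asboolT tX).
have d0 : 0 < e1 - e0 by rewrite subr_gt0.
rewrite mulrAC; apply: clamp01_le.
  by apply: divr_ge0 (ltW d0); exact: mulr_ge0.
rewrite ler_pM2r ?invr_gt0; last exact: d0.
exact: le_sub_trans EX EZ.
Qed.

Lemma chi_lip : exists2 L : R, 0 <= L & forall X Y e, sup_close X Y e -> `|chi X - chi Y| <= L * e.
Proof.
have [C C0 HC] := energy_lip_global; have d0 : 0 < e1 - e0 by rewrite subr_gt0.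
have L0 : 0 <= C / (e1 - e0) by apply: divr_ge0 C0 (ltW d0).
exists (C / (e1 - e0)) => [|X Y e XY]; first exact: L0.
have e00 : 0 <= e by have [h _] := XY (Ordinal N0); exact: le_trans h.
have YX : sup_close Y X e by apply: sup_close_sym.
have chi0 Z : ~ tube Z -> chi Z = 0 by move=> nZ; rewrite /chi asboolF.
have [tX|nX] := pselect (tube X); have [tY|nY] := pselect (tube Y).
- rewrite /chi (asboolT tX) (asboolT tY); apply: (le_trans (clamp01_lip _ _)); rewrite -mulrBl normrM.
  rewrite (@gtr0_norm _ (e1 - e0)^-1) ?invr_gt0; last exact: d0.
  rewrite mulrAC ler_pM2r ?invr_gt0; last exact: d0.
  by rewrite distrC subrB_cancel; exact: (HC _ _ _ (tube_configs tX) (tube_configs tY) XY).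
- rewrite (chi0 Y nY) subr0 ger0_norm; last by have /andP[] := chi_itv X.
  exact: (chi_exit C0 HC tX nY XY).
- rewrite (chi0 X nX) sub0r normrN ger0_norm; last by have /andP[] := chi_itv Y.
  exact: (chi_exit C0 HC tY nX YX).
- by rewrite (chi0 X nX) (chi0 Y nY) subrr normr0; exact: mulr_ge0 L0 e00.
Qed.

(** [f] is controlled inside the tube only. If one point lies outside, [chi] vanishes there and is
    at most [L * e] at the other, where [f] is bounded by [M]. *)
Lemma chiM_lip L M Lf (f : config Om N -> R) : 0 <= M ->
  (forall X Y e, sup_close X Y e -> `|chi X - chi Y| <= L * e) ->
  (forall X, tube X -> `|f X| <= M) ->
  (forall X Y e, tube X -> tube Y -> sup_close X Y e -> `|f X - f Y| <= Lf * e) -> 0 <= Lf ->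
  forall X Y e, sup_close X Y e -> `|chi X * f X - chi Y * f Y| <= (M * L + Lf) * e.
Proof.
move=> M0' HL HM Hf Lf0.
have key X Y e : tube X -> sup_close X Y e -> `|chi X * f X - chi Y * f Y| <= (M * L + Lf) * e.
  move=> tX XY; have e00 : 0 <= e by have [h _] := XY (Ordinal N0); exact: le_trans h.
  rewrite mulrDl; have [tY|nY] := pselect (tube Y).
    rewrite mulrB_split.
    apply: le_trans (ler_normD _ _) _; apply: lerD; rewrite normrM.
      rewrite mulrC -mulrA; apply: ler_pM; [exact: normr_ge0..|exact: HM tX|exact: HL XY].
    apply: le_trans (Hf _ _ _ tX tY XY); apply: ler_piMl; first exact: normr_ge0.
    by have /andP[c0 c1] := chi_itv Y; rewrite (ger0_norm c0).
  have cY : chi Y = 0 by rewrite /chi (asboolF nY).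
  have := HL _ _ _ XY; rewrite cY mul0r !subr0 normrM => H.
  apply: (@le_trans _ _ (M * L * e)); last by rewrite lerDl; exact: mulr_ge0 Lf0 e00.
  by rewrite mulrC -mulrA; apply: ler_pM; [exact: normr_ge0..|exact: HM tX|exact: H].
move=> X Y e XY; have [tX|nX] := pselect (tube X); first exact: key.
have e00 : 0 <= e by have [h _] := XY (Ordinal N0); exact: le_trans h.
have YX : sup_close Y X e by apply: sup_close_sym.
have [tY|nY] := pselect (tube Y); first by rewrite distrC; exact: key.
have LL : 0 <= L * e by exact: le_trans (HL _ _ _ XY).
rewrite /chi (asboolF nX) (asboolF nY) !mul0r subrr normr0 mulrDl -mulrA.
by apply: addr_ge0; apply: mulr_ge0.
Qed.

End Cutoff.

Section CurveMeasurability.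
Variables (R : realType) (N : nat).

(** Scalar unknowns for the Picard iteration; [false] and [true] stand for the first and second
    coordinate, as in [coord]. *)
Definition config_of (x : 'I_N * bool -> R) : 'I_N -> R * R := fun i => (x (i, false), x (i, true)).

Lemma sup_lip_continuous (h : ('I_N -> R * R) -> R) L (x : R -> 'I_N * bool -> R) : 0 <= L ->
  (forall X Y e, sup_close X Y e -> `|h X - h Y| <= L * e) ->
  (forall i, continuous (x^~ i)) -> continuous (fun t => h (config_of (x t))).
Proof.
move=> L0 hL cx t; apply/cvgrPdist_le => e e0.
have d0 : 0 < e / (L + 1) by rewrite divr_gt0// ltr_wpDl.
have : \forall u \near t, forall i, `|x t i - x u i| <= e / (L + 1).
  apply: (filter_forall (nbhs_filter t)) => i.
  by move/cvgrPdist_le: (cx i t) => /(_ _ d0).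
apply: (filterS (Filter := nbhs_filter t)) => u Hu; apply: (@le_trans _ _ (L * (e / (L + 1)))).
  by apply: hL => i; split; exact: Hu.
by rewrite mulrCA ler_piMr// ?ltW// ltr_pdivrMr ?ltr_wpDl// mul1r ltrDl.
Qed.

End CurveMeasurability.

(** * Energy along curves *)

Lemma prod_le_bound (R : realType) (a b A B : R) : `|a| <= A -> `|b| <= B -> a * b <= A * B.
Proof. by move=> aA bB; rewrite (le_trans (ler_norm _))// normrM ler_pM. Qed.

Lemma normr_prod_sub (R : realType) (C eta V V' d d' : R) : `|V'| <= C -> `|d| <= C ->
  `|V' - V| <= eta -> `|d' - d| <= eta -> `|V' * d' - V * d| <= 2 * C * eta.
Proof.
move=> hV' hd hV hdd; rewrite (_ : _ - _ = V' * (d' - d) + d * (V' - V)); last by ring.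
rewrite (le_trans (ler_normD _ _))// !normrM (_ : 2 * C * eta = C * eta + C * eta); last by ring.
by apply: lerD; apply: ler_pM.
Qed.

(** Primed data belong to the left end of a short interval, unprimed ones to the differentiability
    time. Dropping [D ^+ 2], replacing [D] by [P * h] and [V' * d'] by [V * d] cost the three terms
    of the error. *)
Lemma coord_descent (R : realType) (C p eta h V V' d d' P D : R) : 0 <= h ->
  `|V'| <= C -> `|d| <= C -> `|d'| <= C -> `|P| <= p ->
  `|V' - V| <= eta -> `|d' - d| <= eta -> `|D - P * h| <= eta * h -> D ^+ 2 <= eta * h ->
  V' * (D ^+ 2 - 2 * (D * d')) <=
  - (2 * (V * (P * d)) * h) + (C + 2 * (C * C) + 4 * p * C) * eta * h.
Proof.
move=> h0 hV' hd hd' hP hV hdd hD hD2.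
have s1 : V' * D ^+ 2 <= C * (eta * h).
  by apply: prod_le_bound hV' _; rewrite ger0_norm// sqr_ge0.
have s2 : - (V' * d') * (D - P * h) <= C * C * (eta * h).
  by apply: prod_le_bound hD; rewrite normrN normrM ler_pM.
have s3 : - (P * h) * (V' * d' - V * d) <= p * h * (2 * C * eta).
  apply: prod_le_bound (normr_prod_sub hV' hd hV hdd).
  by rewrite normrN normrM (ger0_norm h0) ler_wpM2r.
move: s1 s2 s3; set u1 := V' * D ^+ 2.
rewrite (_ : V' * (D ^+ 2 - 2 * (D * d')) = u1 + 2 * (- (V' * d') * (D - P * h))
   + 2 * (- (P * h) * (V' * d' - V * d)) - (2 * (V * (P * d)) * h)); last by rewrite /u1; ring.
set u2 := - (V' * d') * _; set u3 := - (P * h) * _; set u4 := 2 * _ * h.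
rewrite (_ : (C + _ + _) * eta * h =
  C * (eta * h) + 2 * (C * C * (eta * h)) + 2 * (p * h * (2 * C * eta))); last by ring.
move=> s1 s2 s3; rewrite addrC lerD2l.
by apply: lerD; [apply: lerD|]; rewrite ?ler_pM2l.
Qed.

(* The feedback beats the transport: [m |d| - K m |d|^2 <= m / (4 K)]. *)
Lemma feedback_bound (R : realType) (C K m c V w1 w2 d1 d2 : R) : 0 < K -> 0 <= m ->
  0 <= c <= 1 -> 0 <= V <= C -> w1 ^+ 2 + w2 ^+ 2 <= m ^+ 2 ->
  - (2 * (V * (c * (w1 + K * m * d1) * d1 + c * (w2 + K * m * d2) * d2))) <= C / (2 * K) * m.
Proof.
move=> K0 m0 /andP[c0 c1] /andP[V0 VC] hw.
pose q := - (w1 * d1 + w2 * d2) - K * m * (d1 ^+ 2 + d2 ^+ 2).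
have hq : q <= m / (4 * K).
  rewrite ler_pdivlMr ?mulr_gt0//; have [m1|m1] := ltP 0 m; last first.
    have mz : m = 0 by apply/eqP; rewrite eq_le m1.
    have w12 : w1 ^+ 2 + w2 ^+ 2 <= 0 by rewrite (le_trans hw)// mz expr0n.
    have [w1z w2z] : w1 = 0 /\ w2 = 0.
      have a1 := sqr_ge0 w1; have a2 := sqr_ge0 w2.
      by split; apply/eqP; rewrite -sqrf_eq0 eq_le; apply/andP; split=> //; lra.
    by rewrite /q w1z w2z mz !mul0r mulr0 !mul0r addr0 oppr0 addr0 mul0r.
  rewrite -(ler_pM2l m1) -expr2; apply: le_trans hw; rewrite -subr_ge0.
  (* Completing the square after multiplication by [m], which is why [m = 0] was treated apart. *)
  rewrite (_ : _ - _ = (w1 + 2 * (K * m) * d1) ^+ 2 + (w2 + 2 * (K * m) * d2) ^+ 2).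
    by rewrite addr_ge0// sqr_ge0.
  by rewrite /q; ring.
have -> : - (2 * (V * (c * (w1 + K * m * d1) * d1 + c * (w2 + K * m * d2) * d2))) =
  2 * (V * c * q) by rewrite /q; ring.
have -> : C / (2 * K) * m = 2 * (C * (m / (4 * K))) by field; lra.
rewrite ler_pM2l//; have mK : 0 <= m / (4 * K) by rewrite divr_ge0// mulr_ge0// ltW.
have Vc0 : 0 <= V * c by exact: mulr_ge0.
apply: (@le_trans _ _ (V * c * (m / (4 * K)))); first by rewrite ler_wpM2l.
by rewrite ler_wpM2r// (le_trans _ VC)// ler_piMr.
Qed.

Lemma descent_arith (R : realType) (Eb Ea S B eta h c0 Ib Ia m e : R) :
  Eb - Ea <= S + B * eta * h -> S <= c0 * m * h ->
  - (c0 * (Ib - Ia - m * h)) <= c0 * (eta * h) -> (B + c0) * eta * h <= e * h ->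
  (Eb - c0 * Ib) - (Ea - c0 * Ia) <= e * h.
Proof. by move=> h1 h2 h3 h4; lra. Qed.

(** The derivative is known at [t] only, while the monotonicity criterion wants increments over
    intervals around [t]: the estimates on both sides of [t] are subtracted. *)
Lemma increment_bounds (R : realType) (p eta a t b ya yt yb P : R) : a <= t -> t <= b ->
  0 <= eta <= 1 -> `|P| <= p ->
  `|ya - yt - P * (a - t)| <= eta * `|a - t| -> `|yb - yt - P * (b - t)| <= eta * `|b - t| ->
  [/\ `|yb - ya - P * (b - a)| <= eta * (b - a), `|ya - yt| <= (p + 1) * (t - a) &
     `|ya - yb| <= (p + 1) * (b - a)].
Proof.
move=> at_ tb /andP[eta0 eta1] hP; rewrite (distrC a t) (@ger0_norm _ (t - a)) ?subr_ge0//.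
rewrite (@ger0_norm _ (b - t)) ?subr_ge0// => ha hb.
have ab : 0 <= b - a by rewrite subr_ge0 (le_trans at_).
have h1 : `|yb - ya - P * (b - a)| <= eta * (b - a).
  rewrite (_ : _ - _ = (yb - yt - P * (b - t)) - (ya - yt - P * (a - t))); last by ring.
  rewrite (le_trans (ler_normB _ _))// (_ : b - a = (b - t) + (t - a)); last by ring.
  by rewrite [leRHS]mulrDr; exact: lerD.
split=> //.
  rewrite (_ : ya - yt = (ya - yt - P * (a - t)) - P * (t - a)); last by ring.
  apply: (le_trans (ler_normB _ _)); rewrite addrC [leRHS]mulrDl mul1r normrM (@ger0_norm _ (t - a)) ?subr_ge0//.
  by apply: lerD; [rewrite ler_wpM2r ?subr_ge0|rewrite (le_trans ha)// ler_piMl ?subr_ge0].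
rewrite distrC (_ : yb - ya = (yb - ya - P * (b - a)) + P * (b - a)); last by ring.
apply: (le_trans (ler_normD _ _)); rewrite addrC [leRHS]mulrDl mul1r normrM (@ger0_norm _ (b - a))//.
by apply: lerD; [rewrite ler_wpM2r|rewrite (le_trans h1)// ler_piMl].
Qed.

Lemma sqr_le_small (R : realType) (D p h eta : R) : 0 <= h -> `|D| <= (p + 1) * h ->
  (p + 1) ^+ 2 * h <= eta -> D ^+ 2 <= eta * h.
Proof.
move=> h0 hD hh; apply: (@le_trans _ _ (((p + 1) * h) ^+ 2)).
  by rewrite -[D ^+ 2]ger0_norm ?sqr_ge0// normrX lerXn2r ?nnegrE// (le_trans _ hD).
by rewrite exprMn (expr2 h) mulrA ler_wpM2r.
Qed.

Lemma scale_choice (R : realType) (p C : R) : 0 <= p -> 0 <= C ->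
  exists2 q : R, 0 < q & [/\ p + 1 <= q, (p + 1) * C <= q & (p + 1) ^+ 2 <= q].
Proof.
move=> p0 C0; have a1 : 0 <= p * C by exact: mulr_ge0.
have a2 : 0 <= p * p by exact: mulr_ge0.
have a3 : 0 <= p * p * C by exact: mulr_ge0.
exists ((p + 1) ^+ 2 * (C + 1)); first by rewrite mulr_gt0// ?exprn_gt0// ltr_wpDl.
by split; rewrite !expr2 -subr_ge0; lra.
Qed.

Lemma eta_choice (R : realType) (e B : R) : 0 < e -> 0 <= B ->
  exists2 eta : R, 0 < eta <= 1 & B * eta <= e.
Proof.
move=> e0 B0; have B1 : 0 < B + 1 by rewrite ltr_wpDl.
exists (Num.min 1 (e / (B + 1))); first by rewrite lt_min ltr01 divr_gt0//= ge_min lexx.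
apply: (@le_trans _ _ ((B + 1) * (e / (B + 1)))); last by rewrite mulrC divfK// gt_eqF.
by apply: ler_pM => //; rewrite ?lerDl// ?ge_min ?lexx ?orbT// le_min ler01 divr_ge0// ltW.
Qed.

Lemma mulr_natr_sum1 (R : realType) (N : nat) (x : R) : N%:R * x = \sum_(i < N) x.
Proof. by rewrite sumr_const card_ord mulr_natl. Qed.

Lemma mulr_natr_sum (R : realType) (N : nat) (x y z : R) :
  N%:R * x * y * z = \sum_(i < N) x * y * z.
Proof. by rewrite -mulr_natr_sum1 !mulrA. Qed.

Section Descent.
Variables (R : realType) (N : nat).
Notation config := ('I_N -> R * R).
Notation mu := (@lebesgue_measure R).
Variables (E : config -> R) (V : config -> 'I_N -> R) (d : config -> 'I_N -> R * R).
Variables (W : config -> Prop) (C CE : R).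
Hypothesis C0 : 0 <= C.
Hypothesis CE0 : 0 <= CE.
Hypothesis hreg : forall X, W X ->
  (forall i, [/\ 0 < V X i, V X i <= C, `|(d X i).1| <= C & `|(d X i).2| <= C]) /\
  forall Y e, W Y -> sup_close X Y e -> e <= 1 ->
    (forall i, [/\ `|V X i - V Y i| <= C * e, `|(d X i).1 - (d Y i).1| <= C * e &
       `|(d X i).2 - (d Y i).2| <= C * e]) /\
    E Y <= E X + \sum_i V X i * (sqd (Y i) (X i) -
      2 * (((Y i).1 - (X i).1) * (d X i).1 + ((Y i).2 - (X i).2) * (d X i).2)).
Hypothesis hlip : forall X Y e, W X -> W Y -> sup_close X Y e -> `|E X - E Y| <= CE * e.

(** The one-sided energy bound is applied from [A] to [B]; its coefficients are then compared with
    those at [X], where the velocity [P] is known. *)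
Lemma energy_increment X A B P (p eta h e : R) : W X -> W A -> W B -> 0 <= h -> 0 <= p ->
  (forall i, `|(P i).1| <= p /\ `|(P i).2| <= p) ->
  sup_close A X e -> e <= 1 -> C * e <= eta -> sup_close A B ((p + 1) * h) -> (p + 1) * h <= 1 ->
  (p + 1) ^+ 2 * h <= eta ->
  (forall i, `|(B i).1 - (A i).1 - (P i).1 * h| <= eta * h /\
     `|(B i).2 - (A i).2 - (P i).2 * h| <= eta * h) ->
  E B - E A <= (\sum_i - (2 * (V X i * ((P i).1 * (d X i).1 + (P i).2 * (d X i).2)))) * h +
     N%:R * (2 * (C + 2 * (C * C) + 4 * p * C)) * eta * h.
Proof.
move=> WX WA WB h0 p0 hP AX e1 Ceta AB AB1 hh hD.
have [bA HA] := hreg WA; have [bX _] := hreg WX.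
have [_ EAB] := HA _ _ WB AB AB1; have [lAX _] := HA _ _ WX AX e1.
rewrite lerBlDl; apply: (le_trans EAB); rewrite lerD2l.
rewrite mulr_natr_sum mulr_suml -big_split/=; apply: ler_sum => i _.
have [V0 VC d1C d2C] := bA i; have [V0X VCX d1X d2X] := bX i.
have [lV l1 l2] := lAX i; have [P1 P2] := hP i; have [D1 D2] := hD i.
have {}lV := le_trans lV Ceta; have {}l1 := le_trans l1 Ceta; have {}l2 := le_trans l2 Ceta.
have VA : `|V A i| <= C by rewrite gtr0_norm.
have [c1 c2] := AB i; rewrite distrC in c1; rewrite distrC in c2.
have := lerD (coord_descent h0 VA d1X d1C P1 lV l1 D1 (sqr_le_small h0 c1 hh))
  (coord_descent h0 VA d2X d2C P2 lV l2 D2 (sqr_le_small h0 c2 hh)).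
rewrite /sqd; congr (_ <= _); ring.
Qed.

Variables (T K : R) (m : R -> R) (Y : R -> config).
Hypothesis T0 : 0 <= T.
Hypothesis K0 : 0 < K.
Hypothesis im : mu.-integrable setT (EFin \o m).
Hypothesis m0 : forall t, 0 <= m t.
Hypothesis WY : forall t, 0 <= t <= T -> W (Y t).
Hypothesis acY : forall i, ac_increments T (fun a b => `|(Y b i).1 - (Y a i).1|) /\
  ac_increments T (fun a b => `|(Y b i).2 - (Y a i).2|).

Let c0 := N%:R * (C / (2 * K)).

Let c0_ge0 : 0 <= c0.
Proof. by rewrite mulr_ge0// divr_ge0// mulr_ge0// ltW. Qed.

Lemma ac_energy : ac_increments T (fun a b => `|E (Y b) - E (Y a)|).
Proof.
have ac i := ac_incrementsD (proj1 (acY i)) (proj2 (acY i)).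
apply: (ac_increments_le CE0 _ (ac_increments_sum ac)) => a b /andP[a0 ab] bT.
apply: hlip; [by apply: WY; rewrite (le_trans a0)|by apply: WY; rewrite a0 (le_trans ab)|].
move=> i; have hb : `|(Y b i).1 - (Y a i).1| + `|(Y b i).2 - (Y a i).2| <=
    \sum_i (`|(Y b i).1 - (Y a i).1| + `|(Y b i).2 - (Y a i).2|).
  by rewrite [leRHS](bigD1 i)//= lerDl sumr_ge0// => j _; rewrite addr_ge0.
by split; apply: le_trans hb; rewrite ?lerDl ?lerDr.
Qed.

(** [E (Y t) - c0 * Iint m t] satisfies the hypotheses of [ac_nonincreasing], with one share
    [C / (2 * K)] of [c0] per generator from [feedback_bound]. The factor [c] covers the cut-off
    curve and, with [c = 1], a genuine solution. *)
Lemma energy_descent :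
  {ae mu, forall t : R, 0 < t < T -> exists c w, 0 <= c <= 1 /\ forall i : 'I_N,
    [/\ (w i).1 ^+ 2 + (w i).2 ^+ 2 <= m t ^+ 2,
        is_derive t (1 : R) (fun s => (Y s i).1) (c * ((w i).1 + K * m t * (d (Y t) i).1)) &
        is_derive t (1 : R) (fun s => (Y s i).2) (c * ((w i).2 + K * m t * (d (Y t) i).2))]} ->
  E (Y T) <= E (Y 0) + c0 * (Iint m T - Iint m 0).
Proof.
move=> hder.
have acf : ac_increments T (fun a b => `|(E (Y b) - c0 * Iint m b) - (E (Y a) - c0 * Iint m a)|).
  have := ac_incrementsD ac_energy (Iint_ac T (intbleZ c0 im)).
  apply: (ac_increments_le ler01) => a b _ _; rewrite mul1r !IintZ//.
  rewrite (_ : _ - _ - _ = (E (Y b) - E (Y a)) - (c0 * Iint m b - c0 * Iint m a)); last by ring.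
  exact: ler_normB.
have := ac_nonincreasing T0 acf.
suff H : {ae mu, forall t : R, 0 < t < T -> forall e : R, 0 < e -> exists2 g : R, 0 < g &
    forall a b, 0 <= a <= t -> t <= b <= T -> t - a < g -> b - t < g ->
    (E (Y b) - c0 * Iint m b) - (E (Y a) - c0 * Iint m a) <= e * (b - a)}.
  by move=> /(_ H); rewrite mulrBr; lra.
have dI := Iint_derive im.
move: hder dI; apply: filterS2; first exact: (ae_filter_ringOfSetsType mu).
move=> t hder dI tT e e0.
have [c [w [c01 Hw]]] := hder tT.
pose P i : R * R := (c * ((w i).1 + K * m t * (d (Y t) i).1), c * ((w i).2 + K * m t * (d (Y t) i).2)).
pose p := \sum_i (`|(P i).1| + `|(P i).2|).
have p0 : 0 <= p by apply: sumr_ge0 => i _; exact: addr_ge0.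
have hp i : `|(P i).1| <= p /\ `|(P i).2| <= p.
  have hb : `|(P i).1| + `|(P i).2| <= p.
    by rewrite /p [leRHS](bigD1 i)//= lerDl sumr_ge0// => j _; rewrite addr_ge0.
  by split; apply: le_trans hb; rewrite ?lerDl ?lerDr.
pose B := N%:R * (2 * (C + 2 * (C * C) + 4 * p * C)).
have B0 : 0 <= B by rewrite !mulr_ge0// !addr_ge0// !mulr_ge0.
(* [B] weighs the error of the energy increment, [c0] that of the increment of [Iint m]. *)
have [eta /andP[eta0 eta1] Heta] := eta_choice e0 (addr_ge0 B0 c0_ge0).
have [q q0 [q1 q2 q3]] := scale_choice p0 C0.
have Hd (ib : 'I_N * bool) : exists g : R, 0 < g /\ forall y, `|y - t| < g ->
   let f s := if ib.2 then (Y s ib.1).2 else (Y s ib.1).1 in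
   `|f y - f t - (if ib.2 then (P ib.1).2 else (P ib.1).1) * (y - t)| <= eta * `|y - t|.
  have [_ d1 d2] := Hw ib.1; case: ib d1 d2 => i [] /= d1 d2.
    by have [g g0 Hg] := is_derive_linear_bound d2 eta0; exists g.
  by have [g g0 Hg] := is_derive_linear_bound d1 eta0; exists g.
have [g1 g10 Hg1] := finType_pos_lb (fun ib => proj1 (svalP (cid (Hd ib)))).
have [g2 g20 Hg2] := is_derive_linear_bound dI eta0.
(* As [a] and [b] lie within [g] of [t], the length [b - a] is below [eta / q]. *)
pose g := Num.min (Num.min g1 g2) (eta / q / 2).
have g0 : 0 < g by rewrite !lt_min g10 g20 !divr_gt0.
exists g => // a b /andP[a0 at_] /andP[tb bT] ag bg.
have ab : a <= b by exact: le_trans tb.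
have h0 : 0 <= b - a by rewrite subr_ge0.
have na : `|a - t| < g by rewrite distrC ger0_norm ?subr_ge0.
have nb : `|b - t| < g by rewrite ger0_norm ?subr_ge0.
have hq : q * (b - a) <= eta.
  have gq : g <= eta / q / 2 by rewrite /g ge_min lexx orbT.
  by rewrite mulrC -ler_pdivlMr//; lra.
have eta01 : 0 <= eta <= 1 by rewrite ltW.
have inc i : [/\ `|(Y b i).1 - (Y a i).1 - (P i).1 * (b - a)| <= eta * (b - a),
     `|(Y a i).1 - (Y t i).1| <= (p + 1) * (t - a) & `|(Y a i).1 - (Y b i).1| <= (p + 1) * (b - a)] /\
   [/\ `|(Y b i).2 - (Y a i).2 - (P i).2 * (b - a)| <= eta * (b - a),
     `|(Y a i).2 - (Y t i).2| <= (p + 1) * (t - a) & `|(Y a i).2 - (Y b i).2| <= (p + 1) * (b - a)].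
  have key bo y : `|y - t| < g -> let f s := if bo then (Y s i).2 else (Y s i).1 in
   `|f y - f t - (if bo then (P i).2 else (P i).1) * (y - t)| <= eta * `|y - t|.
    move=> yg; apply: (proj2 (svalP (cid (Hd (i, bo))))).
    by apply: (lt_le_trans yg); apply: le_trans (Hg1 (i, bo)); rewrite /g !ge_min lexx.
  have [hp1 hp2] := hp i.
  split; apply: increment_bounds => //.
  - exact: (key false).
  - exact: (key false).
  - exact: (key true).
  - exact: (key true).
have p1 : 0 <= p + 1 by rewrite addr_ge0.
have [c1 c2 c3] : [/\ (p + 1) * (b - a) <= eta, (p + 1) * C * (b - a) <= eta & (p + 1) ^+ 2 * (b - a) <= eta].
  by split; apply: le_trans hq; apply: ler_wpM2r.
have ta : (p + 1) * (t - a) <= (p + 1) * (b - a) by rewrite ler_wpM2l// lerD2r.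
have Ceta : C * ((p + 1) * (t - a)) <= eta.
  by rewrite (le_trans _ c2)// (mulrC (p + 1) C) -mulrA ler_wpM2l.
have WA : W (Y a) by apply: WY; rewrite a0 (le_trans ab).
have WB : W (Y b) by apply: WY; rewrite (le_trans a0).
have WT : W (Y t) by apply: WY; rewrite (le_trans a0)//= (le_trans tb).
have := @energy_increment (Y t) (Y a) (Y b) P p eta (b - a) ((p + 1) * (t - a)) WT WA WB h0 p0 hp _ _ Ceta _ _ c3 _.
have S1 : sup_close (Y a) (Y t) ((p + 1) * (t - a)) by move=> i; have [[_ ? _] [_ ? _]] := inc i.
have S2 : sup_close (Y a) (Y b) ((p + 1) * (b - a)) by move=> i; have [[_ _ ?] [_ _ ?]] := inc i.
have S3 i : `|(Y b i).1 - (Y a i).1 - (P i).1 * (b - a)| <= eta * (b - a) /\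
     `|(Y b i).2 - (Y a i).2 - (P i).2 * (b - a)| <= eta * (b - a).
  by have [[? _ _] [? _ _]] := inc i.
move=> /(_ S1 (le_trans ta (le_trans c1 eta1)) S2 (le_trans c1 eta1) S3) EB.
have Sm : \sum_i - (2 * (V (Y t) i * ((P i).1 * (d (Y t) i).1 + (P i).2 * (d (Y t) i).2))) <= c0 * m t.
  rewrite /c0 -[N%:R * _ * _]mulrA mulr_natr_sum1; apply: ler_sum => i _.
  have [bX _] := hreg WT; have [V0 VC _ _] := bX i; have [hw _ _] := Hw i.
  by apply: feedback_bound => //; rewrite ltW.
have Ia : `|Iint m b - Iint m a - m t * (b - a)| <= eta * (b - a).
  have gg y : `|y - t| < g -> `|y - t| < g2.
    by move=> yg; apply: (lt_le_trans yg); rewrite /g !ge_min lexx !orbT.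
  have hm0 : `|m t| <= m t by rewrite ger0_norm.
  by have [] := increment_bounds at_ tb eta01 hm0 (Hg2 _ (gg _ na)) (Hg2 _ (gg _ nb)).
have s1 := ler_wpM2r h0 Sm.
have s2 : - (c0 * (Iint m b - Iint m a - m t * (b - a))) <= c0 * (eta * (b - a)).
  apply: (le_trans (ler_norm _)); rewrite normrN normrM (ger0_norm c0_ge0).
  exact: ler_wpM2l.
have s3 := ler_wpM2r h0 Heta.
move: EB s1 s2 s3; rewrite -/B; set S := (\sum_i _) * (b - a).
exact: descent_arith.
Qed.

End Descent.

(** * The cut-off system *)

Definition coord (R : realType) (b : bool) (p : R * R) : R := if b then p.2 else p.1.

Section CutoffField.
Variables (R : realType) (N : nat).
Notation config := ('I_N -> R * R).
Notation mu := (@lebesgue_measure R).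
Notation intble h := (mu.-integrable setT (EFin \o h)).
Variables (W : config -> Prop) (chi : config -> R) (d : config -> 'I_N -> R * R).
Variables (v : R -> R * R -> R * R) (G : set (measurableTypeR R)) (m : R -> R) (L C K T : R).
Hypotheses (L0 : 0 <= L) (C0 : 0 <= C) (K0 : 0 <= K).
Hypothesis chi01 : forall X, 0 <= chi X <= 1.
Hypothesis chi_in : forall X, chi X != 0 -> W X.
Hypothesis chiM : forall (M Lf : R) (f : config -> R), 0 <= M -> 0 <= Lf ->
  (forall X, W X -> `|f X| <= M) ->
  (forall X Y e, W X -> W Y -> sup_close X Y e -> `|f X - f Y| <= Lf * e) ->
  forall X Y e, sup_close X Y e -> `|chi X * f X - chi Y * f Y| <= (M * L + Lf) * e.
Hypothesis d_bd : forall X i b, W X -> `|coord b (d X i)| <= C.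
Hypothesis d_lip : forall X Y e i b, W X -> W Y -> sup_close X Y e ->
  `|coord b (d X i) - coord b (d Y i)| <= 2 * C * e.
Hypothesis mG : measurable G.
Hypothesis GT : G `<=` `]0, T[.
Hypothesis GT_ae : {ae mu, forall t : R, 0 < t < T -> G t}.
Hypothesis m0 : forall t, 0 <= m t.
Hypothesis mG0 : forall t, ~ G t -> m t = 0.
Hypothesis im : intble m.
Hypothesis v_bd : forall t X i b, G t -> W X -> `|coord b (v t (X i))| <= m t.
Hypothesis v_lip : forall t X Y e i b, G t -> W X -> W Y -> sup_close X Y e ->
  `|coord b (v t (X i)) - coord b (v t (Y i))| <= 2 * m t * e.
Hypothesis v_meas : forall (x : R -> 'I_N * bool -> R) i b, (forall ib, continuous (x^~ ib)) ->
  measurable_fun G (fun t => chi (config_of (x t)) * coord b (v t (config_of (x t) i))).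

Let drift t X (ib : 'I_N * bool) : R :=
  coord ib.2 (v t (X ib.1)) + K * m t * coord ib.2 (d X ib.1).

Let field t (x : 'I_N * bool -> R) ib : R :=
  if t \in G then chi (config_of x) * drift t (config_of x) ib else 0.

(** The drift is bounded by [(1 + K * C) * m t] with Lipschitz constant twice that; the product rule
    for [chi] then gives exactly this constant, which also bounds the field. *)
Let lam t : R := (1 + K * C) * (L + 2) * m t.

Let lam_ge0 t : 0 <= lam t.
Proof. by rewrite !mulr_ge0// addr_ge0// mulr_ge0. Qed.

Let ilam : intble lam.
Proof. exact: intbleZ. Qed.

Let lam0 t : t <= 0 -> lam t = 0.
Proof.
move=> t0; rewrite /lam mG0 ?mulr0// => /GT/=; rewrite in_itv/= => /andP[].
by rewrite ltNge t0.
Qed.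

Let drift_bd t X ib : G t -> W X -> `|drift t X ib| <= (1 + K * C) * m t.
Proof.
move=> Gt WX; rewrite (le_trans (ler_normD _ _))// mulrDl mul1r lerD ?v_bd//.
by rewrite normrM ger0_norm ?mulr_ge0// mulrAC ler_wpM2r// ler_wpM2l// d_bd.
Qed.

Let drift_lip t X Y e ib : G t -> W X -> W Y -> sup_close X Y e ->
  `|drift t X ib - drift t Y ib| <= (1 + K * C) * 2 * m t * e.
Proof.
move=> Gt WX WY XY; rewrite /drift.
have -> : coord ib.2 (v t (X ib.1)) + K * m t * coord ib.2 (d X ib.1) -
  (coord ib.2 (v t (Y ib.1)) + K * m t * coord ib.2 (d Y ib.1)) =
  (coord ib.2 (v t (X ib.1)) - coord ib.2 (v t (Y ib.1))) +
  K * m t * (coord ib.2 (d X ib.1) - coord ib.2 (d Y ib.1)) by ring.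
rewrite (le_trans (ler_normD _ _))//.
have -> : (1 + K * C) * 2 * m t * e = 2 * m t * e + K * m t * (2 * C * e) by ring.
apply: lerD; first exact: v_lip.
by rewrite normrM ger0_norm ?mulr_ge0// ler_wpM2l ?mulr_ge0// d_lip.
Qed.

Let sup_close_of (x y : 'I_N * bool -> R) e : (forall ib, `|x ib - y ib| <= e) -> sup_close (config_of x) (config_of y) e.
Proof. by move=> h i; split; exact: h. Qed.

Let field_lip t x y e : (forall ib, `|x ib - y ib| <= e) ->
  forall ib, `|field t x ib - field t y ib| <= lam t * e.
Proof.
move=> /sup_close_of xy ib; rewrite /field; case: ifPn => Gt; last first.
  have e0 : 0 <= e by have [h _] := xy ib.1; exact: le_trans h.
  by rewrite subrr normr0 mulr_ge0.
have {}Gt : G t by rewrite inE in Gt.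
have KC : 0 <= 1 + K * C by rewrite addr_ge0// mulr_ge0.
have := @chiM ((1 + K * C) * m t) ((1 + K * C) * 2 * m t) (fun X => drift t X ib) _ _ _ _ _ _ _ xy.
rewrite (_ : (1 + K * C) * m t * L + (1 + K * C) * 2 * m t = lam t); last by rewrite /lam; ring.
apply; [exact: mulr_ge0|by rewrite !mulr_ge0|by move=> X; exact: drift_bd|].
by move=> X Y e'; exact: drift_lip.
Qed.

Let field_bd t x ib : `|field t x ib| <= lam t.
Proof.
rewrite /field; case: ifPn => Gt; last by rewrite normr0.
have {}Gt : G t by rewrite inE in Gt.
have KC : 0 <= 1 + K * C by rewrite addr_ge0// mulr_ge0.
have [->|c0] := eqVneq (chi (config_of x)) 0; first by rewrite mul0r normr0.
have /andP[chi0 chi1] := chi01 (config_of x).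
rewrite normrM (ger0_norm chi0); have := drift_bd ib Gt (chi_in c0) => h.
apply: (@le_trans _ _ `|drift t (config_of x) ib|); first by rewrite ler_piMl.
apply: (le_trans h); rewrite /lam mulrAC ler_peMr ?mulr_ge0//.
by move: L0; lra.
Qed.

Let field_meas x : (forall jb, continuous (x^~ jb)) -> forall ib,
  measurable_fun setT (fun t => field t (x t) ib).
Proof.
move=> cx ib; rewrite /field.
have preG : (fun t => t \in G) @^-1` [set true] = G.
  by apply/seteqP; split=> t /=; [move/set_mem|move/mem_set].
apply: measurable_fun_if => //.
- by apply: (measurable_fun_bool true); rewrite setTI preG.
- rewrite setTI preG.
  rewrite /drift.
  (* The cutoff is distributed because [v] and [d] are controlled on [W] only; each product with
     [chi] is regular everywhere. *)
  have -> : (fun t => chi (config_of (x t)) * (coord ib.2 (v t (config_of (x t) ib.1)) +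
      K * m t * coord ib.2 (d (config_of (x t)) ib.1))) =
    (fun t => chi (config_of (x t)) * coord ib.2 (v t (config_of (x t) ib.1)) +
      K * m t * (chi (config_of (x t)) * coord ib.2 (d (config_of (x t)) ib.1))).
    by apply/funext => t; ring.
  apply: measurable_funD; first exact: v_meas.
  apply: measurable_funM.
    apply: measurable_funM; first exact: measurable_cst.
    by apply: measurable_funTS; apply/measurable_EFinP; exact: measurable_int im.
  apply: measurable_funTS; apply: continuous_measurable_fun.
  have C2 : 0 <= 2 * C by exact: mulr_ge0.
  apply: (@sup_lip_continuous R N (fun X => chi X * coord ib.2 (d X ib.1)) (C * L + 2 * C)) => //.
    by rewrite addr_ge0// mulr_ge0.
  by apply: chiM => // [X WX|X Y e WX WY]; [exact: d_bd|exact: d_lip].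
Qed.

Let field_intble x ib : (forall jb, continuous (x^~ jb)) -> intble (fun t => field t (x t) ib).
Proof.
move=> cx; apply: (@le_integrable _ _ _ mu _ _ _ (EFin \o lam)) => //.
  by apply/measurable_EFinP; exact: field_meas.
by move=> t _ /=; rewrite lee_fin (ger0_norm (lam_ge0 t)).
Qed.

Variable X0 : config.

Definition cutoff_curve (Y : R -> config) : Prop := [/\ Y 0 = X0,
  forall i, ac_increments T (fun a b => `|(Y b i).1 - (Y a i).1|) /\
    ac_increments T (fun a b => `|(Y b i).2 - (Y a i).2|) &
  {ae mu, forall t : R, 0 < t < T -> forall i b, is_derive t (1 : R) (fun s => coord b (Y s i))
     (chi (Y t) * (coord b (v t (Y t i)) + K * m t * coord b (d (Y t) i)))}].

Lemma cutoff_exists : exists Y, cutoff_curve Y.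
Proof.
pose x0 (ib : 'I_N * bool) := coord ib.2 (X0 ib.1).
have [x [cx ex]] := caratheodory_exists ilam lam_ge0 lam0 x0 field_lip field_bd field_meas.
have fE ib : (x^~ ib) = (fun t => x0 ib + Iint (fun s => field s (x s) ib) t).
  by apply/funext => t; exact: ex.
have ac ib : ac_increments T (fun a b => `|x b ib - x a ib|).
  apply: (ac_increments_le ler01 _ (Iint_ac T (field_intble ib cx))) => a b _ _.
  by rewrite mul1r !ex opprD addrACA subrr add0r.
exists (fun t => config_of (x t)); split=> [|i|]; last 1 first.
- have H : {ae mu, forall t : R, forall ib, is_derive t (1 : R) (x^~ ib) (field t (x t) ib)}.
    apply: (filter_forall (ae_filter_ringOfSetsType mu)) => ib.
    have := Iint_derive (field_intble ib cx).
    apply: filterS; first exact: (ae_filter_ringOfSetsType mu).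
    by move=> t dt; rewrite fE -[field _ _ _]add0r; apply: is_deriveD.
  move: H GT_ae; apply: filterS2; first exact: (ae_filter_ringOfSetsType mu).
  move=> t dt Gt tT i b; have := dt (i, b); rewrite /field ifT; last by rewrite inE; exact: Gt.
  by case: b.
- have I0 ib : Iint (fun s => field s (x s) ib) 0 = 0.
    by apply: Iint_eq0 => s s0; apply/eqP; rewrite -normr_le0 -(lam0 s0).
  by apply/funext => i; rewrite /config_of !ex !I0 !addr0 /x0 /coord/=; case: (X0 i).
- by split; exact: ac.
Qed.

(** Extends a curve on [[0, T]] by constants, since the uniqueness lemma speaks of curves on the
    whole line. *)
Let clamp (t : R) : R := Num.max 0 (Num.min T t).

Hypothesis T0 : 0 < T.

Let clamp_in t : 0 <= clamp t <= T.
Proof. by rewrite le_max lexx/= ge_max (ltW T0) ge_min lexx. Qed.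

Let clampE t : 0 <= t <= T -> clamp t = t.
Proof. by move=> /andP[t0 tT]; rewrite /clamp min_r// max_r. Qed.

Let clamp_lip s t : `|clamp s - clamp t| <= `|s - t|.
Proof.
wlog st : s t / t <= s.
  move=> H; have [|/ltW] := leP t s; first exact: H.
  by rewrite distrC (distrC s); exact: H.
have cl u : clamp u = if u <= 0 then 0 else if u <= T then u else T.
  rewrite /clamp; case: (leP u 0) => [u0|u0].
    by rewrite min_r ?max_l// (le_trans u0)// ltW.
  case: (leP u T) => uT; first by rewrite max_r// ltW.
  by rewrite max_r// ltW.
rewrite [leRHS]ger0_norm ?subr_ge0// ler_norml !cl.
by case: (leP s 0) => ?; case: (leP t 0) => ?; case: (leP s T) => ?; case: (leP t T) => ?;
  apply/andP; split; move: T0; lra.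
Qed.

Let flat (Y : R -> config) t (ib : 'I_N * bool) : R := coord ib.2 (Y (clamp t) ib.1).

Let flatE Y t : config_of (flat Y t) = Y (clamp t).
Proof. by apply/funext => i; rewrite /config_of /flat /=; case: (Y _ i). Qed.

Let cutoff_ac Y i b : cutoff_curve Y ->
  ac_increments T (fun s t => `|coord b (Y t i) - coord b (Y s i)|).
Proof. by move=> [_ /(_ i)[h1 h2] _]; case: b. Qed.

Let flat_continuous Y ib : cutoff_curve Y -> continuous ((flat Y)^~ ib).
Proof.
move=> cY t; apply/cvgrPdist_lt => e e0.
have [g g0 Hg] := ac_increments_continuous (clamp_in t) (cutoff_ac ib.1 ib.2 cY) e0.
apply/nbhs_ballP; exists g => // s; rewrite /ball/= => st; rewrite distrC; apply: Hg => //.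
by apply: le_lt_trans (clamp_lip _ _) _; rewrite distrC.
Qed.

Let flat_integral Y : cutoff_curve Y -> forall t ib,
  flat Y t ib = coord ib.2 (X0 ib.1) + Iint (fun s => field s (flat Y s) ib) t.
Proof.
move=> cY t ib; have cf jb := @flat_continuous Y jb cY; have ih := @field_intble (flat Y) ib cf.
have [Y0 _ dY] := cY; pose h s := field s (flat Y s) ib.
have Ineg u : u <= 0 -> Iint h u = 0.
  move=> u0; apply: Iint_eq0 => s su; apply/eqP; rewrite -normr_le0 -(lam0 (le_trans su u0)).
  exact: field_bd.
have ftc u : 0 <= u <= T -> coord ib.2 (Y u ib.1) - coord ib.2 (Y 0 ib.1) = Iint h u.
  move=> uT; rewrite (@ac_FTC R T (fun s => coord ib.2 (Y s ib.1)) h ih (cutoff_ac ib.1 ib.2 cY) _ u uT).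
    by rewrite (Ineg 0)// subr0.
  move: dY GT_ae; apply: filterS2; first exact: (ae_filter_ringOfSetsType mu).
  move=> s ds Gs sT; have := ds sT ib.1 ib.2; rewrite /h /field ifT; last by rewrite inE; exact: Gs.
  by rewrite flatE clampE//; case/andP: sT => s0 sT; rewrite !ltW.
(* The field vanishes off []0, T[], so the integral is constant there, as is the extended curve. *)
have Iclamp : Iint h t = Iint h (clamp t).
  have [t0|t0] := leP t 0.
    by rewrite !Ineg// /clamp min_r ?max_l// (le_trans t0)// ltW.
  have [tT|tT] := leP t T; first by rewrite clampE// ltW.
  rewrite /clamp min_l ?ltW// max_r ?ltW//; apply/eqP; rewrite -subr_eq0 IintB ?ltW//.
  rewrite (@eq_Rintegral _ _ _ _ _ (fun=> 0)) ?Rintegral_cst ?mul0r// => s.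
  rewrite inE/= in_itv/= => /andP[Ts _]; rewrite /h /field ifF//; apply/negP; rewrite inE => /GT/=.
  by rewrite in_itv/= => /andP[_]; rewrite ltNge (ltW Ts).
by rewrite Iclamp -(ftc _ (clamp_in t)) Y0 addrC subrK.
Qed.

Lemma cutoff_unique Y Z : cutoff_curve Y -> cutoff_curve Z ->
  forall t, 0 <= t <= T -> Y t = Z t.
Proof.
move=> cY cZ t tT.
have E := caratheodory_unique ilam lam_ge0 lam0 field_lip field_bd field_meas
  (fun ib => @flat_continuous Y ib cY) (fun ib => @flat_continuous Z ib cZ)
  (flat_integral cY) (flat_integral cZ) t.
by rewrite -(clampE tT) -!flatE; congr config_of; apply/funext => ib; exact: E.
Qed.

End CutoffField.

Lemma fraction_lt (R : realType) (n e : R) : 0 <= n -> 0 < e -> n * (2 * (e / (2 * n + 1))) < e.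
Proof.
move=> n0 e0; have q : 0 < 2 * n + 1 by rewrite ltr_wpDl// mulr_ge0.
rewrite (_ : n * _ = e * (2 * n) / (2 * n + 1)); last by field; lra.
by rewrite ltr_pdivrMr// ltr_pM2l// ltrDl.
Qed.

(** * Invariance of the tube *)

Section Invariance.
Variables (R : realType) (Om : domain R) (N : nat) (r : R).
Variable rd : lattice_reduction Om.
Hypothesis aOm : admissible Om.
Hypothesis N0 : (0 < N)%N.
Hypothesis M0 : minimizers Om N !=set0.
Hypothesis inside : closure (tube Om N r) `<=` configs Om N.
Notation mu := (@lebesgue_measure R).
Notation intble h := (mu.-integrable setT (EFin \o h)).
Notation tube := (tube Om N r).
Variables (C T K : R) (m : R -> R) (e0 e1 : R) (Y : R -> config Om N).
Hypothesis C0 : 0 <= C.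
Hypothesis regular : regular_on (closure tube) C.
Hypothesis K0 : 0 < K.
Hypothesis im : intble m.
Hypothesis m0 : forall t, 0 <= m t.
Hypothesis e01 : e0 < e1.
Hypothesis e1_gap : ((e1 - min_energy Om N)%:E <= energy_gap Om N r)%E.
Hypothesis acY : forall i, ac_increments T (fun a b => `|(Y b i).1 - (Y a i).1|) /\
  ac_increments T (fun a b => `|(Y b i).2 - (Y a i).2|).

Lemma ac_cdist_continuous : cdist_continuous T Y.
Proof.
move=> t tT e eps0.
have q0 : 0 < e / (2 * N%:R + 1) by rewrite divr_gt0// ltr_wpDl// mulr_ge0.
have H (ib : 'I_N * bool) : exists g : R, 0 < g /\ forall u, 0 <= u <= T -> `|u - t| < g ->
    `|coord ib.2 (Y u ib.1) - coord ib.2 (Y t ib.1)| < e / (2 * N%:R + 1).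
  have [h1 h2] := acY ib.1; case: ib h1 h2 => i [] /= h1 h2.
    by have [g g0 Hg] := ac_increments_continuous tT h2 q0; exists g.
  by have [g g0 Hg] := ac_increments_continuous tT h1 q0; exists g.
have [g g0 Hg] := finType_pos_lb (fun ib => proj1 (svalP (cid (H ib)))).
exists g; first exact: g0.
move=> u uT ut; apply: (@le_lt_trans _ _ (N%:R * (2 * (e / (2 * N%:R + 1))))).
  apply: cdist_sup_close; first exact: ltW.
  have close i b : `|coord b (Y t i) - coord b (Y u i)| <= e / (2 * N%:R + 1).
    rewrite distrC ltW//; apply: (proj2 (svalP (cid (H (i, b)))) u uT).
    exact: lt_le_trans ut (Hg (i, b)).
  by move=> i; split; [exact: (close i false)|exact: (close i true)].
exact: fraction_lt.
Qed.

Hypothesis Y0 : tube (Y 0).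
Hypothesis budget : energy (Y 0) + N%:R * (C / (2 * K)) * (Iint m T - Iint m 0) <= e0.
Hypothesis dY : {ae mu, forall t : R, 0 < t < T -> tube (Y t) -> exists c w, 0 <= c <= 1 /\
  forall i : 'I_N, [/\ (w i).1 ^+ 2 + (w i).2 ^+ 2 <= m t ^+ 2,
    is_derive t (1 : R) (fun s => (Y s i).1) (c * ((w i).1 + K * m t * (displacement (Y t) i).1)) &
    is_derive t (1 : R) (fun s => (Y s i).2) (c * ((w i).2 + K * m t * (displacement (Y t) i).2))]}.

(** Stated up to a time at which the curve may be just leaving, which is possible because regularity
    holds on the closed tube; the budget covers the full time span. *)
Let energy_le t : 0 <= t <= T -> (forall u, 0 <= u < t -> tube (Y u)) -> closure tube (Y t) ->
  energy (Y t) <= e0.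
Proof.
move=> /andP[t0 tT] before ct; apply: le_trans budget.
have [CE CE0 hlip] := energy_lip_global rd N0.
have hlip' X X' e : closure tube X -> closure tube X' -> sup_close X X' e ->
    `|energy X - energy X'| <= CE * e by move=> /inside cX /inside cX'; exact: hlip.
have WY u : 0 <= u <= t -> closure tube (Y u).
  move=> /andP[u0]; rewrite le_eqVlt => /orP[/eqP ->//|ut].
  by apply: subset_closure; apply: before; rewrite u0.
have acYt i : ac_increments t (fun a b => `|(Y b i).1 - (Y a i).1|) /\
    ac_increments t (fun a b => `|(Y b i).2 - (Y a i).2|).
  by have [h1 h2] := acY i; split; [exact: ac_increments_S h1|exact: ac_increments_S h2].
apply: (le_trans (energy_descent C0 CE0 regular hlip' t0 K0 im m0 WY acYt _)).
  move: dY; apply: filterS; first exact: (ae_filter_ringOfSetsType mu).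
  move=> s Hs /andP[s0 st]; apply: Hs; first by rewrite s0 (lt_le_trans st).
  by apply: before; rewrite (ltW s0).
rewrite lerD2l ler_wpM2l ?lerB ?le_refl//.
  by rewrite mulr_ge0// divr_ge0// mulr_ge0// ltW.
have hm s : `|m s| <= m s by rewrite ger0_norm.
by have := Iint_incr_le im im hm tT; rewrite -subr_ge0 => /(le_trans _); apply; rewrite normr_ge0.
Qed.

(** At a first exit the energy would be at least [e1] and at most [e0]. *)
Lemma stays_in_tube t : 0 <= t <= T -> tube (Y t) /\ energy (Y t) <= e0.
Proof.
have [inT|[u [/andP[u0 uT] before cu nu]]] := first_exit aOm M0 ac_cdist_continuous Y0.
  move=> tT; have tt := inT t tT; split; first exact: tt.
  apply: (energy_le tT); last exact: subset_closure tt.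
  move=> u /andP[u0 ut]; apply: inT; rewrite u0 (le_trans (ltW ut)); first by [].
  by case/andP: tT.
have uT' : 0 <= u <= T by rewrite (ltW u0).
have := le_trans (exit_energy M0 inside e1_gap cu nu) (energy_le uT' before cu).
by rewrite leNgt e01.
Qed.

End Invariance.

(** * Existence and uniqueness for the controlled system *)

Section ControlledFlow.
Variables (R : realType) (Om : domain R) (N : nat) (r : R).
Variable rd : lattice_reduction Om.
Hypothesis aOm : admissible Om.
Hypothesis N0 : (0 < N)%N.
Hypothesis M0 : minimizers Om N !=set0.
Hypothesis distinct : forall X, closure (tube Om N r) X -> pairwise_distinct X.
Hypothesis inside : closure (tube Om N r) `<=` configs Om N.
Hypothesis pts0 : points Om !=set0.
Notation mu := (@lebesgue_measure R).
Notation intble h := (mu.-integrable setT (EFin \o h)).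
Notation tube := (tube Om N r).
Variables (C T K L : R) (e0 e1 : R) (X0 : config Om N) (v : R -> R * R -> R * R).
Variables (G : set (measurableTypeR R)) (m : R -> R).
Notation chi := (@chi R Om N r e0 e1).
Hypothesis C0 : 0 <= C.
Hypothesis regular : regular_on (closure tube) C.
Hypothesis T0 : 0 < T.
Hypothesis K0 : 0 < K.
Hypothesis e01 : e0 < e1.
Hypothesis e1_gap : ((e1 - min_energy Om N)%:E <= energy_gap Om N r)%E.
Hypothesis L0 : 0 <= L.
Hypothesis chiL : forall (X Y : config Om N) e, sup_close X Y e -> `|chi X - chi Y| <= L * e.
Hypothesis mG : measurable G.
Hypothesis GT : G `<=` `]0, T[.
Hypothesis GT_ae : {ae mu, forall t : R, 0 < t < T -> G t}.
Hypothesis m0 : forall t, 0 <= m t.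
Hypothesis mG0 : forall t, ~ G t -> m t = 0.
Hypothesis im : intble m.
Hypothesis v_bd : forall t x, G t -> points Om x -> enorm (v t x) <= m t.
Hypothesis v_lip : forall t x y, G t -> points Om x -> points Om y ->
  enorm (v t x - v t y) <= m t * pdist Om x y.
Hypothesis v_meas : forall (w : R -> R) (y : R -> R * R),
  (forall f, C01 Om f -> measurable_fun [set: measurableTypeR R] (fun t => w t * (f (y t)).1) /\
     measurable_fun [set: measurableTypeR R] (fun t => w t * (f (y t)).2)) ->
  (forall t, w t != 0 -> points Om (y t)) ->
  measurable_fun G (fun t => w t * (v t (y t)).1) /\
  measurable_fun G (fun t => w t * (v t (y t)).2).
Hypothesis tX0 : tube X0.
Hypothesis budget : energy X0 + N%:R * (C / (2 * K)) * (Iint m T - Iint m 0) <= e0.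

Let alpha t : R := K * m t.

Let tube_closure X : tube X -> closure tube X.
Proof. exact: subset_closure. Qed.

Lemma coord_enorm b (p : R * R) : `|coord b p| <= enorm p.
Proof. by case: b; [exact: enorm_ge2|exact: enorm_ge1]. Qed.

Lemma coordB b (p q : R * R) : coord b p - coord b q = coord b (p - q).
Proof. by case: b. Qed.

Let d_bd X i b : tube X -> `|coord b (displacement X i)| <= C.
Proof. by move=> /tube_closure /regular[/(_ i)[_ _ h1 h2] _]; case: b. Qed.

(** Regularity covers [e <= 1]; beyond that the two displacements together are at most [2 * C],
    whence the doubled constant. *)
Let d_lip (X Y : config Om N) e i b : tube X -> tube Y -> sup_close X Y e ->
  `|coord b (displacement X i) - coord b (displacement Y i)| <= 2 * C * e.
Proof.
move=> tX tY XY; have e00 : 0 <= e by have [h _] := XY i; exact: le_trans h.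
have [e_le1|/ltW e_ge1] := leP e 1.
  have [_ H] := regular (tube_closure tX).
  have [/(_ i)[_ h1 h2] _] := H Y e (tube_closure tY) XY e_le1.
  have Ce : C * e <= 2 * C * e by rewrite -mulrA ler_peMl ?mulr_ge0// ler1n.
  by case: b; exact: le_trans Ce.
apply: (le_trans (ler_normB _ _)); apply: (le_trans (lerD (d_bd i b tX) (d_bd i b tY))).
rewrite (_ : C + C = 2 * C); last by ring.
by rewrite ler_peMr// mulr_ge0.
Qed.

Lemma sup_close_enorm (X Y : config Om N) e (i : 'I_N) : sup_close X Y e -> enorm (X i - Y i) <= 2 * e.
Proof.
by move=> /(_ i)[h1 h2]; rewrite (le_trans (enorm_le_add _))// mulr_natl mulr2n lerD.
Qed.

Let v_coord_bd t X i b : G t -> tube X -> `|coord b (v t (X i))| <= m t.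
Proof. by move=> Gt [cX _]; apply: (le_trans (coord_enorm _ _)); exact: v_bd. Qed.

Let v_coord_lip t (X Y : config Om N) e i b : G t -> tube X -> tube Y -> sup_close X Y e ->
  `|coord b (v t (X i)) - coord b (v t (Y i))| <= 2 * m t * e.
Proof.
move=> Gt [cX _] [cY _] XY; rewrite coordB; apply: (le_trans (coord_enorm _ _)).
apply: (le_trans (v_lip Gt (cX i) (cY i))); rewrite (mulrC 2) -mulrA; apply: ler_wpM2l; first exact: m0.
exact: le_trans (pdist_le_enorm _ _ _) (sup_close_enorm i XY).
Qed.

Let chiM := @chiM_lip R Om N r N0 e0 e1 L.

Let chi_product (M Lf : R) (f : config Om N -> R) : 0 <= M -> 0 <= Lf ->
  (forall X, tube X -> `|f X| <= M) ->
  (forall X Y e, tube X -> tube Y -> sup_close X Y e -> `|f X - f Y| <= Lf * e) ->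
  forall X Y e, sup_close X Y e -> `|chi X * f X - chi Y * f Y| <= (M * L + Lf) * e.
Proof. by move=> M_0 Lf0 fM fL X Y e; exact: (chiM M_0 chiL fM fL Lf0). Qed.

Let v_coord_meas (x : R -> 'I_N * bool -> R) i b : (forall ib, continuous (x^~ ib)) ->
  measurable_fun G (fun t => chi (config_of (x t)) * coord b (v t (config_of (x t) i))).
Proof.
move=> cx; have [] := @v_meas (fun t => chi (config_of (x t))) (fun t => config_of (x t) i) _ _.
- move=> f cf; have F0 : 0 <= fine (C01_norm Om f) by rewrite fine_ge0// C01_norm_ge0.
  have H bo : measurable_fun [set: measurableTypeR R]
      (fun t => chi (config_of (x t)) * coord bo (f (config_of (x t) i))).
    apply: continuous_measurable_fun.
    apply: (@sup_lip_continuous R N (fun X => chi X * coord bo (f (X i)))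
        (fine (C01_norm Om f) * L + 2 * fine (C01_norm Om f))) => //.
      by rewrite addr_ge0// mulr_ge0.
    apply: chi_product => [||X [cX _]|X Y e [cX _] [cY _] XY]; [exact: F0|exact: mulr_ge0| |].
      by apply: (le_trans (coord_enorm _ _)); exact: (C01_bound pts0 cf (cX i)).
    rewrite coordB; apply: (le_trans (coord_enorm _ _)).
    apply: (le_trans (C01_lip rd pts0 cf (cX i) (cY i))); rewrite (mulrC 2) -mulrA; apply: ler_wpM2l => //.
    exact: le_trans (pdist_le_enorm _ _ _) (sup_close_enorm i XY).
  by split; [exact: (H false)|exact: (H true)].
- by move=> t /chi_neq0 [cX _]; exact: cX.
- by case: b.
Qed.

Notation curve := (cutoff_curve chi (@displacement R Om N) v m K T X0).

Lemma curve_exists : exists Y, curve Y.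
Proof.
exact: (cutoff_exists L0 C0 (ltW K0) (@chi_itv R Om N r e0 e1) (@chi_neq0 R Om N r e0 e1) chi_product
  d_bd d_lip mG GT GT_ae m0 mG0 im v_coord_bd v_coord_lip v_coord_meas).
Qed.

Lemma curve_unique (Y Z : R -> config Om N) : curve Y -> curve Z -> forall t, 0 <= t <= T -> Y t = Z t.
Proof.
exact: (cutoff_unique L0 C0 (ltW K0) (@chi_itv R Om N r e0 e1) (@chi_neq0 R Om N r e0 e1) chi_product
  d_bd d_lip mG GT GT_ae m0 mG0 im v_coord_bd v_coord_lip v_coord_meas T0).
Qed.

Let sqr_velocity t (Y : config Om N) i : G t -> tube Y -> (v t (Y i)).1 ^+ 2 + (v t (Y i)).2 ^+ 2 <= m t ^+ 2.
Proof.
move=> Gt [cY _]; rewrite (_ : _ + _ = enorm (v t (Y i)) ^+ 2).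
  apply: lerXn2r; rewrite ?nnegrE ?enorm_ge0//.
  exact: v_bd.
by rewrite /enorm sqr_sqrtr /dot ?addr_ge0 -?expr2 ?sqr_ge0.
Qed.

Lemma curve_stays (Y : R -> config Om N) : curve Y -> forall t, 0 <= t <= T -> tube (Y t) /\ energy (Y t) <= e0.
Proof.
move=> [Y0 acY dY] t tT.
apply: (stays_in_tube rd aOm N0 M0 inside C0 regular K0 im m0 e01 e1_gap acY _ _ _ tT).
- by rewrite Y0.
- by rewrite Y0.
move: dY GT_ae; apply: filterS2; first exact: (ae_filter_ringOfSetsType mu).
move=> s ds Gs sT tY; exists (chi (Y s)), (fun i => v s (Y s i)); split; first exact: chi_itv.
move=> i; have d1 := ds sT i false; have d2 := ds sT i true; split=> //.
exact: sqr_velocity (Gs sT) tY.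
Qed.

Lemma curve_solution (Y : R -> config Om N) : curve Y -> solution T v alpha X0 Y.
Proof.
move=> cY; have st := curve_stays cY; have [Y0 acY dY] := cY; split=> //.
- by move=> i; apply/absolutely_continuousP; exact: acY.
- by move=> t /st[tY _]; split; [case: tY|exact: distinct (tube_closure tY)].
move: dY; apply: filterS; first exact: (ae_filter_ringOfSetsType mu).
move=> t dt tT i; have [] := st t _; first by case/andP: tT => ? ?; rewrite !ltW.
move=> tY eY; have d1 := dt tT i false; have d2 := dt tT i true.
rewrite (chi_eq1 e01 tY eY) !mul1r in d1 d2.
have := is_derive_pair d1 d2; rewrite (_ : (_, _) = v t (Y t i) + alpha t *: displacement (Y t) i)//.
Qed.

(** A solution is not assumed to remain in the tube; the descent with [c = 1] proves it, and then
    [chi] is [1] along it. Uniqueness is thereby inherited from the cut-off system. *)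
Lemma solution_curve (Y : R -> config Om N) : solution T v alpha X0 Y -> curve Y.
Proof.
move=> [acY Y0 _ dY].
have acY' i : ac_increments T (fun a b => `|(Y b i).1 - (Y a i).1|) /\
    ac_increments T (fun a b => `|(Y b i).2 - (Y a i).2|).
  by apply/(absolutely_continuousP T (fun t => Y t i)).
have dY' : {ae mu, forall t : R, 0 < t < T -> forall i b, is_derive t (1 : R) (fun s => coord b (Y s i))
     (coord b (v t (Y t i)) + K * m t * coord b (displacement (Y t) i))}.
  move: dY; apply: filterS; first exact: (ae_filter_ringOfSetsType mu).
  by move=> t dt tT i b; have [d1 d2] := is_derive_coords (dt tT i); case: b.
have st t : 0 <= t <= T -> tube (Y t) /\ energy (Y t) <= e0.
  move=> tT.
  apply: (stays_in_tube rd aOm N0 M0 inside C0 regular K0 im m0 e01 e1_gap acY' _ _ _ tT).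
  - by rewrite Y0.
  - by rewrite Y0.
  move: dY' GT_ae; apply: filterS2; first exact: (ae_filter_ringOfSetsType mu).
  move=> s ds Gs sT tY; exists 1, (fun i => v s (Y s i)); split; first by rewrite ler01 lexx.
  move=> i; have d1 := ds sT i false; have d2 := ds sT i true; rewrite !mul1r; split=> //.
  exact: sqr_velocity (Gs sT) tY.
split=> //.
move: dY'; apply: filterS; first exact: (ae_filter_ringOfSetsType mu).
move=> t dt tT i b; have [] := st t _; first by case/andP: tT => ? ?; rewrite !ltW.
by move=> tY eY; rewrite (chi_eq1 e01 tY eY) mul1r; exact: dt.
Qed.

Lemma controlled_flow : exists X : R -> config Om N, [/\ solution T v alpha X0 X,
  forall Y, solution T v alpha X0 Y -> forall t, 0 <= t <= T -> Y t = X t &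
  forall t, 0 <= t <= T -> tube (X t)].
Proof.
have [X cX] := curve_exists; exists X; split; first exact: curve_solution.
  by move=> Y /solution_curve cY; exact: curve_unique.
by move=> t /(curve_stays cX)[].
Qed.

End ControlledFlow.

(** The gap is [+oo] when the lateral boundary is empty, and then any level above [E] will do. *)
Lemma energy_level (R : realType) (E F : R) (g : \bar R) : ((E - F)%:E < g)%E ->
  exists2 e1, E < e1 & ((e1 - F)%:E <= g)%E.
Proof.
case: g => [g| |]; rewrite ?ltNye //; last by exists (E + 1); rewrite ?ltrDl ?leey.
by rewrite lte_fin ltrBlDr => h; exists (g + F) => //; rewrite lee_fin addrK.
Qed.

Lemma gain_choice (R : realType) (A d : R) : 0 <= A -> 0 < d -> exists2 K : R, 0 < K & A / (2 * K) <= d.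
Proof.
move=> A0 d0; have q : 0 < A / d + 1 by rewrite ltr_wpDl// divr_ge0// ltW.
exists (A / d + 1) => //; rewrite ler_pdivrMr ?mulr_gt0//.
rewrite (_ : d * (2 * (A / d + 1)) = 2 * A + 2 * d); last by field; rewrite gt_eqF.
by lra.
Qed.

Unset Implicit Arguments.

Theorem theorem3p1 (R : realType) (Om : domain R) (N : nat) (T r C1 : R)
    (v : R -> R * R -> R * R)
    (hOm : admissible Om) (hN : (0 < N)%N) (hT : 0 < T) (hr : 0 < r)
    (hM0 : minimizers Om N !=set0) (hM : compact (minimizers Om N))
    (hr_distinct : forall X, closure (tube Om N r) X -> pairwise_distinct X)
    (hr_inside : closure (tube Om N r) `<=` configs Om N)
    (hC1 : 0 < C1)
    (hD : forall X, tube Om N r X -> max_diam X <= C1 * mesh_size Om N)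
    (hv : L1_C01 Om T v)
    (hvn : {ae lebesgue_measure, forall t : R, 0 < t < T ->
              tangential Om (v t)}) :
  (0 < energy_gap Om N r)%E /\
  forall X0 : config Om N,
    tube Om N r X0 ->
    ((energy X0 - min_energy Om N)%:E < energy_gap Om N r)%E ->
    exists alpha : R -> R,
      [/\ forall t, 0 < t < T -> 0 <= alpha t,
          lebesgue_measure.-integrable `]0, T[ (EFin \o alpha) &
          exists X : R -> config Om N,
            [/\ solution T v alpha X0 X,
                forall Y, solution T v alpha X0 Y ->
                  forall t, 0 <= t <= T -> Y t = X t,
                forall t, 0 <= t <= T -> tube Om N r (X t) &
                forall t, 0 <= t <= T ->
                  max_diam (X t) <= C1 * mesh_size Om N]].
Proof.
have [rd _] := reduction_exists hOm.
have pts0 : points Om !=set0.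
  by have [X [cX _]] := hM0; exists (X (Ordinal hN)); exact: cX.
split; first exact: energy_gap_gt0 rd hOm hN hr hM0 hr_inside.
move=> X0 tX0 /energy_level[e1 E1 e1_gap].
have [e0 [E0 e01]] : exists e0, energy X0 < e0 /\ e0 < e1.
  by exists ((energy X0 + e1) / 2); have [] := midf_lt E1.
have [s s0 spaced] := tube_well_spaced rd hOm hr_distinct hr_inside.
have [C C0 reg] := voronoi_regular rd hN s0.
have regular : regular_on (closure (tube Om N r)) C.
  by move=> X /spaced /reg[bX HX]; split=> // Y e /spaced; exact: HX.
have [G [m [[mG GT GT_ae m0 mG0] [im v_bd v_lip v_meas]]]] := velocity_majorant rd pts0 hv.
have [L L0 chiL] := chi_lip rd hOm hN hM0 hr_inside e01 e1_gap.
have m_mono : 0 <= Iint m T - Iint m 0.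
  have hm t : `|m t| <= m t by rewrite ger0_norm.
  by apply: le_trans (Iint_incr_le im im hm (ltW hT)).
(* The gain is fixed so that the total energy growth allowed by the descent fits between the initial
   energy and [e0]. *)
have [K K0 HK] := @gain_choice R (N%:R * C * (Iint m T - Iint m 0)) (e0 - energy X0)
  (mulr_ge0 (mulr_ge0 (ler0n R N) C0) m_mono) (ltac:(by rewrite subr_gt0)).
have budget : energy X0 + N%:R * (C / (2 * K)) * (Iint m T - Iint m 0) <= e0.
  rewrite -lerBrDl; apply: le_trans HK; rewrite le_eqVlt; apply/orP; left; apply/eqP.
  by field; rewrite gt_eqF.
have [X [solX uniqX tX]] := controlled_flow rd hOm hN hM0 hr_distinct hr_inside pts0 C0 regular
  hT K0 e01 e1_gap L0 chiL mG GT GT_ae m0 mG0 im v_bd v_lip v_meas tX0 budget.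
exists (fun t => K * m t); split.
- by move=> t _; rewrite mulr_ge0// ltW.
- by apply: (integrableS measurableT) (intbleZ K im).
- by exists X; split=> // t tT; apply: hD; exact: tX.
Qed.
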